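(* Let $k\ge 1$ and let $F:P_k\to\mathscr E'(\mathbb R)$ be a mapping that does not vanish identically and satisfies the support, span, translation invariance and dilation invariance conditions. Then there is a non-negative integer $n$ such that for all $(a_0,\ldots,a_k)\in P_{k,e}$, $F(a_0,\ldots,a_k)$ is a constant, non-zero multiple of the $n$th distributional derivative of the B-spline function $N(a_{k_\ell},a_{k_\ell+1},\ldots,a_{k_r})$ of order $k_r-k_\ell$ with respect to the points $a_{k_\ell},a_{k_\ell+1},\ldots,a_{k_r}$.
   Context: $\mathscr E'(\mathbb R)$ is the space of compactly supported (complex-valued) distributions on $\mathbb R$, the dual of $\mathscr E(\mathbb R)=C^\infty(\mathbb R)$; $D$ is the distributional derivative. For a distribution $T$, $T(\cdot-\tau)$ and $T(\cdot/\delta)$ are the translated and dilated distributions (extending the usual operations on functions). For an integer $k\ge1$, $P_k=\{(a_0,\ldots,a_k)\in\mathbb Q^{k+1}:a_0<a_1<\cdots<a_k\}$. A mapping $F:P_k\to\mathscr E'(\mathbb R)$ satisfies, for all $(a_0,\ldots,a_k)\in P_k$: - the support condition if $\operatorname{supp}F(a_0,\ldots,a_k)\subseteq[a_0,a_k]$; - the span condition if for all $a\in\bigcup_{j=0}^{k-1}(a_j,a_{j+1})\cap\mathbb Q$, with $(\alpha_0,\ldots,\alpha_{k+1})$ the increasing rearrangement of $\{a_0,\ldots,a_k,a\}$, one has $F(a_0,\ldots,a_k)\in\operatorname{span}\{F(\alpha_0,\ldots,\alpha_k),F(\alpha_1,\ldots,\alpha_{k+1})\}$; - translation invariance if $F(a_0+\tau,\ldots,a_k+\tau)\in\operatorname{span}\{F(a_0,\ldots,a_k)(\cdot-\tau)\}$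 for all $\tau\in\mathbb Q$; - dilation invariance if $F(\delta a_0,\ldots,\delta a_k)\in\operatorname{span}\{F(a_0,\ldots,a_k)(\cdot/\delta)\}$ for all positive $\delta\in\mathbb Q$. If such an $F$ satisfies all four conditions and is not identically zero, then $F(0,1,\ldots,k)\ne0$, and one defines $k_\ell$ as the largest integer $i$ such that $F(0,1,\ldots,k)$ vanishes identically on $(-\infty,i)$, and $k_r$ as the smallest integer $i$ such that $F(0,1,\ldots,k)$ vanishes identically on $(i,\infty)$; one has $0\le k_\ell\le k_r\le k$. Let $Z$ be the set of all $(a_0,\ldots,a_k)\in\mathbb Z^{k+1}$ with $a_0<\cdots<a_k$ such that $a_j-a_{j-1}=1$ for all $j=1,\ldots,k_\ell$ and for all $j=k_r+1,\ldots,k$. Put $P_{k,e}=\{\lambda(a_0,\ldots,a_k):\lambda\in\mathbb Q,\ \lambda>0,\ (a_0,\ldots,a_k)\in Z\}\subset P_k$. B-splines: $N(a)=\delta_a$ (Dirac distribution at $a$) is the B-spline of order $0$; $N(a_0,a_1)$ is the characteristic function of $(a_0,a_1]$ (order $1$); and for $\rho\ge2$ and $a_0<\cdots<a_\rho$ the B-spline of order $\rho$ is $N(a_0,\ldots,a_\rho;t)=\frac{t-a_0}{a_{\rho-1}-a_0}N(a_0,\ldots,a_{\rho-1};t)+\frac{a_\rho-t}{a_\rho-a_1}N(a_1,\ldots,a_\rho;t)$, identified with the distribution it induces. *)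

(* Defs.v *)
From HB Require Import structures.
From mathcomp Require Import all_boot all_order all_algebra.
From mathcomp Require Import all_classical all_reals all_analysis.
From mathcomp.real_closed Require Import complex.

Set Implicit Arguments.
Unset Strict Implicit.
Unset Printing Implicit Defensive.

Import Order.TTheory GRing.Theory Num.Theory numFieldNormedType.Exports.
Local Open Scope classical_set_scope.
Local Open Scope complex_scope.
Local Open Scope ring_scope.

Section smooth_functions.
Variable R : realType.
Implicit Types f g : R -> R[i]^o.

Definition re_part f : R -> R := fun x => complex.Re (f x).
Definition im_part f : R -> R := fun x => complex.Im (f x).

(* The library has no normed R-module structure on R[i], so functions of a
   real variable with complex values are differentiated componentwise. *)
Definition cderivable f :=
  forall x, derivable (re_part f) x 1 /\ derivable (im_part f) x 1.

Definition cderive f : R -> R[i]^o :=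
  fun x => derive1 (re_part f) x +i* derive1 (im_part f) x.

Definition smooth : {pred R -> R[i]^o} :=
  [pred f | `[< forall n, cderivable (iter n cderive f) >]].

Lemma smoothP f :
  reflect (forall n, cderivable (iter n cderive f)) (f \in smooth).
Proof. exact: asboolP. Qed.

Lemma is_derive_lin (a b : R) (u v w : R -> R) (x du dv dw : R) :
  is_derive x 1 u du -> is_derive x 1 v dv -> is_derive x 1 w dw ->
  is_derive x 1 (fun t => a * u t + b * v t + w t) (a * du + b * dv + dw).
Proof.
move=> hu hv hw.
have h1 := is_deriveZ a hu; have h2 := is_deriveZ b hv.
exact: (is_deriveD (is_deriveD h1 h2) hw).
Qed.

Lemma re_part_lin (c : R[i]) f g : re_part (c *: f + g) = fun t =>
  complex.Re c * re_part f t + (- complex.Im c) * im_part f t + re_part g t.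
Proof.
apply/funext => x; rewrite /re_part /im_part !fctE mulNr.
by case: c => a b; case: (f x) => u v; case: (g x) => u' v'.
Qed.

Lemma im_part_lin (c : R[i]) f g : im_part (c *: f + g) = fun t =>
  complex.Re c * im_part f t + complex.Im c * re_part f t + im_part g t.
Proof.
apply/funext => x; rewrite /re_part /im_part !fctE.
by case: c => a b; case: (f x) => u v; case: (g x) => u' v'.
Qed.

Lemma is_derive_cderivable f : cderivable f -> forall x : R,
  is_derive x 1 (re_part f) (complex.Re (cderive f x)) /\
  is_derive x 1 (im_part f) (complex.Im (cderive f x)).
Proof.
by move=> df x; have [rf mf] := df x; rewrite /= !derive1E; split;
  apply: DeriveDef.
Qed.

Lemma is_derive_cderive f g : (forall x : R,
    is_derive x 1 (re_part f) (complex.Re (g x)) /\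
    is_derive x 1 (im_part f) (complex.Im (g x))) ->
  cderivable f /\ cderive f = g.
Proof.
move=> D; split=> [x|]; first by have [[? _] [? _]] := D x.
apply/funext => x; rewrite /cderive !derive1E.
by have [[_ ->] [_ ->]] := D x; case: (g x).
Qed.

Lemma cderivable_lin (c : R[i]) f g : cderivable f -> cderivable g ->
  cderivable (c *: f + g) /\ cderive (c *: f + g) = c *: cderive f + cderive g.
Proof.
move=> df dg; apply: is_derive_cderive => x.
have [rf mf] := is_derive_cderivable df x.
have [rg mg] := is_derive_cderivable dg x.
have := is_derive_lin (complex.Re c) (- complex.Im c) rf mf rg.
have := is_derive_lin (complex.Re c) (complex.Im c) mf rf mg.
by rewrite -re_part_lin -im_part_lin mulNr; case: c => a b; split.
Qed.

Lemma cderivable0 : cderivable 0 /\ cderive 0 = 0.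
Proof.
apply: is_derive_cderive => x.
have -> : re_part 0 = cst 0 by apply/funext.
have -> : im_part 0 = cst 0 by apply/funext.
by split; exact: is_derive_cst.
Qed.

Lemma cderivableZ (c : R[i]) f : cderivable f ->
  cderivable (c *: f) /\ cderive (c *: f) = c *: cderive f.
Proof.
have [d0 e0] := cderivable0 => df.
by have := cderivable_lin c df d0; rewrite e0 !addr0.
Qed.

Lemma smooth_submod_closed : submod_closed smooth.
Proof.
split=> [|c f g /smoothP sf /smoothP sg]; apply/smoothP => n.
  have -> : iter n cderive 0 = 0.
    by elim: n => // n IH; rewrite iterS IH cderivable0.2.
  exact: cderivable0.1.
suff -> : iter n cderive (c *: f + g) =
    c *: iter n cderive f + iter n cderive g.
  exact: (cderivable_lin c (sf n) (sg n)).1.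
by elim: n => // n IH; rewrite !iterS IH (cderivable_lin c (sf n) (sg n)).2.
Qed.

HB.instance Definition _ :=
  GRing.isSubmodClosed.Build _ _ smooth smooth_submod_closed.

Lemma cderivable_affine (d t : R) f : cderivable f ->
  cderivable (fun x => f (d * x + t)) /\
  cderive (fun x => f (d * x + t)) = d%:C *: (fun x => cderive f (d * x + t)).
Proof.
move=> df; apply: is_derive_cderive => x; pose h (y : R) : R := d * y + t.
have hD : is_derive x 1 h d.
  have := is_deriveD (is_deriveZ d (is_derive_id x 1)) (is_derive_cst t x 1).
  by rewrite addr0 [_ *: _]mulr1.
have [rf mf] := is_derive_cderivable df (h x).
have := is_derive1_comp rf hD; have := is_derive1_comp mf hD.
rewrite !fctE -/(h x).
case: (cderive f (h x)) => a b /=; rewrite !mul0r subr0 addr0.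
by rewrite ![_ * d]mulrC.
Qed.

Lemma smooth_affine (d t : R) f :
  f \in smooth -> (fun x => f (d * x + t)) \in smooth.
Proof.
move=> /smoothP sf; apply/smoothP => n.
suff -> : iter n cderive (fun x => f (d * x + t)) =
    (d%:C ^+ n) *: (fun x => iter n cderive f (d * x + t)).
  exact: (cderivableZ _ (cderivable_affine d t (sf n)).1).1.
elim: n => [|n IH]; first by rewrite expr0 scale1r.
have [D1 D2] := cderivable_affine d t (sf n).
by rewrite iterS IH (cderivableZ _ D1).2 D2 scalerA exprSr.
Qed.

Lemma smooth_cderive f : f \in smooth -> cderive f \in smooth.
Proof. by move=> /smoothP sf; apply/smoothP => n; rewrite -iterSr; exact: sf. Qed.

End smooth_functions.

(* E(R), the complex-valued smooth functions on R. *)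
Record testfun (R : realType) := Testfun {
  testfun_val :> R -> R[i]^o;
  _ : testfun_val \in @smooth R
}.

Section testfun_structure.
Variable R : realType.

HB.instance Definition _ := [isSub for @testfun_val R].
HB.instance Definition _ := [Choice of testfun R by <:].
HB.instance Definition _ := [SubChoice_isSubLmodule of testfun R by <:].

Definition jet (phi : testfun R) :
    prod_topology (fun _ : nat => {family compact, R -> R[i]^o}) :=
  fun n => iter n (@cderive R) phi.

(* The usual Frechet topology of E(R): uniform convergence on compact sets of
   the functions and of all their derivatives. *)
HB.instance Definition _ := Topological.copy (testfun R) (initial_topology jet).

Definition test_affine (d t : R) (phi : testfun R) : testfun R :=
  Testfun (smooth_affine d t (valP phi)).

Definition test_derive (phi : testfun R) : testfun R :=
  Testfun (smooth_cderive (valP phi)).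

Definition tsupp (phi : testfun R) : set R := closure [set x | phi x != 0].

End testfun_structure.

Section distributions.
Variable R : realType.
Implicit Types T : testfun R -> R[i]^o.

(* E'(R).  The operations below make sense for, and are defined on, arbitrary
   functionals on E(R). *)
Definition Edual : set (testfun R -> R[i]^o) :=
  [set T : testfun R -> R[i]^o | linear T /\ continuous T].

Definition vanishes_on T (U : set R) := forall phi : testfun R,
  compact (tsupp phi) -> tsupp phi `<=` U -> T phi = 0.

Definition dsupp T : set R :=
  ~` \bigcup_(U in [set U | open U /\ vanishes_on T U]) U.

Definition dspan (s : seq (testfun R -> R[i]^o)) : set (testfun R -> R[i]^o) :=
  [set T | exists c : nat -> R[i], T = \sum_(i < size s) c i *: s`_i].

(* T(. - t) *)
Definition dtranslate (t : R) T : testfun R -> R[i]^o :=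
  fun phi => T (test_affine 1 t phi).

(* T(. / d) for d > 0; the factor d is the Jacobian of x = d * y. *)
Definition ddilate (d : R) T : testfun R -> R[i]^o :=
  fun phi => d%:C * T (test_affine d 0 phi).

Definition dderive T : testfun R -> R[i]^o := fun phi => - T (test_derive phi).

Definition Dirac (a : R) : testfun R -> R[i]^o := fun phi => phi a.

(* The distribution phi |-> \int f phi induced by f. *)
Definition induced_distr (f : R -> R) : testfun R -> R[i]^o := fun phi =>
  (\int[lebesgue_measure]_x (f x * re_part phi x)) +i*
  (\int[lebesgue_measure]_x (f x * im_part phi x)).

(* The value at order 0 is a dummy: that spline is a Dirac distribution. *)
Fixpoint bspline_fun (rho : nat) (a : nat -> R) (t : R) : R :=
  match rho with
  | 0 => 0
  | 1 => \1_`]a 0%N, a 1%N] t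
  | r.+1 => (t - a 0%N) / (a r - a 0%N) * bspline_fun r a t
          + (a r.+1 - t) / (a r.+1 - a 1%N) * bspline_fun r (fun j => a j.+1) t
  end.

(* N(a 0, ..., a rho) *)
Definition bspline (rho : nat) (a : nat -> R) : testfun R -> R[i]^o :=
  if rho is 0 then Dirac (a 0%N) else induced_distr (bspline_fun rho a).

End distributions.

Arguments Edual : clear implicits.

Section knot_sequences.
Variable k : nat.
Implicit Types a : 'rV[rat]_k.+1.

(* P_k *)
Definition knots : set 'rV[rat]_k.+1 :=
  [set a | forall i j : 'I_k.+1, (i < j)%N -> a 0 i < a 0 j].

(* The increasing rearrangement of {a_0, ..., a_k, x}. *)
Definition insert a (x : rat) : 'rV[rat]_k.+2 :=
  \row_(i < k.+2) (sort <=%R (x :: [seq a 0 j | j : 'I_k.+1]))`_i.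

(* (0, 1, ..., k) *)
Definition iota_row : 'rV[rat]_k.+1 := \row_(i < k.+1) i%:R.

(* Z, for k_l = l and k_r = r. *)
Definition Zknots (l r : nat) : set 'rV[int]_k.+1 :=
  [set z | (forall i j : 'I_k.+1, (i < j)%N -> z 0 i < z 0 j) /\
    forall i j : 'I_k.+1, j = i.+1 :> nat -> (j <= l)%N || (r < j)%N ->
      z 0 j - z 0 i = 1].

(* P_{k,e}, for k_l = l and k_r = r. *)
Definition knots_e (l r : nat) : set 'rV[rat]_k.+1 :=
  [set a | exists lambda : rat, 0 < lambda /\
    exists2 z, Zknots l r z & a = lambda *: map_mx intr z].

End knot_sequences.

Arguments knots : clear implicits.

Section conditions.
Variables (R : realType) (k : nat).
Variable F : 'rV[rat]_k.+1 -> testfun R -> R[i]^o.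

Definition support_condition := forall a, knots k a ->
  dsupp (F a) `<=` [set` `[ratr (a 0 ord0) : R, ratr (a 0 ord_max)]].

Definition span_condition := forall a, knots k a -> forall x : rat,
  (exists i j : 'I_k.+1, j = i.+1 :> nat /\ a 0 i < x < a 0 j) ->
  dspan [:: F (col' ord_max (insert a x)); F (col' ord0 (insert a x))] (F a).

Definition translation_invariance := forall a, knots k a -> forall t : rat,
  dspan [:: dtranslate (ratr t) (F a)] (F (a + const_mx t)).

Definition dilation_invariance := forall a, knots k a -> forall d : rat, 0 < d ->
  dspan [:: ddilate (ratr d) (F a)] (F (d *: a)).

(* The default 0 and the absolute value are irrelevant: when F satisfies the
   four conditions above and does not vanish identically on P_k, these extremal
   integers exist and 0 <= k_left <= k_right <= k. *)
Definition k_left : nat :=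
  let A := [set i : int | vanishes_on (F (iota_row k)) [set` `]-oo, i%:~R[]] in
  `|xget 0 (A `&` ubound A)|%N.

Definition k_right : nat :=
  let A := [set i : int | vanishes_on (F (iota_row k)) [set` `]i%:~R, +oo[]] in
  `|xget 0 (A `&` lbound A)|%N.

End conditions.

(* Main.v *)
(* Inserting integer knots expands F(s), for an integer tuple s, into integer
   translates of T = F(0, ..., k); write p(s) for the polynomial of coefficients
   and H_N for that of the dilate T(./N). Linear algebra gives a nonzero c of
   degree at most k such that c p(s) only involves powers z^e with e an entry
   of s. For s = (0, N, ..., kN) this forces c H_N to be proportional to c(z^N),
   so that the nonzero roots of c are closed under powers, hence are roots of
   unity; tuples with entries in one residue class modulo N exclude the roots
   other than 1, and c = z^l (z - 1)^rho. For N = 2 the relation is a dilation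
   equation for the moments of T, which determines them up to a factor:
   T(P^(rho)) is a multiple of the sum of c_j P^(n)(j).
     If s satisfies the conditions defining P_{k,e} for l and l + rho, then
   c p(s) lives on the rho + 1 central entries of s and, being divisible by
   (z - 1)^rho, is a divided difference. So F(s) and the n-th derivative of the
   B-spline are proportional on polynomials, and polynomials are dense in E(R). *)
Require Import Defs.
From HB Require Import structures.
From mathcomp Require Import all_boot all_order all_algebra.
From mathcomp Require Import zify ring.

Set Implicit Arguments.
Unset Strict Implicit.
Unset Printing Implicit Defensive.
Import Order.TTheory GRing.Theory Num.Theory.

(** The translates of a nonzero T in E'(R) by natural numbers are linearly independent, since some
    moment of T is nonzero. So [p s] is unique, and the conditions on F become relations between
    polynomials; their unknown factors may be taken nonzero, as translations and dilations can be
    undone. The k conditions defining c concern the tuples (0, ..., k + 1) with one interior entry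
    removed: inserting every place except e reduces the coefficient of X^e in c p(s) to these. The
    obstacle is that F(s) might vanish for a general s. A widely spaced dilate of (0, ..., k) is
    placed with its l-th entry at s_l and all others outside the range of s; c times its symbol is
    known, and inserting knots relates it to c p(s). Exponents being natural numbers, this needs
    room on the left, whence the assumption k (s_k - s_0 + 1) <= s_l. The order n is the degree of
    the first nonzero moment of T. That l and l + rho are k_l and k_r follows from the form of the
    derivative of T of order rho, a combination of n-th derivatives of Dirac distributions with
    nonzero extreme coefficients, at l and l + rho. *)

Notation nth0 := (nth 0%N).

(** * Symbols of integer knot sequences *)

Section knot_seq.
Variable k : nat.
Implicit Types s : seq nat.

(** Entries are natural numbers because they become exponents of polynomials. A rational tuple is
    brought to this form by a dilation and a translation. *)
Definition knot_seq s := (size s == k.+1) && sorted ltn s.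

Definition insert_knot x s := sort leq (x :: s).

Lemma sorted_ltn_nth s i j : sorted ltn s -> (i < j < size s)%N ->
  (nth0 s i < nth0 s j)%N.
Proof.
move=> ss /andP[ij js]; apply: (sorted_ltn_nth ltn_trans) => //.
exact: ltn_trans js.
Qed.

Lemma knot_seqP s : knot_seq s -> (size s = k.+1)%N * sorted ltn s.
Proof. by case/andP => /eqP. Qed.

Lemma knot_uniq s : knot_seq s -> uniq s.
Proof. by case/knot_seqP => _; exact: (sorted_uniq ltn_trans ltnn). Qed.

Lemma knot_lt s i j : knot_seq s -> (i < j <= k)%N -> (nth0 s i < nth0 s j)%N.
Proof. by move=> /knot_seqP[sz ss] ij; apply: sorted_ltn_nth; rewrite ?sz. Qed.

Lemma knot_le s i j : knot_seq s -> (i <= j <= k)%N -> (nth0 s i <= nth0 s j)%N.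
Proof.
move=> ks /andP[]; rewrite leq_eqVlt => /orP[/eqP->//|ij jk].
by apply/ltnW/knot_lt; rewrite ?ij.
Qed.

Lemma knot_ltE s i j : knot_seq s -> (i <= k)%N -> (j <= k)%N ->
  (nth0 s i < nth0 s j)%N = (i < j)%N.
Proof.
move=> ks ik jk; apply/idP/idP => [|ij]; last by rewrite knot_lt ?ij.
by apply: contraTT; rewrite -!leqNgt => ji; rewrite knot_le ?ji.
Qed.

Lemma knot_bounds s x : knot_seq s -> x \in s -> (nth0 s 0 <= x <= nth0 s k)%N.
Proof.
move=> ks /(nthP 0%N)[i]; rewrite (knot_seqP ks).1 ltnS => ik <-.
by rewrite !knot_le ?ik ?leqnn.
Qed.

Lemma knot_mem s i : knot_seq s -> (i <= k)%N -> nth0 s i \in s.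
Proof. by move=> ks ik; rewrite mem_nth ?(knot_seqP ks).1. Qed.

Lemma knot_mkseq (f : nat -> nat) : (forall i, (i < k)%N -> (f i < f i.+1)%N) ->
  knot_seq (mkseq f k.+1).
Proof.
move=> fS; rewrite /knot_seq size_mkseq eqxx; apply/(sortedP 0%N) => i.
rewrite size_mkseq => ik; rewrite (nth_mkseq _ _ ik) (nth_mkseq _ _ (ltnW ik)).
exact: fS.
Qed.

Lemma insert_knotE s x : knot_seq s -> x \notin s ->
  [/\ size (insert_knot x s) = k.+2, sorted ltn (insert_knot x s)
    & insert_knot x s =i x :: s].
Proof.
move=> ks xs; split.
- by rewrite size_sort /= (knot_seqP ks).1.
- rewrite ltn_sorted_uniq_leq sort_uniq cons_uniq xs (knot_uniq ks) sort_sorted //.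
- exact: mem_sort.
Qed.

(** Each of the two subtuples gives up one end of [s], so the distance between its end points is
    strictly smaller; this makes repeated insertion terminate. *)
Lemma insert_knot_sub s x : knot_seq s -> (nth0 s 0 < x < nth0 s k)%N ->
    x \notin s ->
  let s1 := take k.+1 (insert_knot x s) in let s2 := behead (insert_knot x s) in
  [/\ knot_seq s1, knot_seq s2, {subset s1 <= x :: s} & {subset s2 <= x :: s}] /\
  [/\ nth0 s1 0 = nth0 s 0, (nth0 s1 k < nth0 s k)%N,
      (nth0 s 0 < nth0 s2 0)%N & nth0 s2 k = nth0 s k].
Proof.
move=> ks /andP[x0 xk] xs; have [sz ss es] := insert_knotE ks xs.
set w := insert_knot x s in sz ss es *; move=> s1 s2.
have sub1 : {subset s1 <= w} by move=> y /mem_take.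
have sub2 : {subset s2 <= w} by move=> y /mem_behead.
have w0 : nth0 w 0 = nth0 s 0.
  apply/eqP; rewrite eqn_leq; apply/andP; split.
    have : nth0 s 0 \in w by rewrite es inE knot_mem ?orbT.
    case/(nthP 0%N) => -[|i] iw <- //.
    by apply/ltnW/sorted_ltn_nth => //; rewrite iw.
  have : nth0 w 0 \in w by rewrite mem_nth ?sz.
  by rewrite es inE => /predU1P[->|/(knot_bounds ks)/andP[]//]; exact: ltnW.
have wk : nth0 w k.+1 = nth0 s k.
  apply/eqP; rewrite eqn_leq; apply/andP; split.
    have : nth0 w k.+1 \in w by rewrite mem_nth ?sz.
    by rewrite es inE => /predU1P[->|/(knot_bounds ks)/andP[]//]; exact: ltnW.
  have : nth0 s k \in w by rewrite es inE knot_mem ?orbT.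
  case/(nthP 0%N) => i; rewrite sz ltnS leq_eqVlt => /predU1P[-> <- //|iw <-].
  by apply/ltnW/sorted_ltn_nth => //; rewrite iw sz /=.
split; split.
- by rewrite /knot_seq size_take sz ltnSn eqxx take_sorted.
- rewrite /knot_seq size_behead sz eqxx /=.
  by rewrite /s2 -drop1 drop_sorted.
- by move=> y /sub1; rewrite es.
- by move=> y /sub2; rewrite es.
- by rewrite nth_take.
- by rewrite nth_take // -wk sorted_ltn_nth // sz ltnSn /=.
- by rewrite nth_behead -w0 sorted_ltn_nth // sz.
- by rewrite nth_behead.
Qed.

Lemma knot_seq_eq s t : sorted ltn s -> sorted ltn t -> s =i t -> s = t.
Proof. by move=> *; apply: (irr_sorted_eq ltn_trans ltnn). Qed.

Lemma knot_consecutive s : knot_seq s ->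
  (forall x, (nth0 s 0 < x < nth0 s k)%N -> x \in s) ->
  s = iota (nth0 s 0) k.+1.
Proof.
move=> ks cs.
have le0k : (nth0 s 0 <= nth0 s k)%N by rewrite knot_le ?leqnn.
have sE : s = iota (nth0 s 0) (nth0 s k - nth0 s 0).+1.
  apply: knot_seq_eq; rewrite ?(knot_seqP ks).2 ?iota_ltn_sorted// => x.
  rewrite mem_iota addnS ltnS subnKC //; apply/idP/idP => [/(knot_bounds ks)//|].
  rewrite leq_eqVlt => /andP[/predU1P[<- _|x0]]; first exact: knot_mem.
  rewrite leq_eqVlt => /predU1P[->|xk]; first exact: knot_mem.
  by apply: cs; rewrite x0.
have := congr1 size sE; rewrite size_iota (knot_seqP ks).1 => sz.
by rewrite {1}sE -sz.
Qed.

(** For [0 < i <= k] these are, up to translation, the tuples with exactly one free place. *)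
Definition skip_seq i := [seq x <- iota 0 k.+2 | x != i].

Lemma knot_skip s e : knot_seq s -> (nth0 s 0 < e < nth0 s k)%N -> e \notin s ->
  (forall x, x != e -> (nth0 s 0 < x < nth0 s k)%N -> x \in s) ->
  (0 < e - nth0 s 0 <= k)%N /\
  s = map (addn (nth0 s 0)) (skip_seq (e - nth0 s 0)).
Proof.
move=> ks /andP[e0 ek] es cs; set a := nth0 s 0 in e0 cs *.
have esE : e :: s =i iota a (nth0 s k - a).+1.
  move=> x; rewrite mem_iota inE addnS ltnS subnKC; last by lia.
  apply/idP/idP => [/predU1P[->|/(knot_bounds ks)//]|]; first by lia.
  have [//|xe /=] := eqVneq x e.
  rewrite leq_eqVlt => /andP[/predU1P[<- _|x0]]; first exact: knot_mem.
  rewrite leq_eqVlt => /predU1P[->|xk]; first exact: knot_mem.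
  by apply: cs; rewrite // x0.
have ues : uniq (e :: s) by rewrite /= es (knot_uniq ks).
have sz : (nth0 s k - a).+1 = k.+2.
  have := perm_size (uniq_perm ues (iota_uniq _ _) esE).
  by rewrite size_iota /= (knot_seqP ks).1 => <-.
split; first by lia.
apply: knot_seq_eq; first exact: (knot_seqP ks).2.
  rewrite sorted_map; apply: (@sub_sorted _ ltn); first by move=> x y /=; rewrite ltn_add2l.
  by rewrite sorted_filter ?iota_ltn_sorted //; exact: ltn_trans.
move=> x; apply/idP/mapP => [xs|[y]].
  have /andP[ax xk] := knot_bounds ks xs; exists (x - a)%N; last by lia.
  rewrite mem_filter mem_iota; apply/andP; split; last by lia.
  by apply: contra es => /eqP ?; rewrite (_ : e = x) //; lia.
rewrite mem_filter mem_iota => /andP[ye yk] ->.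
have : (a + y)%N \in e :: s by rewrite esE mem_iota; lia.
by rewrite inE => /predU1P[?|//]; lia.
Qed.

Lemma nodes_uniq s l n : knot_seq s -> l + n <= k.+1 ->
  uniq [seq nth0 s i | i <- iota l n].
Proof.
move=> ks lk; rewrite map_inj_in_uniq ?iota_uniq // => i j; rewrite !mem_iota => iI jI E.
have := knot_ltE ks (i := i) (j := j); have := knot_ltE ks (i := j) (j := i).
by rewrite E !ltnn; lia.
Qed.

(* The tuples that meet the condition on the first [l] and the last [k - r]
   steps in the definition of [Zknots]. *)
Definition clustered l r s :=
  nth0 s l = nth0 s 0 + l /\ nth0 s k = nth0 s r + (k - r).

(* After its [l]-th entry [b], the nodes of this tuple lie in [b - 1 + N * Z]. *)
Lemma residue_knots l rho N : l + rho <= k -> 0 < rho -> 0 < N -> exists s,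
  [/\ knot_seq s, clustered l (l + rho) s,
      k * (nth0 s k - nth0 s 0).+1 <= nth0 s l &
      forall i, l < i <= l + rho -> nth0 s i = nth0 s l + N * (i - l) + N.-1].
Proof.
(* The bracket is [nth0 s k - nth0 s 0 + 1] for the tuple built below, which gives the third
   condition; the summand [l] makes room for the entries before the [l]-th. *)
move=> lk rho0 N0; pose B := k * (l + N * rho + N + (k - (l + rho))) + l.
have lB : l <= B by rewrite leq_addl.
pose f i := if i <= l then B - l + i else
  if i <= l + rho then B + N * (i - l) + N.-1
  else B + N * rho + N.-1 + (i - (l + rho)).
exists (mkseq f k.+1).
have sE i : i <= k -> nth0 (mkseq f k.+1) i = f i by move=> ik; rewrite nth_mkseq.
have s0 : f 0 = B - l by rewrite /f leq0n addn0.
have sl : f l = B by rewrite /f leqnn subnK.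
have sr : f (l + rho) = B + N * rho + N.-1.
  by rewrite /f leqnn addKn ifF //; lia.
have sk : f k = B + N * rho + N.-1 + (k - (l + rho)).
  rewrite /f ifF; last by lia.
  by case: ifP => // kr; have -> : k = l + rho; [lia|]; rewrite addKn subnn addn0.
rewrite /clustered !sE ?leqnn ?(leq_trans (leq_addr rho l)) // sl s0 sr sk; split.
- apply: knot_mkseq => i ik; rewrite /f.
  have [il|il] := leqP i.+1 l; first by rewrite (ltnW il) ltn_add2l.
  have [il'|il'] := leqP i l.
    have -> : i = l by lia.
    rewrite ifT; last by lia.
    by rewrite subSnn; lia.
  have [ir|ir] := leqP i.+1 (l + rho).
    rewrite (ltnW ir) subSn; last exact: ltnW.
    by rewrite mulnS; lia.
  have [ir'|ir'] := leqP i (l + rho); last by lia.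
  have -> : i = l + rho by lia.
  by rewrite addKn; lia.
- by rewrite subnK.
- rewrite (leq_trans _ (leq_addr _ _)) // leq_mul2l; apply/orP; right.
  by move: (N * rho) => u; lia.
- move=> i /andP[li ir]; rewrite sE ?(leq_trans ir) // /f leqNgt li /= ir.
  by [].
Qed.

End knot_seq.

Local Open Scope ring_scope.

(** * Pairing polynomials with sequences *)

Section pairing.
Variables (K : fieldType) (V : lmodType K).
Implicit Types (phi psi : nat -> V) (u v : {poly K}).

(** The linear extension of ['X^i |-> phi i]. With the translates of a distribution as [phi],
    polynomials act by translation; with [phi i = g.[i%:R]], point masses at the integers, weighted
    by the coefficients of [u], are applied to [g]. *)
Definition pairing phi u : V := \sum_(i < size u) u`_i *: phi i.

Lemma pairing_wide n phi u : (size u <= n)%N ->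
  pairing phi u = \sum_(i < n) u`_i *: phi i.
Proof.
move=> un; rewrite /pairing (big_ord_widen n (fun i => u`_i *: phi i)) // big_mkcond.
by apply: eq_bigr => i _; case: ltnP => // ui; rewrite nth_default ?scale0r.
Qed.

Lemma pairing_is_linear phi : linear (pairing phi).
Proof.
move=> a u v; have := leq_maxl (size u) (size v); have := leq_maxr (size u) (size v).
set n := maxn _ _ => vn un; rewrite !(@pairing_wide n) //; last first.
  by rewrite (leq_trans (size_polyD _ _)) // geq_max (leq_trans (size_scale_leq _ _)).
rewrite scaler_sumr -big_split; apply: eq_bigr => i _.
by rewrite coefD coefZ scalerDl scalerA.
Qed.

HB.instance Definition _ phi :=
  GRing.isLinear.Build K {poly K} V _ (pairing phi) (pairing_is_linear phi).

Lemma pairing_Xn phi n : pairing phi 'X^n = phi n.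
Proof.
rewrite /pairing size_polyXn big_ord_recr /= coefXn eqxx scale1r big1 ?add0r // => i _.
by rewrite coefXn ltn_eqF ?scale0r.
Qed.

Lemma eq_pairing phi psi u : phi =1 psi -> pairing phi u = pairing psi u.
Proof. by move=> E; apply: eq_bigr => i _; rewrite E. Qed.

Lemma pairing_lin a phi psi u :
  pairing (fun i => a *: phi i + psi i) u = a *: pairing phi u + pairing psi u.
Proof.
rewrite scaler_sumr -big_split; apply: eq_bigr => i _.
by rewrite scalerDr !scalerA mulrC.
Qed.

Lemma pairing_scale a phi u : pairing (fun i => a *: phi i) u = a *: pairing phi u.
Proof. by rewrite scaler_sumr; apply: eq_bigr => i _; rewrite !scalerA mulrC. Qed.

Lemma pairing_const (x : V) u : pairing (fun=> x) u = u.[1] *: x.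
Proof.
rewrite horner_coef scaler_suml; apply: eq_bigr => i _.
by rewrite expr1n mulr1.
Qed.

Lemma pairing_comp_Xn phi N u : (0 < N)%N ->
  pairing phi (u \Po 'X^N) = pairing (fun i => phi (N * i)%N) u.
Proof.
move=> N0; rewrite -[u]coefK poly_def [in LHS]raddf_sum !linear_sum.
by apply: eq_bigr => i _; rewrite /= comp_polyZ comp_Xn_poly -exprM !linearZ_LR /= !pairing_Xn.
Qed.

Lemma pairingXnM phi n v : pairing phi ('X^n * v) = pairing (fun j => phi (n + j)%N) v.
Proof.
rewrite -[v]coefK poly_def mulr_sumr !linear_sum; apply: eq_bigr => i _.
by rewrite -scalerAr !linearZ_LR /= -exprD !pairing_Xn.
Qed.

Lemma pairingM phi u v :
  pairing phi (u * v) = pairing (fun i => pairing (fun j => phi (i + j)%N) v) u.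
Proof.
rewrite -[u in u * v]coefK poly_def mulr_suml linear_sum; apply: eq_bigr => i _.
by rewrite -scalerAl linearZ_LR /= pairingXnM.
Qed.

End pairing.

Lemma linear_pairing (K : fieldType) (V W : lmodType K) (f : V -> W) phi u :
  linear f -> f (pairing phi u) = pairing (f \o phi) u.
Proof.
move=> f_lin; pose g : {linear V -> W} := HB.pack f (GRing.isLinear.Build K V W _ f f_lin).
by rewrite -[f]/(g : V -> W) linear_sum; apply: eq_bigr => i _; rewrite linearZ_LR.
Qed.

(** * Multiples of (X - 1)^m and the number of their terms *)

Section few_terms.
Variable K : numFieldType.
Implicit Types (u g : {poly K}).

Lemma size_difference g : (size (g \Po ('X + 1) - g)%R <= (size g).-1)%N.
Proof.
have [->|g0] := eqVneq g 0; first by rewrite comp_poly0 subr0 size_poly0.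
have sE : size (g \Po ('X + 1)) = size g.
  by rewrite size_comp_poly2 // -[1]polyC1 size_XaddC.
apply/leq_sizeP => j gj; rewrite coefB.
have [jg|gj'] := ltnP j (size g); last by rewrite !nth_default ?subr0 ?sE.
have -> : j = (size g).-1 by lia.
rewrite -{1}sE -!/(lead_coef _) lead_coef_comp; last by rewrite -[1]polyC1 size_XaddC.
by rewrite -[1]polyC1 lead_coefXaddC expr1n mulr1 subrr.
Qed.

(** A factor ['X - 1] of [u] turns into a forward difference of [g], which lowers the degree; after
    [m] differences nothing is left. *)
Lemma pairing_annihilated m u g : ('X - 1) ^+ m %| u -> (size g <= m)%N ->
  pairing (fun i => g.[i%:R] : K^o) u = 0.
Proof.
elim: m g u => [|m IHm] g u.
  by rewrite leqn0 size_poly_eq0 => _ /eqP->; rewrite /pairing big1 // => i _; rewrite horner0 scaler0.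
move=> /dvdpP[v ->] gm; rewrite exprS mulrCA mulrBl -['X]expr1 mul1r linearB /=.
rewrite pairingXnM -[_ - _]addrC -scaleN1r -pairing_lin.
have sm : (size (g \Po ('X + 1) - g)%R <= m)%N.
  by apply: leq_trans (size_difference _) _; case: (size g) gm.
rewrite -[RHS](IHm _ (v * ('X - 1) ^+ m) (dvdp_mull _ (dvdpp _)) sm).
apply: eq_pairing => i; rewrite hornerD hornerN horner_comp !hornerE natrD.
by rewrite scaleN1r addrC [i%:R + 1]addrC.
Qed.

(** The product of the ['X - x] over the points [x] of [t] other than [e] is an admissible [g], and
    it isolates the coefficient at [e]. *)
Lemma pairing_separates (t : seq nat) u : uniq t ->
  (forall e, e \notin t -> u`_e = 0) ->
  (forall g, (size g <= size t)%N -> pairing (fun i => g.[i%:R] : K^o) u = 0) -> u = 0.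
Proof.
move=> ut ut0 kill; apply/polyP => e; rewrite coef0.
have [et|] := boolP (e \in t); last exact: ut0.
pose g := \prod_(z <- [seq x%:R : K | x <- rem e t]) ('X - z%:P).
have gt : (size g <= size t)%N.
  by rewrite size_prod_XsubC size_map size_rem // prednK //; case: (t) et.
have := kill g gt.
have eu : (e < maxn (size u) e.+1)%N by rewrite leq_max ltnSn orbT.
rewrite (pairing_wide _ (leq_maxl _ e.+1)) (bigD1 (Ordinal eu)) //= big1.
  rewrite addr0 => /eqP; rewrite mulf_eq0 => /orP[/eqP//|].
  rewrite -[_ == 0]/(root g e%:R) root_prod_XsubC => /mapP[x].
  rewrite mem_rem_uniq // inE => /andP[xe _] /eqP; rewrite eqr_nat => /eqP E.
  by rewrite E eqxx in xe.
move=> i; rewrite -val_eqE /= => ie.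
have [it|it] := boolP (val i \in t); last by rewrite ut0 ?scale0r.
have -> : g.[i%:R] = 0; last by rewrite scaler0.
apply/eqP; rewrite -[_ == 0]/(root g i%:R) root_prod_XsubC.
by apply/mapP; exists (val i); rewrite // mem_rem_uniq // inE ie.
Qed.

Lemma pairing_top m u g : ('X - 1) ^+ m %| u -> (size g <= m.+1)%N ->
  pairing (fun i => g.[i%:R] : K^o) u = g`_m *: pairing (fun i => i%:R ^+ m : K^o) u.
Proof.
move=> dvd gm; pose g' := g - g`_m *: 'X^m.
have g'm : (size g' <= m)%N.
  apply/leq_sizeP => j; rewrite leq_eqVlt coefB coefZ coefXn eq_sym.
  have [->|_ /= mj] := eqVneq j m; first by rewrite mulr1 subrr.
  by rewrite mulr0 subr0 nth_default // (leq_trans gm).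
rewrite -[RHS]addr0 -[X in _ = _ + X](pairing_annihilated dvd g'm) -pairing_lin; apply: eq_pairing => i.
rewrite hornerD hornerN hornerZ hornerXn.
by rewrite -[X in X + _]/(g`_m * i%:R ^+ m) addrCA subrr addr0.
Qed.

(** A multiple of [('X - 1) ^+ m] annihilates all degrees below [m], and these are enough to
    separate [m] points. *)
Lemma few_terms m (t : seq nat) u : uniq t -> (size t <= m)%N ->
  (forall e, e \notin t -> u`_e = 0) -> ('X - 1) ^+ m %| u -> u = 0.
Proof.
move=> ut tm ut0 dvd; apply: (pairing_separates ut) => // g gt.
by apply: pairing_annihilated dvd _; exact: leq_trans tm.
Qed.

End few_terms.

(* Induction on the length: points of [A] are inserted until no place is free. *)
Lemma insertion_ind (K : fieldType) (V : lmodType K) (k : nat) (p : seq nat -> V) (A : pred nat) (Q : V -> Prop) :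
  (forall s x, knot_seq k s -> (nth0 s 0 < x < nth0 s k)%N -> x \notin s ->
    exists a b : K, p s = a *: p (take k.+1 (insert_knot x s)) +
                          b *: p (behead (insert_knot x s))) ->
  Q 0 -> (forall a f g, Q f -> Q g -> Q (a *: f + g)) ->
  (forall s, knot_seq k s -> all A s ->
    (forall x, A x -> (nth0 s 0 < x < nth0 s k)%N -> x \in s) -> Q (p s)) ->
  forall s, knot_seq k s -> all A s -> Q (p s).
Proof.
move=> p_insert Q0 Qlin Qc s; have [n] := ubnP (nth0 s k - nth0 s 0).
elim: n s => // n IHn s sn ks As.
case: (boolP (all [pred x | A x ==> (x \in s)]
  (iota (nth0 s 0).+1 (nth0 s k - (nth0 s 0).+1)))).
  move=> /allP cs; apply: Qc => // x Ax x0k.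
  by have := cs x; rewrite mem_iota /= Ax; apply; lia.
rewrite -has_predC => /hasP[x]; rewrite mem_iota /= negb_imply => xI /andP[Ax xs].
have x0k : (nth0 s 0 < x < nth0 s k)%N by lia.
have [[k1 k2 sub1 sub2] [e1 l1 l2 e2]] := insert_knot_sub ks x0k xs.
have Axs : {subset x :: s <= A}.
  by move=> y; rewrite inE => /predU1P[->//|]; exact: (allP As).
have [a [b ->]] := p_insert _ _ ks x0k xs.
apply: (Qlin); last rewrite -[_ *: _]addr0; last apply: (Qlin) => //.
  by apply: IHn => //; [lia|apply/allP => y /sub1/Axs].
by apply: IHn => //; [lia|apply/allP => y /sub2/Axs].
Qed.

(** * The annihilator of the symbols and its roots *)

Section combinatorics.
Variables (K : numClosedFieldType) (k : nat).
Implicit Types (s : seq nat) (f g : {poly K}).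

Definition supp_in (A : pred nat) f := forall e, ~~ A e -> f`_e = 0.

Lemma supp_in0 A : supp_in A 0.
Proof. by move=> e _; rewrite coef0. Qed.

Lemma supp_in_lin A a f g : supp_in A f -> supp_in A g -> supp_in A (a *: f + g).
Proof. by move=> fA gA e eA; rewrite coefD coefZ fA // gA // mulr0 addr0. Qed.

Lemma supp_inW (A B : pred nat) f : (forall e, A e -> B e) -> supp_in A f -> supp_in B f.
Proof. by move=> AB fA e eB; apply: fA; apply: contra eB; exact: AB. Qed.

(* When [size a <= N], the coefficients of [a * (X \Po 'X^N)] are consecutive
   blocks of length [N], the [i]-th of which is [X`_i *: a]. *)
Lemma comp_Xn_separate N (a b X Y : {poly K}) : (size a <= N)%N -> (size b <= N)%N ->
  a * (X \Po 'X^N) = b * (Y \Po 'X^N) -> forall i, X`_i *: a = Y`_i *: b.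
Proof.
have [->|N0] := posnP N.
  by rewrite !leqn0 !size_poly_eq0 => /eqP-> /eqP-> _ i; rewrite !scaler0.
have coefE (c Z : {poly K}) i j : (size c <= N)%N -> (j < N)%N ->
    (c * (Z \Po 'X^N))`_(i * N + j) = c`_j * Z`_i.
  move=> cN jN; rewrite coefM (bigD1 (inord j)) //= inordK ?ltnS ?leq_addl //.
  rewrite addnK coef_comp_poly_Xn // dvdn_mull // mulnK // big1 ?addr0 // => m.
  rewrite -val_eqE /= inordK ?ltnS ?leq_addl // => mj.
  have [mN|Nm] := ltnP m N; last by rewrite nth_default ?mul0r ?(leq_trans cN).
  rewrite coef_comp_poly_Xn //; case: ifP => [/dvdnP[q qE]|]; last by rewrite mulr0.
  have := ltn_ord m; rewrite ltnS => mi.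
  have : (i * N + j = q * N + m)%N by rewrite -qE subnK.
  move=> /(congr1 (modn^~ N)); rewrite !modnMDl !modn_small // => jm.
  by case/eqP: mj.
move=> aN bN E i; apply/polyP => j; rewrite !coefZ.
have [jN|Nj] := ltnP j N; last first.
  by rewrite [a`_j]nth_default 1?[b`_j]nth_default ?mulr0 //; apply: leq_trans Nj.
by rewrite ![_`_i * _]mulrC -!coefE // E.
Qed.

Variable p : seq nat -> {poly K}.
Variable H : nat -> {poly K}.
Hypothesis p_insert : forall s x, knot_seq k s ->
  (nth0 s 0 < x < nth0 s k)%N -> x \notin s -> exists a b : K,
  p s = a *: p (take k.+1 (insert_knot x s)) + b *: p (behead (insert_knot x s)).
Hypothesis p_translate : forall s t, knot_seq k s -> exists2 a : K, a != 0 &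
  p (map (addn t) s) = a *: ('X^t * p s).
Hypothesis p_iota : p (iota 0 k.+1) = 1.
Hypothesis p_dilate : forall N, (0 < N)%N -> exists2 a : K, a != 0 &
  p (map (muln N) (iota 0 k.+1)) = a *: H N.
Hypothesis H_neq0 : forall N, (0 < N)%N -> H N != 0.
(** Dilating by [N] and then by [M] is dilating by [M * N]; the second dilation spreads the
    translates by the factor [M], whence the substitution of ['X^M]. *)
Hypothesis H_mul : forall M N, (0 < M)%N -> (0 < N)%N ->
  H (M * N) = H M * (H N \Po 'X^M).

Lemma knot_iota j : knot_seq k (iota j k.+1).
Proof. by rewrite /knot_seq size_iota eqxx iota_ltn_sorted. Qed.

Lemma p_iotaE j : exists2 a : K, a != 0 & p (iota j k.+1) = a *: 'X^j.
Proof.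
have [a a0] := p_translate j (knot_iota 0).
by rewrite -iotaDl addn0 p_iota mulr1; exists a.
Qed.

(** Inserting every integer between the ends leaves only tuples [a, ..., a + k] inside [[s_0, s_k]],
    and each contributes a multiple of ['X^a]. *)
Lemma p_supp s : knot_seq k s ->
  supp_in [pred e | (nth0 s 0 <= e) && (e + k <= nth0 s k)]%N (p s).
Proof.
move=> ks; set Q := supp_in _.
apply: (insertion_ind (A := [pred x | (nth0 s 0 <= x <= nth0 s k)%N]) (Q := Q) p_insert) => //.
- exact: supp_in0.
- exact: supp_in_lin.
- move=> t kt /allP st ct; have t0 := st _ (knot_mem kt (leq0n k)).
  have tk := st _ (knot_mem kt (leqnn k)).
  have tE : t = iota (nth0 t 0) k.+1.
    by apply: knot_consecutive => // x x0k; apply: ct => //=; simpl in *; lia.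
  have tkE : nth0 t k = (nth0 t 0 + k)%N by rewrite {1}tE nth_iota.
  have [a _] := p_iotaE (nth0 t 0); rewrite -tE => -> e.
  rewrite /= coefZ coefXn => eI; case: eqP => [?|]; last by rewrite mulr0.
  by move: t0 tk eI; rewrite /= tkE; lia.
- by apply/allP => x /(knot_bounds ks).
Qed.

(* There are [k] linear conditions on the [k + 1] coefficients of [c]. *)
Lemma annihilator_exists : exists2 c : {poly K}, c != 0 &
  (size c <= k.+1)%N /\ forall i, (0 < i <= k)%N -> (c * p (skip_seq k i))`_i = 0.
Proof.
(* The [i]-th entry of [v *m M] is the coefficient of ['X^(i.+1)] in [c * p (skip_seq k i.+1)],
   where [c] has the coefficients [v]. *)
pose M := \matrix_(e < k.+1, i < k)
  (if (e <= i.+1)%N then (p (skip_seq k i.+1))`_(i.+1 - e) else 0).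
have [v v0 vM] : exists2 v : 'rV_k.+1, v != 0 & v *m M = 0.
  have : kermx M != 0.
    by rewrite kermx_eq0 /row_free; have := rank_leq_col M; lia.
  by case/rowV0Pn => v /sub_kermxP vM v0; exists v.
exists (\poly_(e < k.+1) v 0 (inord e)).
  apply: contra v0 => /eqP c0; apply/eqP/rowP => e.
  have := congr1 (fun c : {poly K} => c`_e) c0.
  by rewrite coef_poly ltn_ord inord_val coef0 mxE.
split; first exact: size_poly.
case=> // i /andP[_ ik].
transitivity ((v *m M) 0 (Ordinal ik)); last by rewrite vM mxE.
rewrite mxE coefM (big_ord_widen_cond k.+1 xpredT (fun j =>
  (\poly_(e < k.+1) v 0 (inord e))`_j * (p (skip_seq k i.+1))`_(i.+1 - j))) //.
rewrite big_mkcond /=; apply: eq_bigr => e _.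
by rewrite mxE /= ltnS; case: ifP => _; rewrite ?mulr0 // coef_poly ltn_ord inord_val.
Qed.

Lemma mul_supp (A B D : pred nat) f g : supp_in A f -> supp_in B g ->
  (forall i j, A i -> B j -> D (i + j)%N) -> supp_in D (f * g).
Proof.
move=> fA gB AB e De; rewrite coefM big1 // => i _.
have [iA|iA] := boolP (A i); last by rewrite fA ?mul0r.
have [iB|iB] := boolP (B (e - i)%N); last by rewrite gB ?mulr0.
by have := AB _ _ iA iB; rewrite subnKC ?(negPf De) // -ltnS.
Qed.

Variable c : {poly K}.
Hypothesis c_neq0 : c != 0.
Hypothesis size_c : (size c <= k.+1)%N.
Hypothesis c_annihilates : forall i, (0 < i <= k)%N -> (c * p (skip_seq k i))`_i = 0.

(** Insert every place except [e]. A remaining tuple either has [e] as its only gap, hence is a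
    translate of some [skip_seq k i] and is covered by the choice of [c], or has [e] outside its
    range, where the degree bounds on [c] and on its symbol leave no coefficient. *)
Lemma annihilated_supp s : knot_seq k s -> supp_in (mem s) (c * p s).
Proof.
move=> ks e es; pose Q f := (c * f)`_e = 0.
apply: (insertion_ind (A := predC1 e) (Q := Q) p_insert) => //; rewrite /Q.
- by rewrite mulr0 coef0.
- by move=> a f g fe ge; rewrite mulrDr -scalerAr coefD coefZ fe ge mulr0 addr0.
- move=> t kt At ct; have et : e \notin t by apply/negP => /(allP At) /=; rewrite eqxx.
  have [e0k|] := boolP (nth0 t 0 < e < nth0 t k)%N.
    have [i0k tE] := knot_skip kt e0k et ct.
    have sk : knot_seq k (skip_seq k (e - nth0 t 0)%N).
      have /knot_seqP[t1 t2] := kt; rewrite {}tE size_map sorted_map in t1 t2.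
      rewrite /knot_seq t1 eqxx; apply: sub_sorted t2.
      by move=> x y /=; rewrite ltn_add2l.
    have [a _] := p_translate (nth0 t 0) sk; rewrite -tE => ->.
    rewrite -scalerAr coefZ mulrCA coefXnM ifF; last by lia.
    by rewrite c_annihilates // mulr0.
  move=> e0k; apply: (mul_supp (A := [pred i | i < k.+1]%N)
      (D := [pred e | nth0 t 0 <= e <= nth0 t k]%N) _ (p_supp kt)).
  + by move=> i; rewrite -leqNgt => ki; rewrite nth_default // (leq_trans size_c).
  + by move=> i j /=; lia.
  + rewrite /=; have := knot_mem kt (leq0n k); have := knot_mem kt (leqnn k).
    move=> tk t0; apply/negP => e0k'.
    have [E|ne0] := eqVneq e (nth0 t 0); first by rewrite E t0 in et.
    have [E|nek] := eqVneq e (nth0 t k); first by rewrite E tk in et.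
    by lia.
- by apply/allP => x xs /=; apply: contra es => /eqP <-.
Qed.

Lemma comp_Xn_inj N : (0 < N)%N -> injective (fun f : {poly K} => f \Po 'X^N).
Proof.
move=> N0 f g /polyP E; apply/polyP => i; have := E (i * N)%N.
by rewrite !coef_comp_poly_Xn // dvdn_mull // mulnK.
Qed.

Lemma comp_XnM M N (f : {poly K}) : f \Po 'X^(M * N) = (f \Po 'X^M) \Po 'X^N.
Proof. by rewrite -comp_polyA comp_Xn_poly -exprM mulnC. Qed.

Lemma knot_dilate N : (0 < N)%N -> knot_seq k (map (muln N) (iota 0 k.+1)).
Proof.
move=> N0; rewrite /knot_seq size_map size_iota eqxx sorted_map.
by apply: sub_sorted (iota_ltn_sorted _ _) => x y /=; rewrite ltn_pmul2l.
Qed.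

(* With [c * H n = f_n \Po 'X^n], the two factorizations of [c * H (N * M)] for
   [M > k] give [c * (h \Po 'X^M) = f_N * (g \Po 'X^M)], so [f_N] is a multiple of [c]. *)
Lemma annihilated_dilate N : (0 < N)%N -> exists2 a : K, a != 0 &
  c * H N = a *: (c \Po 'X^N).
Proof.
have step n : (0 < n)%N -> exists2 f : {poly K}, (size f <= k.+1)%N & c * H n = f \Po 'X^n.
  move=> n0; exists (\poly_(i < k.+1) (c * H n)`_(i * n)); first exact: size_poly.
  have [a a0 pE] := p_dilate n0; have := annihilated_supp (knot_dilate n0).
  rewrite {}pE -scalerAr => sup; apply/polyP => e.
  have sup' : supp_in (mem (map (muln n) (iota 0 k.+1))) (c * H n).
    by move=> i /sup; rewrite coefZ => /eqP; rewrite mulf_eq0 (negPf a0) => /eqP.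
  rewrite coef_comp_poly_Xn // coef_poly; case: ifP => [/dvdnP[q ->]|ne].
    rewrite mulnK //; case: ltnP => // kq; apply: sup'.
    by apply/mapP => -[i]; rewrite mem_iota => ik; nia.
  apply: sup'; apply/negP => /mapP[i _ E]; move: ne; rewrite E dvdn_mulr //.
move=> N0; pose M := k.+1; have [f fk fE] := step _ N0.
have [g gk gE] := step M isT.
have [h hk hE] : exists2 f : {poly K}, (size f <= k.+1)%N & c * H (N * M) = f \Po 'X^(N * M).
  by apply: step; rewrite muln_gt0 N0.
have E : h \Po 'X^M = f * H M.
  apply: (comp_Xn_inj N0); rewrite /= -comp_XnM mulnC -hE H_mul // mulrA fE.
  by rewrite comp_polyM.
have E2 : c * (h \Po 'X^M) = f * (g \Po 'X^M) by rewrite E -gE mulrCA.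
have sep := comp_Xn_separate size_c fk E2.
have g0 : g != 0.
  apply: contra (H_neq0 (isT : 0 < M)%N) => /eqP g0; move: gE.
  by rewrite g0 comp_poly0 => /eqP; rewrite mulf_eq0 (negPf c_neq0).
have lg0 : lead_coef g != 0 by rewrite lead_coef_eq0.
have fE' : f = ((lead_coef g)^-1 * h`_(size g).-1) *: c.
  by rewrite -scalerA sep scalerA mulVf // scale1r.
exists ((lead_coef g)^-1 * h`_(size g).-1); last by rewrite fE fE' comp_polyZ.
apply/negP => /eqP z; move: fE; rewrite fE' z scale0r comp_poly0 => /eqP.
by rewrite mulf_eq0 (negPf c_neq0) (negPf (H_neq0 N0)).
Qed.

Lemma root_exp z N : (0 < N)%N -> root c z -> root c (z ^+ N).
Proof.
move=> N0 cz; have [a a0 E] := annihilated_dilate N0.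
have := congr1 (fun f => f.[z]) E; rewrite hornerM (rootP cz) mul0r hornerZ.
rewrite horner_comp hornerXn => /esym/eqP; rewrite mulf_eq0 (negPf a0) => cz'.
exact: cz'.
Qed.

(** The positive powers of [z] are all roots of [c], so two of the first [size c] ones coincide. *)
Lemma root_unity z : z != 0 -> root c z -> exists2 N, (0 < N)%N & z ^+ N = 1.
Proof.
move=> z0 cz; pose t := [seq z ^+ i | i <- iota 1 (size c)].
have ct : all (root c) t.
  by apply/allP => y /mapP[i]; rewrite mem_iota => /andP[i0 _] ->; exact: root_exp.
have : ~~ uniq t.
  apply/negP => ut; have := max_poly_roots c_neq0 ct ut.
  by rewrite size_map size_iota ltnn.
have [/hasP[N]|/hasPn nz] := boolP (has (fun N => z ^+ N == 1) (iota 1 (size c))).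
  by rewrite mem_iota => /andP[N0 _] /eqP; exists N.
case/negP; rewrite map_inj_in_uniq ?iota_uniq //.
suff main i j : i \in iota 1 (size c) -> j \in iota 1 (size c) -> (i < j)%N -> z ^+ i != z ^+ j.
  move=> i j iI jI E; apply/eqP; case: (ltngtP i j) => // ij.
    by have := main _ _ iI jI ij; rewrite E eqxx.
  by have := main _ _ jI iI ij; rewrite E eqxx.
rewrite !mem_iota => iI jI ij; have := nz (j - i)%N; rewrite mem_iota => /(_ _) nz1.
apply/negP; rewrite -(subnKC (ltnW ij)) exprD -{1}[z ^+ i]mulr1 => /eqP.
move=> /(mulfI (expf_neq0 _ z0)) E.
by have := nz1 ltac:(lia); rewrite -E eqxx.
Qed.

(* Inserting knots into the dilated and translated copy [g] of [0, ..., k] whose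
   [l]-th entry is that of [s] writes [c * p g] as a combination of [c * p t]
   for tuples [t] without free places among the entries of [s] and [g]: those
   ending before [s] give [U], those starting after [s] do not reach the
   [l]-th entry of [s], and the only other one is [s]. *)
Lemma insertion_endpoints s l r : knot_seq k s ->
  (forall i, c`_i != 0 -> (l <= i <= r)%N) -> c`_l != 0 -> (l <= r <= k)%N ->
  nth0 s l = (nth0 s 0 + l)%N -> nth0 s k = (nth0 s r + (k - r))%N ->
  (k * (nth0 s k - nth0 s 0).+1 <= nth0 s l)%N ->
  exists U a, [/\ c %| U,
    supp_in [pred e | (e \in s) && (nth0 s l <= e < nth0 s r)%N] U &
    (U + a *: (c * p s))`_(nth0 s l) != 0].
Proof.
move=> ks c_supp cl /andP[lr rk] sl sr far.
(* Distinct entries of [g] are at least [tau] apart, more than the length of [s], and [sh] puts the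
   [l]-th one on that of [s]; so no other entry of [g] meets the range of [s]. The assumption on
   [nth0 s l] makes the subtraction in [sh] exact. *)
pose tau := (nth0 s k - nth0 s 0).+1; pose sh := (nth0 s l - tau * l)%N.
pose g0 := map (muln tau) (iota 0 k.+1); pose g := map (addn sh) g0.
have kg0 : knot_seq k g0 by exact: knot_dilate.
have kg : knot_seq k g.
  rewrite /knot_seq size_map (knot_seqP kg0).1 eqxx sorted_map.
  by apply: sub_sorted (knot_seqP kg0).2 => x y /=; rewrite ltn_add2l.
have shE : (sh + tau * l = nth0 s l)%N.
  by rewrite subnK // (leq_trans _ far) // mulnC leq_mul // (leq_trans lr).
have c_supp' : supp_in [pred i | l <= i <= r]%N c.
  by move=> i; apply: contraNeq; exact: c_supp.
have cp_supp t : knot_seq k t ->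
    supp_in [pred e | (nth0 t 0 + l <= e) && (e + k <= nth0 t k + r)]%N (c * p t).
  by move=> kt; apply: mul_supp c_supp' (p_supp kt) _ => i j /=; lia.
pose A := [pred x | (x \in s) || (x \in g)].
pose Q f := exists U a V, [/\ c * f = U + a *: (c * p s) + V, c %| U,
  supp_in [pred e | A e && (e < nth0 s r)%N] U & supp_in [pred e | nth0 s l < e]%N V].
have Qg : Q (p g).
  apply: (insertion_ind (A := A) p_insert) => //.
  - exists 0, 0, 0; rewrite mulr0 scale0r !addr0 dvdp0.
    by split=> //; exact: supp_in0.
  - move=> a f f' [U [b [V [E dU sU sV]]]] [U' [b' [V' [E' dU' sU' sV']]]].
    exists (a *: U + U'), (a * b + b'), (a *: V + V'); split.
    + rewrite mulrDr -scalerAr E E' !scalerDr scalerDl scalerA.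
      by rewrite [LHS]addrACA; congr (_ + _); rewrite addrACA.
    + by rewrite dvdp_addl // -mul_polyC dvdp_mull.
    + exact: supp_in_lin.
    + exact: supp_in_lin.
  - move=> t kt /allP At ct; have [tk|tk] := ltnP (nth0 t k) (nth0 s k).
      exists (c * p t), 0, 0; rewrite scale0r !addr0 dvdp_mulr //; split=> //.
        move=> e /=; rewrite negb_and => /orP[Ae|eA].
          apply: (annihilated_supp kt); apply: contra Ae; exact: At.
        by apply: (cp_supp _ kt); move: eA => /=; lia.
      exact: supp_in0.
    have [t0|t0] := ltnP (nth0 s 0) (nth0 t 0).
      exists 0, 0, (c * p t); rewrite scale0r !add0r dvdp0; split=> //.
        exact: supp_in0.
      by apply: supp_inW (cp_supp _ kt) => e /=; lia.
    have st : {subset s <= t}.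
      move=> x xs; have := knot_bounds ks xs => x0k.
      have [->|x0] := eqVneq x (nth0 t 0); first by rewrite (knot_mem kt).
      have [->|xk] := eqVneq x (nth0 t k); first by rewrite (knot_mem kt).
      by apply: ct; [rewrite /= xs|lia].
    have [|_ est] := uniq_min_size (knot_uniq ks) st.
      by rewrite (knot_seqP ks).1 (knot_seqP kt).1.
    have <- : s = t by apply: knot_seq_eq => //; [case/knot_seqP: ks|case/knot_seqP: kt].
    exists 0, 1, 0; rewrite scale1r add0r addr0 dvdp0.
    by split=> //; exact: supp_in0.
  - by apply/allP => x xg /=; rewrite xg orbT.
have [b b0 cgE] : exists2 b : K, b != 0 & c * p g = b *: ('X^sh * (c \Po 'X^tau)).
  have [a a0 ->] := p_translate sh kg0.
  have [a' a'0 ->] : exists2 a : K, a != 0 & p g0 = a *: H tau by exact: p_dilate.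
  have [a'' a''0 E] : exists2 a : K, a != 0 & c * H tau = a *: (c \Po 'X^tau).
    exact: annihilated_dilate.
  exists (a * (a' * a'')); first by rewrite !mulf_neq0.
  by rewrite -!scalerAr mulrCA E -scalerAr !scalerA mulrA.
have [U [a [V [E dU sU sV]]]] := Qg; rewrite {}cgE in E.
have lhs_lt e : (e < nth0 s l)%N -> ('X^sh * (c \Po 'X^tau))`_e = 0.
  move=> el; rewrite coefXnM; case: ltnP => // she; rewrite coef_comp_poly_Xn //.
  case: ifP => // /dvdnP[q qE]; rewrite qE mulnK // c_supp' //=.
  by apply/negP => /andP[lq _]; nia.
(* The left side, [c * p s] and [V] have no terms below [nth0 s l], hence neither has [U]. *)
have U_lt e : (e < nth0 s l)%N -> U`_e = 0.
  move=> el; have := congr1 (fun f : {poly K} => f`_e) E.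
  rewrite coefZ lhs_lt // !coefD coefZ (cp_supp _ ks) /=; last by lia.
  by rewrite sV /= ?mulr0 ?addr0 //; lia.
exists U, a; split=> //.
  move=> e /=; rewrite negb_and => eI.
  have [el|el] := ltnP e (nth0 s l); first exact: U_lt.
  apply: sU; apply/negP => /=/andP[/orP[es|/mapP[_ /mapP[i _ ->] eE]] er].
    by move: eI; rewrite es el er.
  have [il|il] := eqVneq i l.
    by move: eI; rewrite eE il shE (knot_mem ks) ?(leq_trans lr) //= leqnn -shE -il -eE er.
  have : (nth0 s r <= nth0 s k)%N by rewrite (knot_le ks) ?rk ?leqnn.
  move: il; rewrite neq_ltn => /orP[il|li]; first by nia.
  by rewrite /tau in eE shE; nia.
(* At the exponent [nth0 s l] the left side has [b] times the coefficient of ['X^l] in [c], and [V]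
   contributes nothing. *)
have := congr1 (fun f : {poly K} => f`_(nth0 s l)) E.
rewrite [RHS]coefD [V`__]sV /= ?ltnn // addr0 => <-; rewrite coefZ mulf_neq0 //.
rewrite -shE coefXnM ifF; last by lia.
by rewrite addKn coef_comp_poly_Xn // dvdn_mulr // mulKn.
Qed.

(** The exponents of [c] lie in [[l, r]] and those of [p s] in [[s_0, s_k - k]]; for a clustered
    tuple [s_0 + l = s_l] and [s_k - k + r = s_r]. *)
Lemma clustered_supp l r s : (forall i, c`_i != 0 -> (l <= i <= r)%N) ->
  (l <= r <= k)%N -> knot_seq k s -> clustered k l r s ->
  supp_in [pred e | (e \in s) && (nth0 s l <= e <= nth0 s r)%N] (c * p s).
Proof.
move=> c_supp lrk ks [sl sr] e; rewrite /= negb_and => /orP[es|eI].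
  exact: annihilated_supp.
apply: (mul_supp (A := [pred i | (l <= i <= r)%N])
  (D := [pred e | nth0 s l <= e <= nth0 s r]%N) _ (p_supp ks)) => //.
  by move=> i; apply: contraNeq; exact: c_supp.
by move=> i j /=; lia.
Qed.

Lemma nodes_mem l r s e : knot_seq k s -> (l <= r <= k)%N -> e \in s ->
  (nth0 s l <= e < nth0 s r)%N -> e \in [seq nth0 s i | i <- iota l (r - l)].
Proof.
move=> ks /andP[lr rk] /(nthP 0%N)[i]; rewrite (knot_seqP ks).1 ltnS => ik <- ler.
rewrite leqNgt !(knot_ltE ks) // ?(leq_trans lr) // -leqNgt in ler.
by apply/mapP; exists i => //; rewrite mem_iota subnKC.
Qed.

(** If [p s] were zero, [U] of [insertion_endpoints] would be a multiple of [('X - 1) ^+ rho] with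
    at most [rho] terms, at the entries [l] to [l + rho - 1]; it would vanish, against its
    coefficient at [nth0 s l]. *)
Lemma clustered_neq0 l rho a s : c = a *: ('X^l * ('X - 1) ^+ rho) ->
  (forall i, c`_i != 0 -> (l <= i <= l + rho)%N) -> c`_l != 0 ->
  (l + rho <= k)%N -> knot_seq k s -> clustered k l (l + rho) s ->
  (k * (nth0 s k - nth0 s 0).+1 <= nth0 s l)%N -> p s != 0.
Proof.
move=> cE c_supp cl lk ks [sl sr] far; apply/negP => /eqP ps.
have lrk : (l <= l + rho <= k)%N by rewrite leq_addr.
have [U [b [dU sU]]] := insertion_endpoints ks c_supp cl lrk sl sr far.
rewrite ps mulr0 scaler0 addr0 (_ : U = 0) ?coef0 ?eqxx //.
pose t := [seq nth0 s i | i <- iota l rho].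
apply: (@few_terms _ rho t).
- by apply: nodes_uniq ks _; exact: leqW.
- by rewrite size_map size_iota.
- move=> e et; apply: sU => /=; apply: contra et => /andP[es eI].
  by have := nodes_mem ks lrk es eI; rewrite addKn.
- by apply: dvdp_trans dU; rewrite cE -mul_polyC mulrA dvdp_mull.
Qed.

(* [W] is divisible by [c], hence vanishes at [z] and at [1]; its exponents are
   [B = nth0 s l], with a nonzero coefficient, and some congruent to [B - 1]
   modulo the order [N] of [z]. Comparing both values forces [z = 1]. *)
Lemma annihilator_roots l q : c = 'X^l * q -> q`_0 != 0 ->
  forall z, root q z -> z = 1.
Proof.
move=> cE q0 z qz; apply/eqP/negPn/negP => z1.
have z0 : z != 0.
  by apply: contraTneq qz => ->; rewrite rootE horner_coef0.
have cz : root c z by rewrite cE rootM qz orbT.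
have [N N0 zN] := root_unity z0 cz.
have c1 : root c 1 by rewrite -zN root_exp.
have qn0 : q != 0 by apply: contraNneq q0 => ->; rewrite coef0.
pose rho := (size q).-1; have sq : size q = rho.+1.
  by rewrite /rho prednK // lt0n size_poly_eq0.
have lk : (l + rho <= k)%N.
  by move: size_c; rewrite cE size_monicM ?monicXn // size_polyXn sq addSn /= addnS.
have rho0 : (0 < rho)%N.
  rewrite lt0n; apply/negP => /eqP r0; move: qz; rewrite rootE.
  have /size_poly1P[b b0 ->] : size q == 1%N by rewrite sq r0.
  by rewrite hornerC (negPf b0).
have cl : c`_l != 0 by rewrite cE coefXnM ltnn subnn.
have c_supp i : c`_i != 0 -> (l <= i <= l + rho)%N.
  rewrite cE coefXnM; case: ltnP => [_|li]; first by rewrite eqxx.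
  apply: contraR; rewrite /= -ltnNge => ri; rewrite nth_default // sq; lia.
have [s [ks clu far sE]] := residue_knots lk rho0 N0.
set B := nth0 s l in sE.
have lrk : (l <= l + rho <= k)%N by rewrite leq_addr.
have [U [b [dU sU]]] := insertion_endpoints ks c_supp cl lrk clu.1 clu.2 far.
set W := U + _ => Wl; have cW : c %| W by rewrite dvdp_addr // -mul_polyC dvdp_mull ?dvdp_mulr.
have sW : supp_in [pred e | (e \in s) && (nth0 s l <= e <= nth0 s (l + rho))%N] W.
  rewrite /W addrC; apply: supp_in_lin; first exact: clustered_supp.
  by apply: supp_inW sU => e /= /and3P[-> -> /ltnW].
(* All exponents of [W'] are congruent to [B + N.-1] modulo [N], so at an [N]-th root of unity [x]
   its value is [x ^+ (B + N.-1)] times the value at 1. *)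
pose w := W`_B; pose W' := W - w *: 'X^B.
have sW' e : W'`_e != 0 -> exists j, e = (B + N * j + N.-1)%N.
  rewrite coefB coefZ coefXn; have [->|eB] := eqVneq e B.
    by rewrite mulr1 subrr eqxx.
  rewrite mulr0 subr0 => We; have /andP[es] : (e \in s) && (nth0 s l <= e <= nth0 s (l + rho))%N.
    by apply: contraR We => /sW/eqP.
  move=> eI; move: es => /(nthP 0%N)[i]; rewrite (knot_seqP ks).1 ltnS => ik eE.
  rewrite -{}eE in eI eB *.
  have lk' : (l <= k)%N by case/andP: lrk => /leq_trans /[apply].
  have li : (l < i)%N.
    by rewrite -(knot_ltE ks) // ltn_neqAle eq_sym eB; case/andP: eI.
  have ir : (i <= l + rho)%N.
    by move: eI; rewrite [(nth0 s i <= _)%N]leqNgt (knot_ltE ks) // -leqNgt => /andP[].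
  by exists (i - l)%N; rewrite sE // li.
have W'z x : x ^+ N = 1 -> W'.[x] = x ^+ (B + N.-1) * W'.[1].
  move=> xN; rewrite !horner_coef mulr_sumr; apply: eq_bigr => i _.
  have [->|/sW'[j ->]] := eqVneq (W'`_i) 0; first by rewrite !mul0r mulr0.
  by rewrite expr1n mulr1 mulrC addnAC exprD exprM xN expr1n mulr1.
have Wz x : x ^+ N = 1 -> root W x -> w * x ^+ B + x ^+ (B + N.-1) * W'.[1] = 0.
  move=> xN /rootP; rewrite -(W'z _ xN) /W' hornerD hornerN hornerZ hornerXn => ->.
  by rewrite add0r subrr.
have rW x : root c x -> root W x by move=> cx; case/dvdpP: cW => v ->; rewrite rootM cx orbT.
(* The value at 1 gives [w = - W'.[1]]; inserted in the value at [z], this leaves [z ^+ N.-1 = 1],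
   which together with [z ^+ N = 1] means [z = 1]. *)
have := Wz 1 (expr1n _ _) (rW _ c1); rewrite !expr1n mulr1 mul1r => /eqP.
rewrite addr_eq0 => /eqP wE; have := Wz z zN (rW _ cz); rewrite wE exprD -mulrA.
rewrite [_ * z ^+ B]mulrC -mulrDr => /eqP; rewrite mulf_eq0 expf_eq0 (negPf z0) andbF /=.
have W1 : W'.[1] != 0 by rewrite -oppr_eq0 -wE.
rewrite -mulN1r -mulrDl mulf_eq0 (negPf W1) orbF addrC subr_eq0 => /eqP zN1.
by case/eqP: z1; rewrite -zN -(prednK N0) exprS zN1 mulr1.
Qed.

Lemma annihilator_shape : exists l rho, c = lead_coef c *: ('X^l * ('X - 1) ^+ rho).
Proof.
have [l [q]] := multiplicity_XsubC c 0; rewrite c_neq0 subr0 mulrC /= => q0 cE.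
have q0' : q`_0 != 0 by rewrite -horner_coef0.
have roots1 := annihilator_roots cE q0'.
have [rs qE] := closed_field_poly_normal q; exists l, (size rs).
have lq0 : lead_coef q != 0.
  by rewrite lead_coef_eq0; apply: contraNneq q0' => ->; rewrite coef0.
rewrite cE lead_coef_monicM ?monicXn // {1}qE -scalerAr; congr (_ *: (_ * _)).
rewrite big_tnth (eq_bigr (fun=> 'X - 1)) ?prodr_const ?card_ord // => i _.
rewrite [tnth _ _]roots1 ?polyC1 // rootE qE hornerZ mulf_eq0 -rootE root_prod_XsubC.
by rewrite mem_tnth orbT.
Qed.

End combinatorics.

(* [p s] stands for the coefficients of [F s] on the integer translates of
   [F (0, ..., k)], and [H N] for those of the dilate of [F (0, ..., k)] by [N]. *)
Lemma translate_coefficients (K : numClosedFieldType) (k : nat)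
    (p : seq nat -> {poly K}) (H : nat -> {poly K}) :
  (forall s x, knot_seq k s -> (nth0 s 0 < x < nth0 s k)%N -> x \notin s ->
    exists a b : K, p s = a *: p (take k.+1 (insert_knot x s)) +
                          b *: p (behead (insert_knot x s))) ->
  (forall s t, knot_seq k s -> exists2 a : K, a != 0 &
    p (map (addn t) s) = a *: ('X^t * p s)) ->
  p (iota 0 k.+1) = 1 ->
  (forall N, (0 < N)%N -> exists2 a : K, a != 0 &
    p (map (muln N) (iota 0 k.+1)) = a *: H N) ->
  (forall N, (0 < N)%N -> H N != 0) ->
  (forall M N, (0 < M)%N -> (0 < N)%N -> H (M * N) = H M * (H N \Po 'X^M)) ->
  exists l rho, let c := 'X^l * ('X - 1) ^+ rho : {poly K} in
    [/\ (l + rho <= k)%N,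
      forall N, (0 < N)%N -> exists2 a : K, a != 0 & c * H N = a *: (c \Po 'X^N) &
      forall s, knot_seq k s -> clustered k l (l + rho) s ->
        supp_in (mem [seq nth0 s i | i <- iota l rho.+1]) (c * p s) /\
        ((k * (nth0 s k - nth0 s 0).+1 <= nth0 s l)%N -> p s != 0)].
Proof.
move=> p_ins p_tr p_i p_dil H0 HM.
have [d d0 [sd dp]] := annihilator_exists k p.
have [l [rho dE]] := annihilator_shape p_ins p_tr p_i p_dil H0 HM d0 sd dp.
exists l, rho; set c := 'X^l * _ : {poly K}; rewrite -/c in dE; move=> c'.
have ld0 : lead_coef d != 0 by rewrite lead_coef_eq0.
have cE : c = (lead_coef d)^-1 *: d by rewrite {2}dE scalerA mulVf ?scale1r.
have mon : ('X - 1 : {poly K}) \is monic by rewrite -[1]polyC1 monicXsubC.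
have sc : size c = (l + rho).+1.
  rewrite size_monicM ?monicXn ?monic_neq0 ?monic_exp // size_polyXn.
  by rewrite -[1]polyC1 size_exp_XsubC addSn addnS.
have c0 : c != 0 by rewrite -size_poly_eq0 sc.
have lk : (l + rho <= k)%N by move: sd; rewrite dE size_scale // sc.
have sck : (size c <= k.+1)%N by rewrite sc.
have cp i : (0 < i <= k)%N -> (c * p (skip_seq k i))`_i = 0.
  by move=> ik; rewrite cE -scalerAl coefZ dp ?mulr0.
have c_supp i : c`_i != 0 -> (l <= i <= l + rho)%N.
  move=> ci; rewrite leqNgt; apply/andP; split; last first.
    by rewrite -ltnS -sc ltnNge; apply: contra ci => /(nth_default 0)/eqP.
  by apply: contra ci => il; rewrite coefXnM il.
have cl : c`_l != 0.
  by rewrite coefXnM ltnn subnn -horner_coef0 horner_exp !hornerE expf_neq0 // oppr_eq0 oner_eq0.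
have lrk : (l <= l + rho <= k)%N by rewrite leq_addr.
split=> //.
  by move=> N N0; apply: (annihilated_dilate p_ins p_tr p_i p_dil H0 HM c0 sck cp N0).
move=> s ks clu; split.
  have sup := clustered_supp p_ins p_tr p_i c0 sck cp c_supp lrk ks clu.
  move=> e et; apply: sup; apply: contra et => /= /andP[es eI].
  suff : e \in [seq nth0 s i | i <- iota l rho.+1] by [].
  have [->|er] := eqVneq e (nth0 s (l + rho)).
    by apply/mapP; exists (l + rho)%N; rewrite // mem_iota; lia.
  have eI' : (nth0 s l <= e < nth0 s (l + rho))%N by lia.
  have /mapP[i iI ->] := nodes_mem ks lrk es eI'; apply/mapP; exists i => //.
  by move: iI; rewrite !mem_iota; lia.
by apply: (clustered_neq0 p_ins p_tr p_i p_dil H0 HM c0 sck cp (a := 1)); rewrite ?scale1r.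
Qed.

(** * Functionals on polynomials *)

Section moments.
Variable K : numFieldType.
Implicit Types (P Q u : {poly K}).

Definition affine_poly (a b : K) : {poly K} := a *: 'X + b%:P.

Lemma derivn_affine a b P n :
  (P \Po affine_poly a b)^`(n) = a ^+ n *: (P^`(n) \Po affine_poly a b).
Proof.
elim: n => [|n IHn]; first by rewrite !derivn0 expr0 scale1r.
rewrite !derivnS IHn derivZ deriv_comp derivD derivZ derivX derivC addr0.
by rewrite alg_polyC mulrC mul_polyC scalerA exprSr.
Qed.

Lemma horner_affine a b P x : (P \Po affine_poly a b).[x] = P.[a * x + b].
Proof. by rewrite horner_comp !hornerE. Qed.

Lemma derivn_surjective n Q : exists P, P^`(n) = Q.
Proof.
elim: n Q => [|n IHn] Q; first by exists Q; rewrite derivn0.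
have [P <-] := IHn Q.
exists (\sum_(i < size P) (P`_i / i.+1%:R) *: 'X^(i.+1)); rewrite derivSn; congr derivn.
rewrite raddf_sum -[RHS]coefK poly_def; apply: eq_bigr => i _.
rewrite /= derivZ derivXn /=; by rewrite -scaler_nat scalerA divfK // pnatr_eq0.
Qed.

Implicit Types m : {linear {poly K} -> K^o}.

Lemma moment_shift m i b : m ('X^i \Po affine_poly 1 b) =
  \sum_(j < i.+1) b ^+ (i - j) *+ 'C(i, j) * m 'X^j.
Proof.
rewrite comp_Xn_poly /affine_poly scale1r addrC exprDn linear_sum.
apply: eq_bigr => j _; rewrite -polyC_exp mul_polyC linearMn /= linearZ_LR /=.
by rewrite mulrnAl.
Qed.

Lemma moment_neq0 m : (exists P, m P != 0) ->
  exists2 n, m 'X^n != 0 & forall i, (i < n)%N -> m 'X^i = 0.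
Proof.
move=> [P mP]; have ex : exists n, m 'X^n != 0.
  suff /existsP[i mi] : [exists i : 'I_(size P), m 'X^i != 0] by exists i.
  apply: contraR mP; rewrite negb_exists => /forallP m0.
  rewrite -[P]coefK poly_def linear_sum big1 // => i _.
  by rewrite linearZ_LR (eqP (negPn (m0 i))) scaler0.
case: (ex_minnP ex) => n mn min; exists n => // i im; apply/eqP/negPn/negP.
by move=> /min; rewrite leqNgt im.
Qed.

(** Let [n] be the degree of the first nonzero moment. Once the sums of [u_j j^i] vanish for
    [i < d], testing with ['X^(n + d)] leaves a nonzero multiple of the sum of [u_j j^d]. So all
    these sums vanish, and [u] with them. *)
Lemma translates_free m u : (exists P, m P != 0) ->
  (forall P, pairing (fun j => m (P \Po affine_poly 1 j%:R)) u = 0) -> u = 0.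
Proof.
move=> /moment_neq0[n mn mlt] kill.
have power d : pairing (fun j => j%:R ^+ d : K^o) u = 0.
  elim/ltn_ind: d => d IHd; have := kill 'X^(n + d).
  pose f i j := (j%:R ^+ (n + d - i) *+ 'C(n + d, i) * m 'X^i : K^o).
  have E : pairing (fun j => m ('X^(n + d) \Po affine_poly 1 j%:R)) u =
      \sum_(i < (n + d).+1) (m 'X^i *+ 'C(n + d, i)) *:
        pairing (fun j => j%:R ^+ (n + d - i) : K^o) u.
    rewrite /pairing; under [RHS]eq_bigr do rewrite scaler_sumr.
    rewrite exchange_big; apply: eq_bigr => j _; rewrite moment_shift scaler_sumr.
    apply: eq_bigr => i _; rewrite mulrnAl -scalerMnr -scalerMnl; congr (_ *+ _).
    by rewrite -[LHS]/(_ * (_ * _)) -[RHS]/(_ * (_ * _)) mulrA mulrC.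
  have nd : (n < (n + d).+1)%N by rewrite ltnS leq_addr.
  rewrite E (bigD1 (Ordinal nd)) //= addKn big1 ?addr0.
    move=> /eqP; rewrite scaler_eq0 mulrn_eq0 (negPf mn) orbF -leqn0 leqNgt.
    by rewrite bin_gt0 leq_addr /= => /eqP.
  move=> i; rewrite -val_eqE /= => iNn; have [im|mi] := ltnP i n.
    by rewrite mlt // mul0rn scale0r.
  by rewrite IHd ?scaler0 //; have := ltn_ord i; lia.
apply: (pairing_separates (iota_uniq 0 (size u))).
  by move=> e; rewrite mem_iota /= -leqNgt => /(nth_default 0).
move=> g _; rewrite -[LHS]/(pairing (fun i => g.[i%:R] : K^o) u).
transitivity (\sum_(d < size g) g`_d *: pairing (fun j => j%:R ^+ d : K^o) u).
  rewrite /pairing; under [RHS]eq_bigr do rewrite scaler_sumr.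
  rewrite exchange_big; apply: eq_bigr => j _; rewrite horner_coef scaler_sumr.
  by apply: eq_bigr => d _; exact: mulrCA.
by rewrite big1 // => d _; rewrite power scaler0.
Qed.

(* The functionals on both sides solve the same dilation equation, which on
   the monomials determines all values but the one at ['X^(n + rho)]; [C] is
   chosen to make these agree. *)
Lemma refinable_functional m mu l rho : (exists P, m P != 0) ->
  (forall P, m (P \Po affine_poly 2 0) =
    mu *: pairing (fun j => m (P \Po affine_poly 1 j%:R)) ('X^l * ('X + 1) ^+ rho)) ->
  exists n, exists2 C : K, C != 0 & forall P,
    m P^`(rho) = C *: pairing (fun j => (P^`(n)).[j%:R] : K^o) ('X^l * ('X - 1) ^+ rho).
Proof.
move=> /moment_neq0[n mn mlt] refine; exists n.
set h := 'X^l * ('X + 1) ^+ rho in refine; set c := 'X^l * _.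
have h1 : h.[1] = 2 ^+ rho by rewrite !hornerE expr1n mul1r.
have lead (f : {linear {poly K} -> K^o}) i : (forall j, (j < i)%N -> f 'X^j = 0) ->
    pairing (fun j => f ('X^i \Po affine_poly 1 j%:R)) h = 2 ^+ rho *: f 'X^i.
  move=> f0; rewrite -h1 -pairing_const; apply: eq_pairing => b.
  rewrite moment_shift big_ord_recr /= subnn expr0 binn mul1r big1 ?add0r // => j _.
  by rewrite f0 ?mulr0.
(* On ['X^n] all lower moments vanish, and comparing both sides fixes the factor. *)
have mu_eq : mu * 2 ^+ rho = 2 ^+ n.
  have := refine 'X^n; rewrite lead // scalerA.
  rewrite comp_Xn_poly /affine_poly addr0 exprZn linearZ_LR /=.
  by move=> /(mulIf mn).
pose E0 C P := m P^`(rho) - C *: (pairing (fun j => (P^`(n)).[j%:R] : K^o) c : K^o).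
have E_lin C : linear (E0 C : {poly K} -> K^o).
  move=> a P Q; rewrite /E0 derivnD derivnZ linearP scalerBr addrACA; congr (_ + _).
  rewrite scalerA [a * C]mulrC -scalerA -opprD -scalerDr -pairing_lin; congr (- (C *: _)).
  by apply: eq_pairing => j; rewrite derivnD derivnZ hornerD hornerZ.
have dc : ('X - 1) ^+ rho %| c by rewrite dvdp_mull.
(* This number is nonzero: otherwise [c] would annihilate all degrees up to [rho], which separate
   its at most [rho + 1] exponents. *)
pose e := pairing (fun j => j%:R ^+ rho : K^o) c.
have e0 : e != 0.
  have c0 : c != 0.
    rewrite mulf_neq0 ?expf_neq0 ?polyX_eq0 //.
    by rewrite -[1]polyC1 polyXsubC_eq0.
  apply: contra c0 => /eqP e0; apply/eqP.
  apply: (pairing_separates (iota_uniq l rho.+1)) => [i|g].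
    rewrite mem_iota coefXnM; move=> iI; case: (ltnP i l) => // li.
    by rewrite nth_default // -[1]polyC1 size_exp_XsubC; lia.
  by rewrite size_iota => /(pairing_top dc)->; rewrite -/e e0 scaler0.
pose C := (((n + rho) ^_ rho)%:R * m 'X^n) / (((n + rho) ^_ n)%:R * e).
have C0 : C != 0.
  by rewrite !mulf_neq0 ?invr_eq0 ?mulf_neq0 // pnatr_eq0 -lt0n ffact_gt0 ?leq_addl ?leq_addr.
exists C => //.
pose E : {linear {poly K} -> K^o} := HB.pack (E0 C) (GRing.isLinear.Build _ _ _ _ _ (E_lin C)).
suff E_eq0 i : E 'X^i = 0.
  move=> P; apply/eqP; rewrite -subr_eq0; apply/eqP; rewrite -[LHS]/(E P).
  rewrite -[P]coefK poly_def linear_sum big1 // => i _.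
  by rewrite linearZ_LR E_eq0 scaler0.
have E_refine P : E (P \Po affine_poly 2 0) =
    2 ^+ n *: pairing (fun j => E (P \Po affine_poly 1 j%:R)) h.
  rewrite -[LHS]/(E0 C _) /E0 !derivn_affine linearZ_LR /= refine !scalerA.
  rewrite [2 ^+ rho * mu]mulrC mu_eq.
  have -> : pairing (fun j => (2 ^+ n *: (P^`(n) \Po affine_poly 2 0)).[j%:R] : K^o) c =
      2 ^+ n *: pairing (fun j => (P^`(n)).[j%:R] : K^o) (h * c).
    (* The polynomial [h] is exactly the quotient of [c \Po 'X^2] by [c], since ['X^2 - 1] is the
       product of ['X - 1] and ['X + 1]; hence point evaluations along [c] solve the same dilation
       equation. *)
    rewrite (_ : h * c = c \Po 'X^2).
      rewrite pairing_comp_Xn // -pairing_scale; apply: eq_pairing => j.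
      by rewrite hornerZ horner_affine addr0 natrM.
    rewrite /h /c comp_polyM comp_Xn_poly [_ ^+ rho \Po _]rmorphXn /= comp_polyB comp_polyX.
    rewrite -[1]polyC1 comp_polyC polyC1 -exprM mulnC.
    rewrite [(_ ^+ 2 - 1)]subr_sqr_1 exprMn exprM expr2; ring.
  rewrite pairingM scalerA [C * _]mulrC -scalerA -scalerBr; congr (_ *: _).
  rewrite addrC -scaleNr -pairing_lin; apply: eq_pairing => a.
  rewrite -[RHS]/(E0 C _) /E0 !derivn_affine !expr1n !scale1r addrC scaleNr.
  congr (_ - _ *: _); apply: eq_pairing => j.
  by rewrite horner_affine mul1r addrC natrD.
elim/ltn_ind: i => i IHi.
have [->|ni] := eqVneq i (n + rho)%N.
  rewrite -[LHS]/(E0 C _) /E0 !derivnXn addnK addKn linearMn /=.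
  have -> : pairing (fun j => ('X^rho *+ (n + rho) ^_ n).[j%:R] : K^o) c =
      ((n + rho) ^_ n)%:R *: e.
    rewrite -pairing_scale; apply: eq_pairing => j.
    by rewrite hornerMn hornerXn scaler_nat.
  rewrite -[C *: _]/(C * (((n + rho) ^_ n)%:R * e)) divfK; first by rewrite mulr_natl subrr.
  by rewrite mulf_neq0 // pnatr_eq0 -lt0n ffact_gt0 leq_addr.
(* With all lower values zero the equation reads [2 ^+ i * E 'X^i = 2 ^+ (n + rho) * E 'X^i]. *)
have := E_refine 'X^i; rewrite lead // comp_Xn_poly /affine_poly addr0 exprZn linearZ_LR /=.
rewrite scalerA -exprD -[_ *: _]/(_ * _) -[in RHS]/(_ * _) => /eqP; rewrite -subr_eq0 -mulrBl mulf_eq0 => /orP[|/eqP//].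
rewrite subr_eq0 => /eqP /(ieexprIn _ _) E2; case/eqP: ni.
by rewrite E2 // ?pnatr_eq1.
Qed.

End moments.

(** * Divided differences *)

Section divided_differences.
Variable K : fieldType.
Implicit Types (P g : {poly K}) (a : nat -> K).

Fixpoint divdiff r a P : K :=
  if r is r'.+1 then
    (divdiff r' (fun i => a i.+1) P - divdiff r' a P) / (a r - a 0%N)
  else P.[a 0%N].

Definition distinct_nodes r a :=
  forall i j, (i <= r)%N -> (j <= r)%N -> a i = a j -> i = j.

Lemma distinct_nodesS r a : distinct_nodes r.+1 a ->
  [/\ distinct_nodes r (fun i => a i.+1), distinct_nodes r a & a r.+1 - a 0%N != 0].
Proof.
move=> da; split.
- by move=> i j ir jr E; have [] := da i.+1 j.+1 ir jr E.
- by move=> i j ir jr; apply: da; exact: leqW.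
- by rewrite subr_eq0; apply/eqP => /(da r.+1 0%N (leqnn _) isT).
Qed.

Lemma eq_divdiff r a b P : (forall i, (i <= r)%N -> a i = b i) ->
  divdiff r a P = divdiff r b P.
Proof.
elim: r a b => [|r IHr] a b ab /=; first by rewrite ab.
rewrite !ab //; congr ((_ - _) / _); apply: IHr => i ir; apply: ab => //.
exact: leqW.
Qed.

Lemma divdiff_lin r a c P g : divdiff r a (c *: P + g) = c * divdiff r a P + divdiff r a g.
Proof.
elim: r a => [|r IHr] a /=; first by rewrite hornerD hornerZ.
by rewrite !IHr mulrA -mulrDl; congr (_ / _); ring.
Qed.

Lemma divdiff_local r a P g : (forall i, (i <= r)%N -> P.[a i] = g.[a i]) ->
  divdiff r a P = divdiff r a g.
Proof.
elim: r a => [|r IHr] a E /=; first exact: E.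
by rewrite !IHr // => i ir; apply: E; rewrite ?ltnS // leqW.
Qed.

Lemma divdiffSE r a P : a r.+1 - a 0%N != 0 -> (a r.+1 - a 0%N) * divdiff r.+1 a P =
  divdiff r (fun i => a i.+1) P - divdiff r a P.
Proof. by move=> a0; rewrite /= mulrC divfK. Qed.

Lemma divdiff_swap r a g : a r.+1 - a 0%N != 0 ->
  divdiff r.+1 a (('X - (a 0%N)%:P) * g) = divdiff r.+1 a (('X - (a r.+1)%:P) * g)
    + (divdiff r (fun i => a i.+1) g - divdiff r a g).
Proof.
move=> a0; rewrite -divdiffSE // [RHS]addrC -divdiff_lin; congr (divdiff _ _ _).
by rewrite -mul_polyC polyCB; ring.
Qed.

(** Leibniz' rule for a linear factor vanishing at the first node. In the induction the factor is
    traded for the one at the last node, whose effect follows from the induction hypothesis by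
    [divdiff_swap]. *)
Lemma divdiff_mul_first r a g : distinct_nodes r.+1 a ->
  divdiff r.+1 a (('X - (a 0%N)%:P) * g) = divdiff r (fun i => a i.+1) g.
Proof.
elim: r a => [|r IHr] a da; have [d1 d2 a0] := distinct_nodesS da.
  by rewrite /= !hornerE subrr mul0r subr0 mulrAC mulfV // mul1r.
apply: (mulfI a0); rewrite divdiffSE // (IHr a) //.
have -> : ('X - (a 0%N)%:P) * g =
    (a r.+2 - a 0%N) *: g + ('X - (a r.+2)%:P) * g.
  by rewrite -mul_polyC polyCB; ring.
rewrite divdiff_lin; have [_ _ a1] := distinct_nodesS d1.
have := divdiff_swap (a := fun i => a i.+1) g a1; rewrite (IHr _ d1) => /eqP.
rewrite addrCA -subr_eq0 opprD addrA subrr add0r oppr_eq0 subr_eq0 => /eqP ->.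
by rewrite addrK.
Qed.

Lemma divdiff_mul_last r a g : distinct_nodes r.+1 a ->
  divdiff r.+1 a (('X - (a r.+1)%:P) * g) = divdiff r a g.
Proof.
move=> da; have [_ _ a0] := distinct_nodesS da.
have := divdiff_swap g a0; rewrite divdiff_mul_first // => /eqP.
by rewrite addrCA -subr_eq0 opprD addrA subrr add0r oppr_eq0 subr_eq0 => /eqP.
Qed.

Lemma divdiff_const r a c : divdiff r.+1 a c%:P = 0.
Proof.
elim: r a => [|r IHr] a /=; first by rewrite !hornerC subrr mul0r.
by have := IHr a; have := IHr (fun i => a i.+1); rewrite /= => -> ->; rewrite subrr mul0r.
Qed.

Lemma divdiff_small r a P : distinct_nodes r a -> (size P <= r)%N -> divdiff r a P = 0.
Proof.
elim: r a P => [|r IHr] a P da.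
  by rewrite leqn0 size_poly_eq0 => /eqP->; rewrite /= horner0.
move=> sP; have /factor_theorem[g gE] : root (P - (P.[a 0%N])%:P) (a 0%N).
  by rewrite rootE !hornerE subrr.
have -> : P = 1 *: (('X - (a 0%N)%:P) * g) + (P.[a 0%N])%:P.
  by rewrite scale1r mulrC -gE subrK.
have [d1 _ _] := distinct_nodesS da.
rewrite divdiff_lin divdiff_const addr0 divdiff_mul_first // IHr ?mulr0 //.
have [->|g0] := eqVneq g 0; first by rewrite size_poly0.
have : (size (g * ('X - (a 0%N)%:P))%R <= maxn r.+1 1)%N.
  rewrite -gE (leq_trans (size_polyD _ _)) // geq_max leq_max sP /= size_polyN.
  by rewrite leq_max size_polyC_leq1 orbT.
by rewrite size_Mmonic ?monicXsubC // size_XsubC addn2 (maxn_idPl _).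
Qed.

Lemma divdiff_Xn r a : distinct_nodes r a -> divdiff r a 'X^r = 1.
Proof.
elim: r a => [|r IHr] a da; first by rewrite /= hornerXn.
have -> : 'X^(r.+1) = (a 0%N) *: 'X^r + ('X - (a 0%N)%:P) * 'X^r :> {poly K}.
  by rewrite -mul_polyC exprS; ring.
have [d1 _ _] := distinct_nodesS da.
by rewrite divdiff_lin divdiff_small ?size_polyXn // divdiff_mul_first // IHr // mulr0 add0r.
Qed.

(** Modulo the node polynomial [M], [P] reduces to degree at most [r], and then only the coefficient
    of ['X^r] counts for either functional. *)
Lemma divdiff_unique r a (E : {linear {poly K} -> K^o}) : distinct_nodes r a ->
  (forall P, (forall i, (i <= r)%N -> P.[a i] = 0) -> E P = 0) ->
  (forall P, (size P <= r)%N -> E P = 0) ->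
  forall P, E P = E 'X^r * divdiff r a P.
Proof.
move=> da E_local E_small P.
pose M := \prod_(z <- [seq a i | i <- iota 0 r.+1]) ('X - z%:P).
have M0 i : (i <= r)%N -> M.[a i] = 0.
  by move=> ir; apply/eqP; rewrite -rootE root_prod_XsubC map_f // mem_iota.
pose g := P %% M; have gr : (size g <= r.+1)%N.
  have : M != 0 by rewrite monic_neq0 // monic_prod_XsubC.
  by move=> /(ltn_modpN0 P); rewrite size_prod_XsubC size_map size_iota ltnS.
have Pg i : (i <= r)%N -> P.[a i] = g.[a i].
  by move=> ir; rewrite [P in LHS](divp_eq P M) hornerD hornerM M0 // mulr0 add0r.
rewrite (divdiff_local Pg).
have -> : E P = E g.
  by apply/eqP; rewrite -subr_eq0 -linearB E_local // => i /Pg E1; rewrite hornerD hornerN E1 subrr.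
have -> : g = g`_r *: 'X^r + (g - g`_r *: 'X^r) by rewrite addrC subrK.
have g's : (size (g - g`_r *: 'X^r)%R <= r)%N.
  apply/leq_sizeP => j; rewrite leq_eqVlt coefB coefZ coefXn eq_sym.
  have [->|_ /= mj] := eqVneq j r; first by rewrite mulr1 subrr.
  by rewrite mulr0 subr0 nth_default // (leq_trans gr).
rewrite divdiff_lin linearD linearZ_LR /= (E_small (_ - _)) // (divdiff_small da g's) !addr0.
by rewrite divdiff_Xn // mulr1; exact: mulrC.
Qed.

End divided_differences.

From mathcomp Require Import all_classical all_reals all_analysis.
From mathcomp.real_closed Require Import complex.
From mathcomp Require Import measurable_realfun lra.
Import numFieldNormedType.Exports.
Local Open Scope classical_set_scope.
Local Open Scope complex_scope.
Local Open Scope ring_scope.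

(** * Density of polynomials in E(R) *)

Section bernstein.
Variable R : realFieldType.

(* The Bernstein polynomial with node values [g 0, ..., g n], by de Casteljau's recursion. *)
Fixpoint bernstein n (g : nat -> R) : {poly R} :=
  if n is n'.+1 then
    'X * bernstein n' (fun i => g i.+1) + (1 - 'X) * bernstein n' g
  else (g 0%N)%:P.

(** The bracket on the right is the mean of [(i - b)^2] for [i] binomially distributed with
    parameters [n] and [x]. The centre [b] is general because the recursion passes to the values
    [g i.+1], for which it becomes [b - 1]. *)
Lemma bernstein_bound n g (c e M b x : R) : 0 <= x <= 1 ->
  (forall i, (i <= n)%N -> `|g i - c| <= e + M * (i%:R - b) ^+ 2) ->
  `|(bernstein n g).[x] - c| <= e + M * (n%:R * x * (1 - x) + (n%:R * x - b) ^+ 2).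
Proof.
move=> /andP[x0 x1]; elim: n g b => [|n IHn] g b gb /=.
  by have := gb 0%N isT; rewrite hornerC !mul0r sub0r !add0r sqrrN.
have h1 : forall i, (i <= n)%N -> `|g i.+1 - c| <= e + M * (i%:R - (b - 1)) ^+ 2.
  by move=> i ni; have := gb i.+1 ni; rewrite -natr1; congr (_ <= _ + _ * _ ^+ _); ring.
have h2 : forall i, (i <= n)%N -> `|g i - c| <= e + M * (i%:R - b) ^+ 2.
  by move=> i ni; apply: gb; rewrite leqW.
have {}IH1 := IHn (fun i => g i.+1) (b - 1) h1; have {}IH2 := IHn _ _ h2.
rewrite !hornerE.
have -> : x * (bernstein n (fun i => g i.+1)).[x] + (1 - x) * (bernstein n g).[x] - c =
  x * ((bernstein n (fun i => g i.+1)).[x] - c) + (1 - x) * ((bernstein n g).[x] - c).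
  by ring.
rewrite (le_trans (ler_normD _ _)) // !normrM (ger0_norm x0) (@ger0_norm _ (1 - x)) ?subr_ge0 //.
have y0 : 0 <= 1 - x by rewrite subr_ge0.
apply: le_trans (lerD (ler_wpM2l x0 IH1) (ler_wpM2l y0 IH2)) _.
by rewrite -natr1 le_eqVlt; apply/orP; left; apply/eqP; ring.
Qed.

(* AM-GM turns the Lipschitz bound into the quadratic bound of [bernstein_bound]. *)
Lemma bernstein_lipschitz n (f : R -> R) (L e x : R) : 0 < e -> 0 <= L -> 0 <= x <= 1 ->
  (0 < n)%N -> L ^+ 2 <= e ^+ 2 * n%:R ->
  (forall x y, 0 <= x <= 1 -> 0 <= y <= 1 -> `|f y - f x| <= L * `|y - x|) ->
  `|(bernstein n (fun i => f (i%:R / n%:R))).[x] - f x| <= 2 * e.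
Proof.
move=> e0 L0 x01 n0 nL fL; have n0' : (0 : R) < n%:R by rewrite ltr0n.
have := @bernstein_bound n (fun i => f (i%:R / n%:R)) (f x) e (L ^+ 2 / e / n%:R ^+ 2) (n%:R * x) x x01.
rewrite subrr expr0n addr0 => H; apply: le_trans (H _) _.
  move=> i ni; have i01 : 0 <= (i%:R / n%:R : R) <= 1.
    by rewrite divr_ge0 // ler_pdivrMr // mul1r ler_nat.
  apply: le_trans (fL x _ x01 i01) _.
  set d := _ - x; have -> : i%:R - n%:R * x = n%:R * d.
    by rewrite /d mulrBr mulrCA divff ?mulr1 // gt_eqF.
  rewrite exprMn; have -> : L ^+ 2 / e / n%:R ^+ 2 * (n%:R ^+ 2 * d ^+ 2) = (L * `|d|) ^+ 2 / e.
    rewrite exprMn real_normK ?num_real //; field.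
    by rewrite !gt_eqF.
  set t := L * `|d|; rewrite -subr_ge0.
  have -> : e + t ^+ 2 / e - t = ((e - t / 2) ^+ 2 + 3 / 4 * t ^+ 2) / e by field; rewrite gt_eqF.
  apply: divr_ge0; last exact: ltW.
  apply: addr_ge0; first exact: sqr_ge0.
  apply: mulr_ge0; last exact: sqr_ge0.
  lra.
have x1 : x * (1 - x) <= 1 by case/andP: x01 => *; nra.
have -> : e + L ^+ 2 / e / n%:R ^+ 2 * (n%:R * x * (1 - x)) = e + L ^+ 2 / (e * n%:R) * (x * (1 - x)).
  by field; rewrite !gt_eqF.
have : L ^+ 2 / (e * n%:R) <= e by rewrite ler_pdivrMr ?mulr_gt0 // mulrA -expr2.
have : 0 <= L ^+ 2 / (e * n%:R) by rewrite divr_ge0 ?sqr_ge0 // mulr_ge0 // ltW.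
by move: (L ^+ 2 / _) (x * _) x1 => u v *; nra.
Qed.

End bernstein.

Section cabs.
Variable R : realType.
Implicit Types z w : R[i].

(* A real-valued norm: [`|z|] takes its values in [R[i]]. *)
Definition cabs z : R := `|complex.Re z| + `|complex.Im z|.

Lemma Re_add z w : complex.Re (z + w) = complex.Re z + complex.Re w.
Proof. by case: z; case: w. Qed.

Lemma Im_add z w : complex.Im (z + w) = complex.Im z + complex.Im w.
Proof. by case: z; case: w. Qed.

Lemma Re_opp z : complex.Re (- z) = - complex.Re z. Proof. by case: z. Qed.
Lemma Im_opp z : complex.Im (- z) = - complex.Im z. Proof. by case: z. Qed.

Lemma norm_le_cabs z : `|z| <= (cabs z)%:C.
Proof.
case: z => a b; rewrite normc_def lecR /cabs /=.
rewrite -(@ler_pXn2r _ 2) ?nnegrE ?sqrtr_ge0 ?addr_ge0 //.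
rewrite sqr_sqrtr ?addr_ge0 ?sqr_ge0 // sqrrD !real_normK ?num_real //.
by rewrite addrAC lerDl mulrn_wge0 // mulr_ge0.
Qed.

Lemma cabs_le_norm z (e : R) : `|z| < e%:C -> cabs z < 2 * e.
Proof.
move=> ze; have re := le_lt_trans (normc_ge_Re z) ze.
have im : `|complex.Im z|%:C < e%:C.
  have := normc_ge_Re (z * 'i); rewrite ReiNIm normrN => /le_lt_trans; apply.
  rewrite normrM (_ : `|'i%C : R[i]| = 1) ?mulr1 //.
  by rewrite normc_def /= expr0n /= add0r expr1n sqrtr1.
by rewrite /cabs; move: re im; rewrite !ltcR; lra.
Qed.

End cabs.

(** * Polynomials as test functions *)

Section testpoly.
Variable R : realType.
Implicit Types (P Q : {poly R[i]}) (phi psi : testfun R).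

Definition poly_fun P : R -> R[i]^o := fun x => P.[x%:C].

Lemma cderive_poly P : cderivable (poly_fun P) /\ cderive (poly_fun P) = poly_fun P^`().
Proof.
apply: is_derive_cderive => x.
elim/poly_ind: P => [|P c [IHre IHim]].
  rewrite deriv0 /poly_fun !horner0 /=.
  have -> : re_part (poly_fun 0) = cst 0 by apply/funext => y; rewrite /re_part /poly_fun horner0.
  have -> : im_part (poly_fun 0) = cst 0 by apply/funext => y; rewrite /im_part /poly_fun horner0.
  by split; exact: is_derive_cst.
have reE : re_part (poly_fun (P * 'X + c%:P)) =
    (re_part (poly_fun P) * id + cst (complex.Re c))%R.
  apply/funext => y; rewrite /re_part /poly_fun !hornerE !fctE.
  by case: (P.[_]) => a b; case: (c) => a' b' /=; rewrite mulr0 subr0.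
have imE : im_part (poly_fun (P * 'X + c%:P)) =
    (im_part (poly_fun P) * id + cst (complex.Im c))%R.
  apply/funext => y; rewrite /im_part /poly_fun !hornerE !fctE.
  by case: (P.[_]) => a b; case: (c) => a' b' /=; rewrite mulr0 add0r.
have dre := is_deriveD (is_deriveM IHre (is_derive_id x 1)) (is_derive_cst (complex.Re c) x 1).
have dim := is_deriveD (is_deriveM IHim (is_derive_id x 1)) (is_derive_cst (complex.Im c) x 1).
rewrite reE imE; split.
  apply: is_derive_eq; rewrite derivMXaddC /re_part /poly_fun !hornerE.
  case: (P.[_]) => a b; case: (_.[_]) => a' b' /=.
  rewrite /GRing.scale /=; ring.
apply: is_derive_eq; rewrite derivMXaddC /im_part /poly_fun !hornerE.
case: (P.[_]) => a b; case: (_.[_]) => a' b' /=.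
rewrite /GRing.scale /=; ring.
Qed.

Lemma iter_cderive_poly n P : iter n (@cderive R) (poly_fun P) = poly_fun P^`(n).
Proof.
elim: n => [|n IHn]; first by rewrite derivn0.
by rewrite iterS IHn (cderive_poly _).2 derivnS.
Qed.

Lemma poly_fun_smooth P : poly_fun P \in @smooth R.
Proof. by apply/smoothP => n; rewrite iter_cderive_poly; exact: (cderive_poly _).1. Qed.

Definition polytest P : testfun R := Testfun (poly_fun_smooth P).

Lemma testfunP phi psi : (forall x, phi x = psi x) -> phi = psi.
Proof. by move=> E; apply: val_inj; apply/funext. Qed.

Lemma iter_test_derive n phi :
  iter n (@test_derive R) phi = iter n (@cderive R) phi :> (R -> R[i]^o).
Proof. by elim: n phi => // n IHn phi; rewrite iterS /= IHn. Qed.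

Lemma iter_test_derive_poly n P : iter n (@test_derive R) (polytest P) = polytest P^`(n).
Proof. by apply: testfunP => x; rewrite iter_test_derive iter_cderive_poly. Qed.

Lemma polytest_lin a P Q : polytest (a *: P + Q) = a *: polytest P + polytest Q.
Proof. by apply: testfunP => x; rewrite /= /poly_fun hornerD hornerZ. Qed.

Lemma test_affine_poly d t P :
  test_affine d t (polytest P) = polytest (P \Po (d%:C *: 'X + t%:C%:P)).
Proof.
apply: testfunP => x; rewrite /= /poly_fun horner_comp !hornerE.
by rewrite rmorphD rmorphM.
Qed.

End testpoly.

Section test_topology.
Variable R : realType.
Implicit Types (phi psi : testfun R).

(** Translates the initial topology of [jet] into estimates with [cabs] on intervals; [test_cvg]
    goes the other way. *)
Lemma near_jet phi n (A e : R) : 0 < e -> \forall psi \near phi,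
  forall x : R, `|x| <= A -> cabs (iter n (@cderive R) (psi : testfun R) x - iter n (@cderive R) phi x) < e.
Proof.
move=> e0; have cj : {for phi, continuous (@jet R)}.
  exact: (@initial_continuous (testfun R) _ (@jet R)).
have cn := continuous_comp cj (@proj_continuous nat (fun=> {family compact, R -> R[i]^o}) n (jet phi)).
have e20 : 0 < (e / 2)%:C :> R[i] by rewrite ltcR divr_gt0.
have cK : compact `[- A, A]%classic by exact: segment_compact.
pose E := [set xy : R[i]^o * R[i]^o | ball xy.1 (e / 2)%:C xy.2].
pose B := [set g : R -> R[i]^o | forall y, `[- A, A]%classic y -> E (proj n (jet phi) y, g y)].
have nB : nbhs phi ((proj n \o @jet R) @^-1` B).
  by apply: cn; exact: (fam_nbhs (proj n (jet phi)) (entourage_ball _ (PosNum e20)) cK).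
apply: filterS nB => psi h x xA.
have /h : `[- A, A]%classic x by rewrite /= in_itv /= -ler_norml.
rewrite /E /ball /= => xe; rewrite (_ : e = 2 * (e / 2)); last by field.
by apply: cabs_le_norm; rewrite distrC.
Qed.

Lemma initial_cvg (S : choiceType) (T : topologicalType) (f : S -> T)
    (F : set_system S) (s : S) : Filter F ->
  f @ F --> f s -> F --> (s : initial_topology f).
Proof.
move=> FF cf A /= [_ [[B Bop <-] Bs] sBA].
by apply: filterS sBA _; apply: cf; exact: open_nbhs_nbhs.
Qed.

Lemma test_cvg (I : Type) (F : set_system I) (u : I -> testfun R) phi : Filter F ->
  (forall n (A e : R), 0 < e -> \forall j \near F, forall x, `|x| <= A ->
    cabs (iter n (@cderive R) (u j) x - iter n (@cderive R) phi x) < e) ->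
  u @ F --> phi.
Proof.
move=> FF uc; apply: (@initial_cvg (testfun R) _ (@jet R)).
apply/cvg_sup => n; apply: initial_cvg; apply/fam_cvgP => K cK.
move=> Q /uniform_nbhs [E [entE EQ]].
have := entE; rewrite -entourage_from_ballE => -[e /= e0 eE].
have eR : e = (complex.Re e)%:C by rewrite RRe_real // gtr0_real.
have Re0 : 0 < complex.Re e by rewrite -ltcR -eR.
have [A KA] : exists A, forall x, K x -> `|x| <= A.
  have [M [_ hM]] := compact_bounded cK; exists (`|M| + 1) => x Kx.
  by apply: (hM (`|M| + 1)) => //; rewrite ltr_pwDr // ler_norm.
apply: filterS (uc n A _ Re0) => j uj; apply: EQ => x Kx; apply: eE.
rewrite /ball /= distrC eR; apply: le_lt_trans (norm_le_cabs _) _.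
by rewrite ltcR; apply: uj; exact: KA.
Qed.

Lemma iter_cderive_lin n a phi psi : iter n (@cderive R) (a *: phi + psi : testfun R) =
  a *: iter n (@cderive R) phi + iter n (@cderive R) psi :> (R -> R[i]^o).
Proof.
elim: n => // n IHn; rewrite !iterS IHn.
by rewrite (cderivable_lin a (elimT (smoothP _) (valP phi) n) (elimT (smoothP _) (valP psi) n)).2.
Qed.

End test_topology.

Section real_functions.
Variable R : realType.
Implicit Types (f df : R -> R).

Lemma is_derive_continuous f df : (forall x : R, is_derive x 1 f (df x)) -> continuous f.
Proof.
move=> d x; apply/differentiable_continuous; rewrite -derivable1_diffP.
exact: ex_derive.
Qed.

Lemma lipschitz_of_bound f df (A L : R) : (forall x : R, is_derive x 1 f (df x)) ->
  (forall z, `|z| <= A -> `|df z| <= L) ->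
  forall x y, `|x| <= A -> `|y| <= A -> `|f y - f x| <= L * `|y - x|.
Proof.
move=> d dL; have main x y : x <= y -> `|x| <= A -> `|y| <= A -> `|f y - f x| <= L * `|y - x|.
  move=> xy xA yA.
  have [|c cI ->] := @MVT_segment R f df x y xy (fun z _ => d z).
    by apply: continuous_subspaceT; exact: is_derive_continuous d.
  rewrite normrM ler_wpM2r // dL //; move: cI xA yA; rewrite in_itv /= !ler_norml.
  by move=> /andP[? ?] /andP[? ?] /andP[? ?]; apply/andP; split; lra.
move=> x y xA yA; case: (leP x y) => [xy|/ltW yx]; first exact: main.
by rewrite distrC [`|y - x|]distrC; exact: main.
Qed.

Lemma bounded_on_segment f (A : R) : continuous f ->
  exists2 L, 0 <= L & forall z, `|z| <= A -> `|f z| <= L.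
Proof.
move=> cf; have cK : compact (f @` `[- A, A]%classic).
  apply: (continuous_compact _ (@segment_compact _ _ _)).
  exact: continuous_subspaceT.
have [M [_ hM]] := compact_bounded cK; exists (`|M| + 1); first by rewrite addr_ge0.
move=> z zA; apply: (hM (`|M| + 1)); first by rewrite ltr_pwDr // ler_norm.
by exists z => //=; rewrite in_itv /= -ler_norml.
Qed.

(** An affine map carries [[-A, A]] to [[0, 1]], where Bernstein polynomials approximate Lipschitz
    functions uniformly. *)
Lemma poly_approx_real f df (A e : R) : 0 < A -> 0 < e ->
  (forall x : R, is_derive x 1 f (df x)) -> continuous df ->
  exists P : {poly R}, forall x, `|x| <= A -> `|P.[x] - f x| <= e.
Proof.
move=> A0 e0 d /(bounded_on_segment A)[L L0 dL].
have fL := lipschitz_of_bound d dL.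
pose g t := f (2 * A * t - A); pose e2 := e / 2.
have e20 : 0 < e2 by rewrite divr_gt0.
pose L' := L * (2 * A); have L'0 : 0 <= L' by rewrite !mulr_ge0 // ltW.
have gL x y : 0 <= x <= 1 -> 0 <= y <= 1 -> `|g y - g x| <= L' * `|y - x|.
  move=> /andP[x0 x1] /andP[y0 y1].
  have sc t : 0 <= t -> t <= 1 -> `|2 * A * t - A| <= A.
    by move=> *; rewrite ler_norml; apply/andP; split; nra.
  rewrite /g /L'; apply: le_trans (fL _ _ (sc _ x0 x1) (sc _ y0 y1)) _.
  rewrite -[leRHS]mulrA; apply: ler_wpM2l => //.
  rewrite -[X in X * `|y - x|]ger0_norm ?mulr_ge0 ?(ltW A0) // -normrM.
  by rewrite le_eqVlt; apply/orP; left; apply/eqP; congr `|_|; ring.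
have [n n0 nL] : exists2 n, (0 < n)%N & L' ^+ 2 <= e2 ^+ 2 * n%:R.
  exists (Num.truncn (L' ^+ 2 / e2 ^+ 2)).+1 => //.
  rewrite mulrC -ler_pdivrMr ?exprn_gt0 //; apply: ltW; exact: Num.Theory.truncnS_gt.
pose B := bernstein n (fun i => g (i%:R / n%:R)).
exists (B \Po ((2 * A)^-1 *: 'X + (2^-1)%:P)) => x; rewrite ler_norml => /andP[xA Ax].
pose t := (2 * A)^-1 * x + 2^-1.
have tE : 2 * A * t - A = x by rewrite /t; field; rewrite gt_eqF.
have t01 : 0 <= t <= 1 by apply/andP; split; nra.
rewrite horner_comp !hornerE -/t -[in f x]tE -/(g t).
by have := bernstein_lipschitz e20 L'0 t01 n0 nL gL; rewrite /e2 mulrC divfK.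
Qed.

End real_functions.

Section density.
Variable R : realType.
Implicit Types (phi psi : testfun R) (P : {poly R[i]}).

Lemma test_is_derive phi (x : R) : is_derive x 1 (re_part phi) (re_part (test_derive phi) x) /\
  is_derive x 1 (im_part phi) (im_part (test_derive phi) x).
Proof. by apply: is_derive_cderivable; have /smoothP/(_ 0%N) := valP phi. Qed.

(** Approximate the derivative first, then take the primitive with the right value at 0; the mean
    value theorem controls the error of the primitive. *)
Lemma test_approx n phi (A e : R) : 0 < A -> 0 < e -> exists P, forall i x, (i <= n)%N ->
  `|x| <= A -> cabs (iter i (@cderive R) (polytest P) x - iter i (@cderive R) phi x) < e.
Proof.
move=> A0; elim: n phi e => [|n IHn] phi e e0.
  have e40 : 0 < e / 4 by rewrite divr_gt0.
  have dre x := (test_is_derive phi x).1; have dim x := (test_is_derive phi x).2.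
  have cre : continuous (re_part (test_derive phi)).
    exact: is_derive_continuous (fun x => (test_is_derive (test_derive phi) x).1).
  have cim : continuous (im_part (test_derive phi)).
    exact: is_derive_continuous (fun x => (test_is_derive (test_derive phi) x).2).
  have [P hP] := poly_approx_real A0 e40 dre cre.
  have [Q hQ] := poly_approx_real A0 e40 dim cim.
  exists (map_poly (real_complex R) P + 'i *: map_poly (real_complex R) Q) => i x.
  rewrite leqn0 => /eqP -> xA /=; rewrite /poly_fun hornerD hornerZ !horner_map /=.
  have := hP x xA; have := hQ x xA; rewrite /re_part /im_part.
  case: (testfun_val phi x) => a b; rewrite /cabs /= => h1 h2.
  rewrite !mul0r !mul1r subrr addr0 !add0r.
  by lra.
(* For derivatives of positive order the error stays below [e']; for the function itself the real
   and the imaginary part contribute at most [A * e'] each. *)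
pose e' := e / (2 * (A + 1)); have e'0 : 0 < e' by rewrite divr_gt0 // mulr_gt0 // addr_gt0.
have e'e : e' <= e by rewrite ler_pdivrMr ?mulr_gt0 ?addr_gt0 //; nra.
have e'A : 2 * A * e' < e.
  by rewrite /e' mulrA ltr_pdivrMr ?mulr_gt0 ?addr_gt0 //; nra.
have [Q hQ] := IHn (test_derive phi) e' e'0.
have [P0 P0E] := derivn_surjective 1 Q; rewrite derivn1 in P0E.
pose P := P0 + (phi 0 - P0.[0])%:P; exists P.
have dP : test_derive (polytest P) = polytest Q.
  by rewrite -[LHS]/(iter 1 _ _) iter_test_derive_poly derivn1 derivD derivC addr0 P0E.
have PE0 : polytest P 0 = phi 0.
  by rewrite /= /poly_fun /P hornerD hornerC addrC subrK.
move=> [|i] x ni xA; last first.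
  rewrite !iterSr -[cderive (polytest P)]/(testfun_val (test_derive (polytest P))) dP.
  exact: lt_le_trans (hQ i x ni xA) e'e.
have bound (f g df dg : R -> R) : (forall x : R, is_derive x 1 f (df x)) ->
    (forall x : R, is_derive x 1 g (dg x)) -> f 0 = g 0 ->
    (forall z, `|z| <= A -> `|df z - dg z| <= e') -> `|f x - g x| <= A * e'.
  move=> ff gg fg0 dfg.
  have h (y : R) : is_derive y (1 : R) (f - g) (df y - dg y) by exact: is_deriveB.
  have := lipschitz_of_bound h dfg; move=> /(_ 0 x); rewrite normr0 (ltW A0) => /(_ isT xA).
  rewrite !fctE fg0 subrr !subr0 => /le_trans; apply.
  by rewrite mulrC ler_wpM2r // ltW.
apply: le_lt_trans e'A; rewrite -mulrA [2 * _]mulrDl mul1r /cabs Re_add Im_add Re_opp Im_opp.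
have hQ0 z : `|z| <= A -> cabs (test_derive (polytest P) z - test_derive phi z) <= e'.
  by move=> zA; rewrite dP; apply/ltW/(hQ 0%N).
apply: lerD.
  apply: (bound (re_part (polytest P)) (re_part phi) _ _
    (fun x => (test_is_derive _ x).1) (fun x => (test_is_derive _ x).1)).
    by rewrite /re_part PE0.
  move=> z /hQ0; rewrite /cabs Re_add Re_opp; apply: le_trans.
  by rewrite lerDl.
apply: (bound (im_part (polytest P)) (im_part phi) _ _
    (fun x => (test_is_derive _ x).2) (fun x => (test_is_derive _ x).2)).
  by rewrite /im_part PE0.
move=> z /hQ0; rewrite /cabs Im_add Im_opp; apply: le_trans.
by rewrite lerDr.
Qed.

(** Polynomials [u j] whose derivatives up to order [j] are within [1 / (j + 1)] of those of [phi]
    on [[-j - 1, j + 1]] converge to [phi] in E(R). *)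
Lemma Edual_eq0 (T : testfun R -> R[i]^o) : Edual R T ->
  (forall P, T (polytest P) = 0) -> T = 0.
Proof.
move=> [_ Tc] T0; apply/funext => phi.
have j1 (j : nat) : 0 < j.+1%:R :> R by rewrite ltr0n.
have /choice[u uP] : forall j : nat, exists P, forall i x, (i <= j)%N -> `|x| <= j.+1%:R ->
    cabs (iter i (@cderive R) (polytest P) x - iter i (@cderive R) phi x) < j.+1%:R^-1.
  by move=> j; apply: test_approx; rewrite ?invr_gt0.
have uphi : (fun j => polytest (u j)) @ \oo --> phi.
  apply: test_cvg => n A e e0; near=> j => x xA.
  have Aj : A < j%:R by near: j; exact: nbhs_infty_gtr.
  have ej : e^-1 < j%:R by near: j; exact: nbhs_infty_gtr.
  have jS : (j%:R : R) <= j.+1%:R by rewrite ler_nat.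
  apply: lt_trans (uP j n x _ _) _; first by near: j; exact: nbhs_infty_ge.
    by rewrite (le_trans xA) // (le_trans (ltW Aj)).
  rewrite -[e]invrK ltf_pV2 ?posrE ?invr_gt0 //; exact: lt_le_trans jS.
have := cvg_comp _ _ uphi (Tc phi).
have -> : T \o (fun j => polytest (u j)) = cst 0 by apply/funext => j; exact: T0.
move=> h; apply: (@cvg_unique (R[i]^o) (@norm_hausdorff _ _) _ _ _ _ h).
exact: cvg_cst.
Unshelve. all: by end_near. Qed.

Lemma Edual_ext (S T : testfun R -> R[i]^o) : Edual R S -> Edual R T ->
  (forall P, S (polytest P) = T (polytest P)) -> S = T.
Proof.
move=> [Sl Sc] [Tl Tc] ST; apply/eqP; rewrite -subr_eq0; apply/eqP; apply: Edual_eq0.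
  split; first by move=> a f g; rewrite !fctE Sl Tl scalerBr opprD addrACA.
  by move=> f; exact: (cvgB (Sc f) (Tc f)).
by move=> P; rewrite !fctE ST subrr.
Qed.

End density.

(** * B-splines as elements of E'(R) *)

Section Edual_theory.
Variable R : realType.
Implicit Types (phi psi : testfun R) (S T : testfun R -> R[i]^o).

#[local] Hint Extern 0 (Filter (nbhs_of_open _ _)) =>
  exact: (@nbhs_filter (testfun _)) : typeclass_instances.

Lemma bounded_continuous T n (A M : R) : linear T -> 0 <= M ->
  (forall phi e, (forall x, `|x| <= A -> cabs (iter n (@cderive R) phi x) <= e) ->
    cabs (T phi) <= M * e) -> continuous T.
Proof.
move=> Tl M0 Tb phi; apply/cvgrPdist_lt => e e0.
have eR : e = (complex.Re e)%:C by rewrite RRe_real // gtr0_real.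
have Re0 : 0 < complex.Re e by rewrite -ltcR -eR.
pose d := complex.Re e / (M + 1).
have M1 : 0 < M + 1 by rewrite ltr_wpDl.
have d0 : 0 < d by rewrite divr_gt0.
apply: (@filterS _ (nbhs phi) (nbhs_filter phi) _ _ _ (near_jet phi n A d0)) => psi psid.
rewrite distrC eR; apply: le_lt_trans (norm_le_cabs _) _; rewrite ltcR.
have -> : T psi - T phi = T (-1 *: phi + psi) by rewrite Tl scaleN1r addrC.
apply: (@le_lt_trans _ _ (M * d)).
  apply: Tb => x xA; rewrite iter_cderive_lin scaleN1r !fctE addrC.
  by apply/ltW/psid.
by rewrite /d mulrA ltr_pdivrMr // mulrC ltr_pM2l // ltrDl.
Qed.

Lemma Edual0 : Edual R 0.
Proof.
split=> [a f g|f]; last exact: cvg_cst.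
by transitivity (a *: (0 : R[i]^o) + 0); [rewrite scaler0 addr0|].
Qed.

Lemma Edual_lin a S T : Edual R S -> Edual R T -> Edual R (a *: S + T).
Proof.
move=> [Sl Sc] [Tl Tc]; split.
  move=> b f g; rewrite !fctE Sl Tl !scalerDr !scalerA [a * b]mulrC.
  by rewrite addrACA.
by move=> f; exact: (cvgD (cvgZl_tmp (Sc f)) (Tc f)).
Qed.

Lemma test_derive_lin a phi psi :
  test_derive (a *: phi + psi) = a *: test_derive phi + test_derive psi.
Proof. by apply: testfunP => x; have := iter_cderive_lin 1 a phi psi => /= ->. Qed.

Lemma test_derive_continuous : continuous (@test_derive R).
Proof.
move=> phi; apply: test_cvg => n A e e0.
apply: (@filterS _ (nbhs phi) (nbhs_filter phi) _ _ _ (near_jet phi n.+1 A e0)) => psi h x xA.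
by have := h x xA; rewrite !iterSr.
Qed.

Lemma Edual_derive T : Edual R T -> Edual R (dderive T).
Proof.
move=> [Tl Tc]; split.
  move=> a f g; rewrite /dderive test_derive_lin Tl opprD.
  by rewrite scalerN.
move=> f; apply: cvgN.
exact: (cvg_comp _ _ (@test_derive_continuous f) (Tc (test_derive f))).
Qed.

Lemma Edual_iter_derive n T : Edual R T -> Edual R (iter n (@dderive R) T).
Proof. by move=> ET; elim: n => [|n IHn]; [exact: ET|exact: Edual_derive IHn]. Qed.

Lemma iter_dderiveE n T phi :
  iter n (@dderive R) T phi = (-1) ^+ n * T (iter n (@test_derive R) phi).
Proof.
elim: n phi => [|n IHn] phi; first by rewrite mul1r.
by rewrite iterS /dderive IHn exprS -mulrA mulN1r -iterSr.
Qed.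

Lemma Edual_Dirac (a : R) : Edual R (Dirac a).
Proof.
have Dl : linear (@Dirac R a) by move=> b f g.
split=> //; apply: (@bounded_continuous _ 0%N `|a| 1 Dl) => // phi e h.
by rewrite mul1r; exact: h.
Qed.

(** This class is stable under sums and affine factors, as the B-spline recursion requires, and its
    members are integrable against continuous functions. *)
Definition compact_kernel (f : R -> R) := measurable_fun setT f /\
  exists2 A : R, 0 <= A & exists2 M : R, 0 <= M &
    forall x, `|f x| <= M /\ (A < `|x| -> f x = 0).

Lemma kernel_integrable (f g : R -> R) : compact_kernel f -> continuous g ->
  lebesgue_measure.-integrable setT (EFin \o (fun x => f x * g x)).
Proof.
move=> [mf [A A0 [M M0 hf]]] cg.
have -> : EFin \o (fun x => f x * g x) = (EFin \o (fun x => f x * g x)) \_ `[- A, A]%classic.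
  apply/funext => x /=; rewrite patchE; case: ifPn => //.
  rewrite notin_setE /= in_itv /= -ler_norml => /negP; rewrite -ltNge => /(hf x).2 ->.
  by rewrite mul0r.
have mI : measurable `[- A, A]%classic by [].
apply: (integrable_mkcond (mu := @lebesgue_measure R) _ mI).1.
apply: (measurable_bounded_integrable (mu := @lebesgue_measure R)
  (f := fun x : R => f x * g x) mI).
- by apply: compact_finite_measure; exact: segment_compact.
- apply: (@measurable_funS _ _ _ _ setT) => //.
  by apply: measurable_funM => //; exact: continuous_measurable_fun.
- have [L L0 hL] := bounded_on_segment A cg.
  exists (M * L); split; first exact: num_real.
  move=> r Mr x /=; rewrite in_itv /= -ler_norml => xA; apply: le_trans (ltW Mr).
  by rewrite normrM ler_pM // ?(hf x).1 // hL.
Qed.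

Lemma kernel_int_bound (f g : R -> R) (A M e : R) : measurable_fun setT f -> 0 <= A -> 0 <= M ->
  (forall x, `|f x| <= M /\ (A < `|x| -> f x = 0)) -> continuous g ->
  (forall x, `|x| <= A -> `|g x| <= e) ->
  `|\int[lebesgue_measure]_x (f x * g x)| <= M * e * (2 * A).
Proof.
move=> mf A0 M0 hf cg ge.
have kf : compact_kernel f by split=> //; exists A => //; exists M.
have ifg := kernel_integrable kf cg.
have e0 : 0 <= e by apply: le_trans (ge 0 _); rewrite ?normr0.
apply: le_trans (le_normr_Rintegral _ ifg) _ => //.
have -> : M * e * (2 * A) = \int[lebesgue_measure]_(x in `[- A, A]) (M * e).
  have mE : @lebesgue_measure R `[- A, A]%classic = (2 * A)%:E.
    rewrite lebesgue_measure_itv /= lte_fin.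
    case: ltP => [_|h]; first by rewrite -EFinD /= opprK; congr (_%:E); ring.
    by have -> : A = 0; [lra|]; rewrite mulr0.
  by rewrite Rintegral_cst // [X in fine X]mE.
rewrite [leRHS]Rintegral_mkcond; apply: le_Rintegral => //.
- by have := integrable_abse ifg; congr (_.-integrable _ _).
- have -> : EFin \o ((fun=> M * e) \_ `[- A, A]) = (EFin \o (fun=> M * e)) \_ `[- A, A]%classic.
    by apply/funext => x; rewrite /= !patchE; case: ifP.
  have mI : measurable `[- A, A]%classic by [].
  apply: (integrable_mkcond (mu := @lebesgue_measure R) _ mI).1; apply: continuous_compact_integrable => //.
    exact: segment_compact.
  by apply: continuous_subspaceT => x; exact: cvg_cst.
- move=> x _; rewrite patchE; case: ifPn.
    by rewrite inE /= in_itv /= -ler_norml => xA; rewrite normrM ler_pM // ?(hf x).1 // ge.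
  rewrite notin_setE /= in_itv /= -ler_norml => /negP; rewrite -ltNge => /(hf x).2 ->.
  by rewrite mul0r normr0.
Qed.

Lemma re_part_continuous phi : continuous (re_part phi).
Proof. exact: is_derive_continuous (fun x => (test_is_derive phi x).1). Qed.

Lemma im_part_continuous phi : continuous (im_part phi).
Proof. exact: is_derive_continuous (fun x => (test_is_derive phi x).2). Qed.

Lemma complex_ext (z w : R[i]) :
  complex.Re z = complex.Re w -> complex.Im z = complex.Im w -> z = w.
Proof. by case: z; case: w => /= a b c d -> ->. Qed.

Lemma kernel_int_lin (f : R -> R) (a b : R) (g h w : R -> R) : compact_kernel f ->
  continuous g -> continuous h -> continuous w ->
  \int[lebesgue_measure]_x (f x * (a * g x + b * h x + w x)) =
  a * (\int[lebesgue_measure]_x (f x * g x)) + b * (\int[lebesgue_measure]_x (f x * h x))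
    + \int[lebesgue_measure]_x (f x * w x).
Proof.
move=> kf cg ch cw.
have ig := kernel_integrable kf cg; have ih := kernel_integrable kf ch.
have iw := kernel_integrable kf cw.
have iag : lebesgue_measure.-integrable setT (EFin \o (fun x => a * (f x * g x))).
  have := integrableZl measurableT a ig.
  by apply: eq_integrable => // x _; rewrite /= EFinM.
have ibh : lebesgue_measure.-integrable setT (EFin \o (fun x => b * (f x * h x))).
  have := integrableZl measurableT b ih.
  by apply: eq_integrable => // x _; rewrite /= EFinM.
have iagbh : lebesgue_measure.-integrable setT
    (EFin \o (fun x => a * (f x * g x) + b * (f x * h x))).
  have := integrableD measurableT iag ibh.
  by apply: eq_integrable => // x _; rewrite /= EFinD.
rewrite -RintegralZl // -RintegralZl // -RintegralD // -RintegralD //.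
by apply: eq_Rintegral => x _; ring.
Qed.

Lemma Edual_induced f : compact_kernel f -> Edual R (induced_distr f).
Proof.
move=> kf; have [mf [A A0 [M M0 hf]]] := kf.
have il : linear (induced_distr f : testfun R -> R[i]^o).
  move=> c phi psi; rewrite /induced_distr.
  rewrite -[testfun_val (c *: phi + psi)]/(c *: (phi : R -> R[i]^o) + psi).
  rewrite re_part_lin im_part_lin.
  rewrite !kernel_int_lin //; try exact: re_part_continuous; try exact: im_part_continuous.
  by apply: complex_ext; case: (c) => u v /=; ring.
split=> //; apply: (@bounded_continuous _ 0%N A (2 * (M * (2 * A))) il).
  by rewrite !mulr_ge0.
move=> phi e h; rewrite /cabs /=.
have h1 : forall x, `|x| <= A -> `|re_part phi x| <= e.
  by move=> x /h; apply: le_trans; rewrite /cabs lerDl.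
have h2 : forall x, `|x| <= A -> `|im_part phi x| <= e.
  by move=> x /h; apply: le_trans; rewrite /cabs lerDr.
have := kernel_int_bound mf A0 M0 hf (@re_part_continuous phi) h1.
have := kernel_int_bound mf A0 M0 hf (@im_part_continuous phi) h2.
by move: (Rintegral _ _ _) (Rintegral _ _ _) => u v; lra.
Qed.

End Edual_theory.

Lemma derivn_XsubC_mul (K : nzRingType) (c : K) (P : {poly K}) n :
  (('X - c%:P) * P)^`(n.+1) = ('X - c%:P) * P^`(n.+1) + P^`(n) *+ n.+1.
Proof.
elim: n => [|n IHn]; first by rewrite derivn1 derivM derivXsubC mul1r addrC derivn0.
rewrite derivnS IHn derivD derivM derivXsubC mul1r derivMn -!derivnS.
by rewrite addrAC -mulrS addrC.
Qed.

(** * B-splines as Peano kernels of divided differences *)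

Section bspline.
Variable R : realType.
Implicit Types (P : {poly R[i]}) (a : nat -> R).

Lemma bspline_funSS r a t : bspline_fun r.+2 a t =
  (t - a 0%N) / (a r.+1 - a 0%N) * bspline_fun r.+1 a t
  + (a r.+2 - t) / (a r.+2 - a 1%N) * bspline_fun r.+1 (fun j => a j.+1) t.
Proof. by []. Qed.

Definition increasing_nodes r a := forall i, (i < r)%N -> a i < a i.+1.

Lemma increasing_nodesS r a : increasing_nodes r.+1 a ->
  [/\ increasing_nodes r (fun i => a i.+1), increasing_nodes r a & a 0%N < a r.+1].
Proof.
move=> ia; split; first by move=> i ir; exact: ia.
  by move=> i ir; apply: ia; exact: leqW.
elim: r ia => [|r IHr] ia; first exact: ia.
apply: lt_trans (ia r.+1 (leqnn _)); apply: IHr => i ir; apply: ia; exact: leqW.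
Qed.

Lemma increasing_nodes_lt r a i j : increasing_nodes r a -> (i < j <= r)%N -> a i < a j.
Proof.
move=> ia /andP[ij jr]; elim: j ij jr => // j IHj; rewrite ltnS leq_eqVlt => /predU1P[->|ij] jr.
  exact: ia.
by apply: lt_trans (ia j jr); apply: IHj => //; exact: ltnW.
Qed.

Lemma increasing_distinct r a : increasing_nodes r a ->
  distinct_nodes r (fun i => (a i)%:C).
Proof.
move=> ia i j ir jr /complexI E; apply/eqP; case: ltngtP => // ij.
  by have := @increasing_nodes_lt r a i j ia; rewrite ij jr E ltxx => /(_ isT).
by have := @increasing_nodes_lt r a j i ia; rewrite ij ir E ltxx => /(_ isT).
Qed.

Lemma bspline_fun_out r a t : increasing_nodes r.+1 a ->
  (t <= a 0%N) || (a r.+1 < t) -> bspline_fun r.+1 a t = 0.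
Proof.
elim: r a => [|r IHr] a ia out.
  rewrite /= indicE; case: (boolP (t \in _)) => //; rewrite inE /= in_itv /= => /andP[t0 t1].
  by move: out; rewrite leNgt t0 /= ltNge t1.
have [i1 i2 _] := increasing_nodesS ia.
rewrite bspline_funSS.
have a01 := ia 0%N isT; have ar := ia r.+1 (leqnn _).
rewrite (IHr a) ?(IHr (fun j => a j.+1)) ?mulr0 ?addr0 //.
  by case/orP: out => [t0|->]; rewrite ?orbT // (le_trans t0 (ltW a01)).
by case/orP: out => [->//|tr]; rewrite (lt_trans ar tr) orbT.
Qed.

Lemma bspline_kernel r a : compact_kernel (bspline_fun r.+1 a).
Proof.
elim: r a => [|r IHr] a.
  split; first by apply: measurable_indic; exact: measurable_itv.
  exists (`|a 0%N| + `|a 1%N|); first by rewrite addr_ge0.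
  exists 1 => // x; rewrite /= indicE; split; first by case: (_ \in _); rewrite ?normr1 ?normr0.
  move=> h; case: (boolP (x \in _)) => //; rewrite inE /= in_itv /= => /andP[x0 x1].
  exfalso; move: h; rewrite real_ltNge ?num_real // => /negP; apply.
  have := ler_norm (a 1%N); have := ler_norm (- a 0%N); rewrite normrN => *.
  by rewrite ler_norml; apply/andP; split; have := normr_ge0 (a 0%N); have := normr_ge0 (a 1%N); lra.
have kern f c d : compact_kernel f -> compact_kernel (fun t => (c * t + d) * f t).
  move=> [mf [A A0 [M M0 hf]]]; split.
    apply: measurable_funM => //; apply: continuous_measurable_fun => x.
    by apply: cvgD; [apply: cvgM; [exact: cvg_cst|exact: cvg_id]|exact: cvg_cst].
  exists A => //; exists ((`|c| * A + `|d|) * M); first by rewrite mulr_ge0 // addr_ge0 // mulr_ge0.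
  move=> x; split; last by move=> /(hf x).2 ->; rewrite mulr0.
  have [xA|Ax] := leP `|x| A; last by rewrite (hf x).2 // mulr0 normr0 mulr_ge0 // addr_ge0 // mulr_ge0.
  rewrite normrM ler_pM // ?(hf x).1 //; apply: le_trans (ler_normD _ _) _.
  by rewrite lerD2r normrM ler_wpM2l.
have kernD f g : compact_kernel f -> compact_kernel g -> compact_kernel (fun t => f t + g t).
  move=> [mf [A A0 [M M0 hf]]] [mg [B B0 [N N0 hg]]]; split; first exact: measurable_funD.
  exists (Num.max A B); first by rewrite le_max A0.
  exists (M + N); first by rewrite addr_ge0.
  move=> x; split; first by apply: le_trans (ler_normD _ _) _; rewrite lerD ?(hf x).1 ?(hg x).1.
  by rewrite gt_max => /andP[Ax Bx]; rewrite (hf x).2 // (hg x).2 // addr0.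
have E : bspline_fun r.+2 a = fun t =>
    ((a r.+1 - a 0%N)^-1 * t + - (a 0%N / (a r.+1 - a 0%N))) * bspline_fun r.+1 a t
  + (- (a r.+2 - a 1%N)^-1 * t + a r.+2 / (a r.+2 - a 1%N)) * bspline_fun r.+1 (fun j => a j.+1) t.
  apply/funext => t; rewrite bspline_funSS; congr (_ * _ + _ * _).
    by rewrite mulrBl mulrC.
  by rewrite mulrBl addrC mulNr [t / _]mulrC.
by rewrite E; apply: kernD; apply: kern.
Qed.

Lemma Edual_bspline r a : Edual R (bspline r a).
Proof. by case: r => [|r]; [exact: Edual_Dirac|apply: Edual_induced; exact: bspline_kernel]. Qed.

Lemma kernel_int_lin2 (f g u v : R -> R) (b c : R) :
  compact_kernel f -> compact_kernel g -> continuous u -> continuous v ->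
  \int[lebesgue_measure]_x (b * (f x * u x) + c * (g x * v x)) =
  b * (\int[lebesgue_measure]_x (f x * u x)) + c * (\int[lebesgue_measure]_x (g x * v x)).
Proof.
move=> kf kg cu cv.
have iu := kernel_integrable kf cu; have iv := kernel_integrable kg cv.
have ibu : lebesgue_measure.-integrable setT (EFin \o (fun x => b * (f x * u x))).
  have := integrableZl measurableT b iu.
  by apply: eq_integrable => // x _; rewrite /= EFinM.
have icv : lebesgue_measure.-integrable setT (EFin \o (fun x => c * (g x * v x))).
  have := integrableZl measurableT c iv.
  by apply: eq_integrable => // x _; rewrite /= EFinM.
by rewrite -RintegralZl // -RintegralZl // -RintegralD.
Qed.

Lemma induced_bspline_rec r a P :
  induced_distr (bspline_fun r.+2 a) (polytest P) =
  ((a r.+1 - a 0%N)^-1)%:C *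
    induced_distr (bspline_fun r.+1 a) (polytest (('X - (a 0%N)%:C%:P) * P))
  - ((a r.+2 - a 1%N)^-1)%:C *
    induced_distr (bspline_fun r.+1 (fun j => a j.+1)) (polytest (('X - (a r.+2)%:C%:P) * P)).
Proof.
have kf := bspline_kernel r a; have kg := bspline_kernel r (fun j => a j.+1).
have reM (c : R) x : re_part (polytest (('X - c%:C%:P) * P)) x = (x - c) * re_part (polytest P) x.
  rewrite /re_part /= /poly_fun !hornerE -[x%:C - c%:C]rmorphB.
  by case: (P.[_]) => u v /=; rewrite mul0r subr0.
have imM (c : R) x : im_part (polytest (('X - c%:C%:P) * P)) x = (x - c) * im_part (polytest P) x.
  rewrite /im_part /= /poly_fun !hornerE -[x%:C - c%:C]rmorphB.
  by case: (P.[_]) => u v /=; rewrite mul0r addr0.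
have scal (c x y : R) : c%:C * (x +i* y) = (c * x) +i* (c * y).
  by apply: complex_ext; rewrite /= mul0r ?subr0 ?addr0.
have sub (x y x' y' : R) : (x +i* y) - (x' +i* y') = (x - x') +i* (y - y') by [].
rewrite /induced_distr 2!scal sub; congr (_ +i* _).
  rewrite -mulNr -(kernel_int_lin2 _ _ kf kg (@re_part_continuous _ _) (@re_part_continuous _ _)).
  by apply: eq_Rintegral => x _; rewrite bspline_funSS !reM; ring.
rewrite -mulNr -(kernel_int_lin2 _ _ kf kg (@im_part_continuous _ _) (@im_part_continuous _ _)).
by apply: eq_Rintegral => x _; rewrite bspline_funSS !imM; ring.
Qed.

Lemma int_indic_derive (G g : R -> R) (b c : R) : b < c -> continuous g ->
  (forall x : R, is_derive x 1 G (g x)) ->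
  \int[lebesgue_measure]_x (\1_`]b, c] x * g x) = G c - G b.
Proof.
move=> bc cg dG; have cG := is_derive_continuous dG.
have -> : \int[lebesgue_measure]_x (\1_`]b, c] x * g x) =
    \int[lebesgue_measure]_(x in `]b, c]) g x.
  rewrite [RHS]Rintegral_mkcond; apply: eq_Rintegral => x _.
  by rewrite patchE indicE; case: (x \in _); rewrite ?mul1r ?mul0r.
have icc : lebesgue_measure.-integrable `[b, c]%classic (EFin \o g).
  apply: continuous_compact_integrable; first exact: segment_compact.
  exact: continuous_subspaceT.
rewrite Rintegral_itv_obnd_cbnd; last first.
  by apply: integrableS icc => //; exact: subset_itv_oc_cc.
rewrite /Rintegral (continuous_FTC2 (F := G)) //.
- exact: continuous_subspaceT.
- split; first by move=> x _; exact: ex_derive.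
    by apply: cvg_at_right_filter; exact: cG.
  by apply: cvg_at_left_filter; exact: cG.
- by move=> x _; rewrite derive1E; exact: derive_val.
Qed.

Lemma induced_indic_derive (b c : R) (phi : testfun R) : b < c ->
  induced_distr (\1_`]b, c]) (test_derive phi) = phi c - phi b.
Proof.
move=> bc; rewrite /induced_distr.
rewrite (int_indic_derive bc (@re_part_continuous _ (test_derive phi)) (fun x => (test_is_derive phi x).1)).
rewrite (int_indic_derive bc (@im_part_continuous _ (test_derive phi)) (fun x => (test_is_derive phi x).2)).
by rewrite /re_part /im_part; case: (phi c) => ? ?; case: (phi b).
Qed.

(** The recursion multiplies the derivative of order [r + 2] by a linear factor, which the identity
    [e] moves inside the derivative. The two terms containing the derivative of [P] cancel, both
    being its divided difference at the inner nodes, and those containing [P] combine to the divided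
    difference of next order. Order 1 is the fundamental theorem of calculus. *)
Lemma induced_bspline_divdiff r a P : increasing_nodes r.+1 a ->
  induced_distr (bspline_fun r.+1 a) (polytest P^`(r.+1)) =
  r`!%:R * (a r.+1 - a 0%N)%:C * divdiff r.+1 (fun i => (a i)%:C) P.
Proof.
elim: r a P => [|r IHr] a P ia.
  have a01 := ia 0%N isT.
  rewrite derivn1 -[polytest P^`()]/(polytest P^`(1)).
  rewrite -iter_test_derive_poly [LHS]induced_indic_derive //= fact0 mul1r.
  rewrite rmorphB mulrC divfK // subr_eq0; apply: contraTN a01 => /eqP/complexI ->.
  by rewrite ltxx.
have [i1 i2 _] := increasing_nodesS ia.
have [_ _ a0r] := increasing_nodesS i2; have [_ _ a1r] := increasing_nodesS i1.
have e c : ('X - c%:P) * P^`(r.+2) = (('X - c%:P) * P^`() - r.+1%:R *: P)^`(r.+1).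
  rewrite derivnB derivnZ derivn_XsubC_mul -derivSn -derivSn scaler_nat.
  by rewrite addrK.
have nz (x y : R) : x < y -> (y - x)%:C != 0.
  by move=> xy; rewrite -[0]/(0%:C) (inj_eq (@complexI _)) subr_eq0 gt_eqF.
rewrite induced_bspline_rec !e !IHr // -!complexr0.
have split_ b Q : divdiff r.+1 b (Q - r.+1%:R *: P) = divdiff r.+1 b Q - r.+1%:R * divdiff r.+1 b P.
  by rewrite addrC -scaleNr divdiff_lin mulNr addrC.
rewrite !split_.
rewrite (divdiff_mul_first (a := fun i => (a i)%:C)); last exact: increasing_distinct.
rewrite (divdiff_mul_last (a := fun i => (a i.+1)%:C)); last exact: (increasing_distinct i1).
set A := divdiff r _ _; rewrite !complexr0.
have a02 : (a r.+2 - a 0%N)%:C != 0 by have [_ _ /nz] := increasing_nodesS ia.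
have := @divdiffSE _ r.+1 (fun i => (a i)%:C) P; rewrite -rmorphB => /(_ a02) E.
rewrite -[in RHS]mulrA E factS natrM.
set B := divdiff r.+1 _ P; set D := divdiff r.+1 _ P.
rewrite !rmorphV ?unitfE ?subr_eq0 ?gt_eqF //=.
have n1 := nz _ _ a0r; have n2 := nz _ _ a1r.
move: n1 n2; set u := (_ - _)%:C; set v := (_ - _)%:C => n1 n2.
by field; rewrite -!rmorphB; apply/andP; split; [exact: n2|exact: n1].
Qed.

End bspline.

(** * Compactly supported test functions *)

Section bump.
Variable R : realType.
Implicit Types (p q : {poly R}) (f g : R -> R) (x : R).

Lemma scaleRE (a b : R) : a *: (b : R^o) = a * b. Proof. by []. Qed.

Lemma is_derive_flat f x (C : R) : f x = 0 -> (forall h, `|h| <= 1 -> `|f (h + x)| <= C * h ^+ 2) ->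
  is_derive x 1 f 0.
Proof.
move=> fx fC; suff H : (fun h : R => h^-1 *: ((f \o shift x) (h *: 1) - f x)) @ 0^' --> (0 : R).
  by apply: DeriveDef; [apply/cvg_ex; exists 0|apply: cvg_lim].
have C0 : 0 <= C by have := fC 1; rewrite normr1 expr1n mulr1 => /(_ (lexx _)); apply: le_trans.
apply/cvgrPdist_lt => e e0; rewrite near_withinE.
have d0 : 0 < Num.min 1 (e / (C + 1)) by rewrite lt_min ltr01 divr_gt0 // ltr_wpDl.
near=> h => h0; rewrite sub0r normrN fx subr0 /= [h *: 1]mulr1 normrZ normfV.
have hd : `|h| < Num.min 1 (e / (C + 1)).
  by near: h; have := nbhsx_ballx (0 : R) _ d0; apply: filterS => z; rewrite /ball /= sub0r normrN.
move: hd; rewrite lt_min => /andP[h1 he].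
have hp : 0 < `|h| by rewrite normr_gt0.
rewrite mulrC ltr_pdivrMr //; apply: le_lt_trans (fC h (ltW h1)) _.
rewrite -real_normK ?num_real // expr2 mulrA ltr_pM2r //.
rewrite ltr_pdivlMr in he; last by rewrite ltr_wpDl.
by apply: le_lt_trans he; rewrite mulrC ler_wpM2l // lerDl.
Unshelve. all: by end_near. Qed.

Definition flat p x : R := if 0 < x then p.[x^-1] * expR (- x^-1) else 0.

(** For [t = h^-1] the term of order [d + 2] of the exponential series dominates [p.[t]], which is
    at most [S * t ^+ d], and leaves the factor [h ^+ 2]. *)
Lemma flat_bound p : exists C, forall h, `|h| <= 1 -> `|flat p h| <= C * h ^+ 2.
Proof.
pose S := \sum_(i < size p) `|p`_i|; pose d := size p.
exists (S * (d.+2)`!%:R) => h h1; rewrite /flat.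
have S0 : 0 <= S by rewrite sumr_ge0.
case: ltP => [h0|_]; last by rewrite normr0 mulr_ge0 ?sqr_ge0 // mulr_ge0.
have [t tE] : {t | t = h^-1} by exists h^-1.
have ht : h = t^-1 by rewrite tE invrK.
have t1 : 1 <= t by rewrite tE -[1]invr1 lef_pV2 ?posrE // (le_trans (ler_norm h)).
have t0 : 0 < t by rewrite tE invr_gt0.
have pS : `|p.[t]| <= S * t ^+ d.
  rewrite horner_coef (le_trans (ler_norm_sum _ _ _)) // mulr_suml ler_sum // => i _.
  rewrite normrM ler_wpM2l // normrX ger0_norm ?(ltW t0) //.
  by rewrite ler_weXn2l // ltnW.
have et : t ^+ d.+2 / (d.+2)`!%:R <= expR t.
  by apply: le_trans (expR_ge1Dxn d.+1 (ltW t0)); rewrite lerDr.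
rewrite -tE expRN normrM normfV (ger0_norm (ltW (expR_gt0 t))).
rewrite ler_pdivrMr ?expR_gt0 //; apply: le_trans pS _.
have F0 : (0 : R) < (d.+2)`!%:R by rewrite ltr0n fact_gt0.
rewrite ler_pdivrMr // in et.
rewrite -[X in _ <= X]mulrA -[X in _ <= X]mulrA; apply: ler_wpM2l => //.
have -> : t ^+ d = h ^+ 2 * t ^+ d.+2.
  by rewrite ht exprVn mulrC -[d.+2]addn2 exprD mulfK // gt_eqF ?exprn_gt0.
rewrite [leRHS]mulrCA; apply: ler_wpM2l; first exact: sqr_ge0.
by rewrite mulrC.
Qed.

(* The functions [p(1/x) exp(-1/x)], extended by [0], are closed under derivation. *)
Lemma is_derive_flat_fun p x : is_derive x 1 (flat p) (flat ('X ^+ 2 * (p - p^`())) x).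
Proof.
have [x0|x0|x0] := ltgtP x 0.
- have -> : flat ('X ^+ 2 * (p - p^`())) x = 0 by rewrite /flat ltNge (ltW x0).
  apply: (@near_eq_is_derive _ _ _ (cst 0)).
  near=> y; rewrite /flat ltNge (_ : y <= 0) //.
  by near: y; apply: filterS (lt_nbhsl x0) => y /ltW.
- have -> : flat ('X ^+ 2 * (p - p^`())) x =
      ('X ^+ 2 * (p - p^`())).[x^-1] * expR (- x^-1) by rewrite /flat x0.
  have xn0 : x != 0 by rewrite gt_eqF.
  have dinv : is_derive x 1 (fun y : R => y^-1) (- x ^- 2).
    apply: is_derive_eq (is_deriveV xn0 (is_derive_id x 1)) _.
    by rewrite scaleRE mulr1.
  have dp := is_derive1_comp (is_derive_poly p x^-1) dinv.
  have dn : is_derive x 1 (fun y : R => - y^-1) (- - x ^- 2) := is_deriveN dinv.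
  have de := is_derive1_comp (g := fun y : R => - y^-1) (is_derive_expR (- x^-1)) dn.
  have D : is_derive x 1 (fun y => p.[y^-1] * expR (- y^-1))
      (('X ^+ 2 * (p - p^`())).[x^-1] * expR (- x^-1)).
    apply: is_derive_eq (is_deriveM dp de) _.
    by rewrite !scaleRE /= hornerM hornerXn hornerD hornerN -exprVn; ring.
  apply: (near_eq_is_derive _ D).
  near=> y; rewrite /flat (_ : 0 < y) //.
  by near: y; exact: lt_nbhsr.
- have [C hC] := flat_bound p.
  have -> : flat ('X ^+ 2 * (p - p^`())) x = 0 by rewrite /flat x0 ltxx.
  rewrite x0; apply: (@is_derive_flat _ _ C); first by rewrite /flat ltxx.
  by move=> h h1; rewrite addr0; exact: hC.
Unshelve. all: by end_near. Qed.

(** A class that contains exp(-1/(x(1-x))) on (0, 1), extended by 0, and is stable under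
    differentiation; the sums are there for the product rule. *)
Inductive bump_like : (R -> R) -> Prop :=
| bump_base r p : bump_like (fun x => r.[x] * flat p (x * (1 - x)))
| bump_add f g : bump_like f -> bump_like g -> bump_like (fun x => f x + g x).

Lemma bump_like_out f x : bump_like f -> (x <= 0) || (1 <= x) -> f x = 0.
Proof.
move=> bf out; elim: bf => [r p|f1 g1 _ -> _ ->]; last by rewrite addr0.
rewrite /flat ltNge (_ : x * (1 - x) <= 0) ?mulr0 //.
by case/orP: out => out; nra.
Qed.

Lemma bump_like_derive f : bump_like f ->
  exists2 g, bump_like g & forall x, is_derive x 1 f (g x).
Proof.
elim=> [r p|f1 g1 _ [f1' bf df] _ [g1' bg dg]]; last first.
  by exists (fun x => f1' x + g1' x); [exact: bump_add|move=> x; exact: is_deriveD].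
pose q := 'X ^+ 2 * (p - p^`()).
exists (fun x => r^`().[x] * flat p (x * (1 - x)) + (r * (1%:P - 2 *: 'X)).[x] * flat q (x * (1 - x))).
  by apply: bump_add; exact: bump_base.
move=> x.
have dy : is_derive x 1 (fun y : R => y * (1 - y)) (1 - 2 * x).
  have d1 := is_deriveB (is_derive_cst (1 : R) x 1) (is_derive_id x 1).
  apply: is_derive_eq (is_deriveM (is_derive_id x 1) d1) _.
  by rewrite !scaleRE !fctE /=; ring.
have dc := is_derive1_comp (g := fun y : R => y * (1 - y))
  (is_derive_flat_fun p (x * (1 - x))) dy.
apply: is_derive_eq (is_deriveM (is_derive_poly r x) dc) _.
by rewrite !scaleRE /= -/q hornerM hornerD hornerN hornerZ hornerX hornerC; ring.
Qed.

Definition real_fun f : R -> R[i]^o := fun x => (f x)%:C.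

Lemma cderive_real f g : (forall x, is_derive x 1 f (g x)) ->
  cderivable (real_fun f) /\ cderive (real_fun f) = real_fun g.
Proof. by move=> d; apply: is_derive_cderive => x; split; [exact: d|exact: is_derive_cst]. Qed.

(* A compactly supported function with zero derivative vanishes, so no
   derivative of a nonzero bump vanishes identically. *)
Lemma bump_like_iter n f : bump_like f -> cderivable (iter n (@cderive R) (real_fun f)) /\
  exists2 g, bump_like g & iter n (@cderive R) (real_fun f) = real_fun g /\
    ((forall x, g x = 0) -> forall x, f x = 0).
Proof.
elim: n f => [|n IHn] f bf.
  have [g _ d] := bump_like_derive bf.
  by split; [exact: (cderive_real d).1|exists f].
have [g bg d] := bump_like_derive bf; have [d1 [h bh [hE h0]]] := IHn g bg.
rewrite iterSr (cderive_real d).2; split=> //; exists h => //; split=> // /h0 g0 x.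
have x1 : `|x| <= `|x| + 1 by rewrite lerDl.
have m1 : `|-1 : R| <= `|x| + 1 by rewrite normrN1 lerDr.
have := lipschitz_of_bound (L := 0) d _ m1 x1; rewrite mul0r normr_le0 subr_eq0.
rewrite (@bump_like_out f (-1)) ?lerN10 // => h1; apply/eqP/h1 => z _.
by rewrite g0 normr0.
Qed.

Lemma bump_like_smooth f : bump_like f -> real_fun f \in @smooth R.
Proof. by move=> bf; apply/smoothP => n; have [] := bump_like_iter n bf. Qed.

Lemma iter_cderive_affine (d t : R) (phi : testfun R) n :
  iter n (@cderive R) (test_affine d t phi) =
    d%:C ^+ n *: (fun x => iter n (@cderive R) phi (d * x + t)).
Proof.
have sf := elimT (smoothP _) (valP phi).
elim: n => [|n IHn]; first by rewrite expr0 scale1r.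
have [D1 D2] := cderivable_affine d t (sf n).
by rewrite iterS IHn (cderivableZ _ D1).2 D2 scalerA exprSr.
Qed.

(** Some point [x1] of (0, 1) is not a zero of the [n]-th derivative of the bump, and an affine
    change of variable moves it to [x0]. *)
Lemma local_test n (x0 : R) : exists phi : testfun R, [/\ compact (tsupp phi),
  tsupp phi `<=` `[x0 - 1 / 2, x0 + 1 / 2]%classic & iter n (@cderive R) phi x0 != 0].
Proof.
pose f x : R := (1%:P : {poly R}).[x] * flat 1%:P (x * (1 - x)).
have bf : bump_like f by exact: bump_base.
have fh : f 2^-1 != 0.
  rewrite /f /flat ifT; last by lra.
  by rewrite !hornerC !mul1r gt_eqF ?expR_gt0.
have [_ [g bg [gE g0]]] := bump_like_iter n bf.
have [x1 gx1] : exists x1, g x1 != 0.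
  apply: contrapT => h; case/eqP: fh; apply: g0 => x; apply/eqP/negPn/negP => gx.
  by apply: h; exists x.
have x101 : 0 < x1 < 1.
  by rewrite !ltNge -negb_or; apply: contra gx1 => /(bump_like_out bg)->.
pose b := Testfun (bump_like_smooth bf).
(* The factor 2 halves the support, which therefore stays within 1/2 of [x0] wherever [x1] lies in
   (0, 1). *)
pose phi := test_affine 2 (x1 - 2 * x0) b.
have sub : tsupp phi `<=` `[x0 - 1 / 2, x0 + 1 / 2]%classic.
  have cl : closed `[x0 - 1 / 2, x0 + 1 / 2]%classic by exact: interval_closed.
  rewrite /tsupp [X in _ `<=` X]((closure_id _).1 cl).
  apply: closure_subset => x /=; apply: contraNP => /negP h.
  rewrite /real_fun bump_like_out //; move: h; rewrite in_itv /= negb_and -!ltNge.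
  by case/andP: x101 => ? ? /orP[h|h]; apply/orP; [left|right]; lra.
exists phi; split=> //.
  apply: subclosed_compact sub; [exact: closed_closure|exact: segment_compact].
rewrite iter_cderive_affine fctE gE scaler_eq0 negb_or expf_neq0 //=.
  rewrite (_ : 2 * x0 + (x1 - 2 * x0) = x1); last by ring.
  by rewrite /real_fun -[0]/(0%:C) (inj_eq (@complexI _)).
by rewrite -[0]/(0%:C) (inj_eq (@complexI _)) pnatr_eq0.
Qed.

End bump.

(** * Spline maps *)

Section operations.
Variable R : realType.
Implicit Types (S T : testfun R -> R[i]^o) (s t d : R).

Lemma dspan1 S T : dspan [:: S] T -> exists c : R[i], T = c *: S.
Proof. by move=> [c ->]; rewrite big_ord1; exists (c 0%N). Qed.

Lemma dspan2 S S' T : dspan [:: S; S'] T -> exists b c : R[i], T = b *: S + c *: S'.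
Proof. by move=> [c ->]; rewrite big_ord_recl big_ord1; exists (c 0%N), (c 1%N). Qed.

Lemma test_affine_comp d d' t t' (phi : testfun R) :
  test_affine d t (test_affine d' t' phi) = test_affine (d' * d) (d' * t + t') phi.
Proof. by apply: testfunP => x /=; congr (testfun_val phi _); ring. Qed.

Lemma test_affine10 (phi : testfun R) : test_affine 1 0 phi = phi.
Proof. by apply: testfunP => x /=; rewrite mul1r addr0. Qed.

Lemma dtranslateD s t T : dtranslate s (dtranslate t T) = dtranslate (s + t) T.
Proof.
by apply/funext => phi; rewrite /dtranslate test_affine_comp !mul1r addrC.
Qed.

Lemma dtranslate0 T : dtranslate 0 T = T.
Proof. by apply/funext => phi; rewrite /dtranslate test_affine10. Qed.

Lemma ddilateM d d' T : ddilate d (ddilate d' T) = ddilate (d * d') T.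
Proof.
apply/funext => phi; rewrite /ddilate test_affine_comp mulr0 add0r rmorphM /=.
by rewrite mulrA.
Qed.

Lemma ddilate1 T : ddilate 1 T = T.
Proof. by apply/funext => phi; rewrite /ddilate test_affine10 mul1r. Qed.

Lemma ddilate_translate d t T : ddilate d (dtranslate t T) = dtranslate (d * t) (ddilate d T).
Proof.
apply/funext => phi; rewrite /ddilate /dtranslate !test_affine_comp.
by rewrite mulr0 add0r mulr1 mul1r addr0.
Qed.

Lemma dtranslate_is_linear t : linear (@dtranslate R t).
Proof. by []. Qed.

Lemma ddilate_is_linear d : linear (@ddilate R d).
Proof.
move=> c S T; apply/funext => phi; rewrite /ddilate !fctE mulrDr; congr (_ + _).
exact: mulrCA.
Qed.

Lemma dtranslate_eq0 t : dtranslate t (0 : testfun R -> R[i]^o) = 0.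
Proof. by []. Qed.

Lemma ddilate_eq0 d : ddilate d (0 : testfun R -> R[i]^o) = 0.
Proof. by apply/funext => phi; rewrite /ddilate mulr0. Qed.

Definition act T (u : {poly R[i]}) : testfun R -> R[i]^o :=
  pairing (fun j => dtranslate j%:R T) u.

Lemma act_lin T a u v : act T (a *: u + v) = a *: act T u + act T v.
Proof. exact: pairing_is_linear. Qed.

Lemma act0 T : act T 0 = 0.
Proof. by rewrite /act /pairing size_poly0 big_ord0. Qed.

Lemma actZ T a u : act T (a *: u) = a *: act T u.
Proof. by rewrite -[a *: u]addr0 act_lin act0 addr0. Qed.

Lemma act_Xn T n : act T 'X^n = dtranslate n%:R T.
Proof. exact: pairing_Xn. Qed.

Lemma act_translate T n u : dtranslate n%:R (act T u) = act T ('X^n * u).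
Proof.
rewrite /act (linear_pairing _ _ (dtranslate_is_linear _)) pairingXnM; apply: eq_pairing => j /=.
by rewrite dtranslateD natrD.
Qed.

Lemma actM T u v : act T (u * v) = pairing (fun i => dtranslate i%:R (act T v)) u.
Proof.
rewrite /act pairingM; apply: eq_pairing => i; rewrite (linear_pairing _ _ (dtranslate_is_linear _)).
by apply: eq_pairing => j /=; rewrite dtranslateD natrD.
Qed.

(** Dilating by [N] turns the translation by [j] into the one by [N * j], that is ['X] into
    ['X^N]. *)
Lemma act_dilate T N u v : (0 < N)%N -> ddilate N%:R T = act T v ->
  ddilate N%:R (act T u) = act T (v * (u \Po 'X^N)).
Proof.
move=> N0 E; rewrite mulrC actM pairing_comp_Xn // {1}/act.
rewrite (linear_pairing _ _ (ddilate_is_linear _)).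
by apply: eq_pairing => j; rewrite /= ddilate_translate E natrM.
Qed.

Lemma pairing_eval (phi : nat -> testfun R -> R[i]^o) u (f : testfun R) :
  pairing phi u f = pairing (fun j => phi j f) u.
Proof. by rewrite /pairing fct_sumE. Qed.

Section moments.
Variable T : testfun R -> R[i]^o.
Hypothesis ET : Edual R T.

Definition moment (P : {poly R[i]}) : R[i]^o := T (polytest P).

Lemma moment_is_linear : linear moment.
Proof. by move=> a P Q; rewrite /moment polytest_lin ET.1. Qed.
Definition moment_linear : {linear {poly R[i]} -> R[i]^o} :=
  HB.pack moment (GRing.isLinear.Build R[i] {poly R[i]} R[i]^o _ moment moment_is_linear).

Lemma act_moment u P : act T u (polytest P) =
  pairing (fun j => moment (P \Po affine_poly 1 j%:R)) u.
Proof.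
rewrite /act pairing_eval; apply: eq_pairing => j.
by rewrite /dtranslate test_affine_poly rmorph_nat.
Qed.

Lemma moment_neq0_ex : T <> 0 -> exists P, moment P != 0.
Proof.
move=> T0; apply: contrapT => h; apply: T0; apply: Edual_eq0 => // P.
by apply/eqP/negPn/negP => mP; apply: h; exists P.
Qed.

Lemma act_free u : T <> 0 -> act T u = 0 -> u = 0.
Proof.
move=> /moment_neq0_ex ex E; apply: (@translates_free _ moment_linear) => // P.
by rewrite -act_moment E.
Qed.

Lemma act_inj u v : T <> 0 -> act T u = act T v -> u = v.
Proof.
move=> T0 E; apply/eqP; rewrite -subr_eq0; apply/eqP; apply: act_free => //.
by rewrite -[u - v]addrC -scaleN1r act_lin E scaleN1r addNr.
Qed.

End moments.
End operations.

(** * Tuples of rational, integer and natural knots *)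

Section knot_rows.
Variable k : nat.
Implicit Types (s : seq nat) (a : 'rV[rat]_k.+1).

Definition knot_row s : 'rV[rat]_k.+1 := \row_i (nth0 s i)%:R.

Lemma knot_rowP s : knot_seq k s -> knots k (knot_row s).
Proof.
move=> ks i j ij; rewrite !mxE ltr_nat (knot_lt ks) // ij /=.
by rewrite -ltnS.
Qed.

Lemma insert_knot_row s x : knot_seq k s -> x \notin s ->
  insert (knot_row s) x%:R = \row_(i < k.+2) (nth0 (insert_knot x s) i)%:R.
Proof.
move=> ks xs; have [sz _ _] := insert_knotE ks xs.
have imE : [seq knot_row s 0 j | j : 'I_k.+1] = [seq (y%:R : rat) | y <- s].
  apply: (@eq_from_nth _ 0); first by rewrite size_map size_enum_ord size_map (knot_seqP ks).1.
  move=> i; rewrite size_map size_enum_ord => ik.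
  rewrite (nth_map (Ordinal ik)) ?size_enum_ord // mxE nth_enum_ord //.
  by rewrite (nth_map 0%N) // (knot_seqP ks).1.
apply/rowP => i; rewrite !mxE imE -map_cons sort_map.
rewrite (nth_map 0%N); last by rewrite size_sort /= (knot_seqP ks).1.
congr (nth0 (sort _ _) i)%:R; apply/funext => y; apply/funext => z /=.
exact: ler_nat.
Qed.

Lemma knot_gap s x : knot_seq k s -> (nth0 s 0 < x < nth0 s k)%N -> x \notin s ->
  exists i j : 'I_k.+1, j = i.+1 :> nat /\ knot_row s 0 i < x%:R < knot_row s 0 j.
Proof.
move=> ks /andP[x0 xk] xs.
have ex : exists i, (i <= k)%N && (nth0 s i < x)%N by exists 0%N; rewrite x0.
have ub i : (i <= k)%N && (nth0 s i < x)%N -> (i <= k)%N by case/andP.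
case: (ex_maxnP ex ub) => i /andP[ik ix] imax.
have ik' : (i < k)%N.
  by rewrite ltn_neqAle ik andbT; apply: contraTneq xk => <-; rewrite -leqNgt ltnW.
have iS : (i.+1 < k.+1)%N by [].
exists (Ordinal (leqW ik' : (i < k.+1)%N)), (Ordinal iS); split=> //.
rewrite !mxE /= !ltr_nat ix /= ltn_neqAle leqNgt; apply/andP; split.
  by apply: contra xs => /eqP ->; rewrite (knot_mem ks).
by apply/negP => h; have := imax i.+1; rewrite ik' h => /(_ isT); rewrite ltnn.
Qed.

Lemma col_insert_max s x : knot_seq k s -> x \notin s ->
  col' ord_max (insert (knot_row s) x%:R) = knot_row (take k.+1 (insert_knot x s)).
Proof.
move=> ks xs; rewrite insert_knot_row //; apply/rowP => i.
by rewrite !mxE lift_max nth_take.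
Qed.

Lemma col_insert_0 s x : knot_seq k s -> x \notin s ->
  col' ord0 (insert (knot_row s) x%:R) = knot_row (behead (insert_knot x s)).
Proof.
move=> ks xs; rewrite insert_knot_row //; apply/rowP => i.
by rewrite !mxE lift0 nth_behead.
Qed.

Lemma iota_knot_row : iota_row k = knot_row (iota 0 k.+1).
Proof. by apply/rowP => i; rewrite !mxE nth_iota. Qed.

Lemma knot_row_translate s t : knot_seq k s ->
  knot_row (map (addn t) s) = knot_row s + const_mx t%:R.
Proof.
move=> ks; apply/rowP => i; rewrite !mxE (nth_map 0%N) ?(knot_seqP ks).1 //.
by rewrite natrD addrC.
Qed.

Lemma knot_row_dilate s N : knot_seq k s ->
  knot_row (map (muln N) s) = N%:R *: knot_row s.
Proof.
move=> ks; apply/rowP => i; rewrite !mxE (nth_map 0%N) ?(knot_seqP ks).1 //.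
by rewrite natrM.
Qed.

Lemma knots_translate a t : knots k a -> knots k (a + const_mx t).
Proof. by move=> ka i j ij; rewrite !mxE ltrD2r ka. Qed.

Lemma knots_dilate a d : 0 < d -> knots k a -> knots k (d *: a).
Proof. by move=> d0 ka i j ij; rewrite !mxE ltr_pM2l // ka. Qed.

(** The bound [m] allows the tuple to be pushed as far to the right as the nonvanishing of its
    symbol requires. *)
Lemma int_knots (z : 'rV[int]_k.+1) (m : nat) :
  (forall i j : 'I_k.+1, (i < j)%N -> z 0 i < z 0 j) ->
  exists t s, [/\ (m <= t)%N, knot_seq k s, knot_row s = map_mx intr z + const_mx t%:R &
    forall i : 'I_k.+1, (nth0 s i)%:Z = z 0 i + t%:Z].
Proof.
move=> zi; pose t := (absz (z 0%R ord0) + m)%N; exists t.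
pose s := mkseq (fun i => absz (z 0%R (inord i) + t%:Z)) k.+1.
have zt (i : 'I_k.+1) : 0 <= z 0 i + t%:Z.
  have : z 0 ord0 <= z 0 i.
    by case: (posnP i) => [i0|/(zi ord0 i)/ltW //]; rewrite (_ : i = ord0) //; apply: val_inj.
  by rewrite /t; lia.
have sE (i : 'I_k.+1) : (nth0 s i)%:Z = z 0 i + t%:Z.
  by rewrite nth_mkseq // inord_val gez0_abs.
exists s; split=> //; first exact: leq_addl.
  apply: knot_mkseq => i ik; rewrite -ltz_nat !gez0_abs // ltrD2r zi //.
  by rewrite !inordK // ltnS // ltnW.
apply/rowP => i; rewrite !mxE -[LHS]/((nth0 s i)%:Z%:~R) sE.
by rewrite intrD.
Qed.

Lemma rat_knots a : knots k a -> exists2 d : rat, 0 < d &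
  exists t s, knot_seq k s /\ knot_row s = d *: a + const_mx t%:R.
Proof.
move=> ka; pose d := \prod_j denq (a 0 j).
have d0 : 0 < d by rewrite prodr_gt0 // => j _; exact: denq_gt0.
pose z : 'rV[int]_k.+1 := \row_j (numq (a 0 j) * \prod_(i | i != j) denq (a 0 i)).
have zE : map_mx intr z = d%:~R *: a.
  apply/rowP => j; rewrite !mxE.
  have -> : d = denq (a 0 j) * \prod_(i | i != j) denq (a 0 i) by rewrite /d (bigD1 j).
  rewrite !intrM mulrAC; congr (_ * _).
  by rewrite numqE mulrC.
have dQ0 : 0 < d%:~R :> rat by rewrite ltr0z.
exists d%:~R => //; have [i j ij|t [s [_ ks sE _]]] := @int_knots z 0.
  by rewrite -(ltr_int rat); have := knots_dilate dQ0 ka ij; rewrite -zE !mxE.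
by exists t, s; rewrite sE zE.
Qed.

End knot_rows.

(** * Symbols and moments of a spline map *)

Section spline_maps.
Variables (R : realType) (k : nat) (F : 'rV[rat]_k.+1 -> testfun R -> R[i]^o).
Hypothesis F_neq0 : exists2 a, knots k a & F a <> 0.
Hypothesis F_dual : forall a, knots k a -> Edual R (F a).
Hypothesis F_span : span_condition F.
Hypothesis F_trans : translation_invariance F.
Hypothesis F_dil : dilation_invariance F.
Implicit Types (s : seq nat) (a : 'rV[rat]_k.+1).

(** If the factor offered by the invariance is 0, the translated value vanishes; translating back
    shows that [F a] vanishes too, and the factor 1 serves as well. *)
Lemma translate_spline a (t : rat) : knots k a -> exists2 c : R[i], c != 0 &
  F (a + const_mx t) = c *: dtranslate (ratr t) (F a).
Proof.
move=> ka; have [c cE] := dspan1 (F_trans ka t).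
have [c0|c0] := eqVneq c 0; last by exists c.
exists 1; rewrite ?oner_eq0 // scale1r cE c0 scale0r.
have [d] := dspan1 (F_trans (knots_translate t ka) (- t)).
rewrite -addrA -raddfD /= subrr raddf0 addr0 cE c0 scale0r dtranslate_eq0 scaler0 => ->.
by rewrite dtranslate_eq0.
Qed.

Lemma dilate_spline a (d : rat) : 0 < d -> knots k a -> exists2 c : R[i], c != 0 &
  F (d *: a) = c *: ddilate (ratr d) (F a).
Proof.
move=> d0 ka; have [c cE] := dspan1 (F_dil ka d0).
have [c0|c0] := eqVneq c 0; last by exists c.
exists 1; rewrite ?oner_eq0 // scale1r cE c0 scale0r.
have d0' : 0 < d^-1 by rewrite invr_gt0.
have [e] := dspan1 (F_dil (knots_dilate d0 ka) d0').
rewrite scalerA mulVf ?gt_eqF // scale1r cE c0 scale0r ddilate_eq0 scaler0 => ->.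
by rewrite ddilate_eq0.
Qed.

Let T := F (iota_row k).

Lemma knots_iota : knots k (iota_row k).
Proof. by rewrite iota_knot_row; apply: knot_rowP; exact: knot_iota. Qed.

Lemma insert_spline s x : knot_seq k s -> (nth0 s 0 < x < nth0 s k)%N -> x \notin s ->
  exists b c : R[i], F (knot_row k s) =
    b *: F (knot_row k (take k.+1 (insert_knot x s))) +
    c *: F (knot_row k (behead (insert_knot x s))).
Proof.
move=> ks x0k xs; have := F_span (knot_rowP ks) (knot_gap ks x0k xs).
by move=> /dspan2; rewrite col_insert_max // col_insert_0.
Qed.

Lemma spline_translates s : knot_seq k s -> exists u, F (knot_row k s) = act T u.
Proof.
move=> ks; pose Q (S : testfun R -> R[i]^o) := exists u, S = act T u.
apply: (insertion_ind (A := predT) (p := fun s => F (knot_row k s)) (Q := Q)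
  insert_spline) => //.
- by exists 0; rewrite act0.
- by move=> b f g [u ->] [v ->]; exists (b *: u + v); rewrite act_lin.
- move=> t kt _ ct; rewrite (@knot_consecutive k t kt); last by move=> x; exact: ct.
  rewrite -[nth0 t 0]addn0 iotaDl knot_row_translate ?knot_iota // -iota_knot_row.
  have [c _ ->] := translate_spline (nth0 t 0)%:R knots_iota.
  by exists (c *: 'X^(nth0 t 0)); rewrite actZ act_Xn ratr_nat.
- exact: all_predT.
Qed.

(** If [T] vanished, so would [F] at all tuples of natural numbers, and every rational tuple is
    obtained from one of these by a translation and a dilation. *)
Lemma base_neq0 : T <> 0.
Proof.
move=> T0; have [a ka] := F_neq0; apply.
have [d d0 [t [s [ks sE]]]] := rat_knots ka.
have [u uE] := spline_translates ks.
have s0 : F (knot_row k s) = 0.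
  by rewrite uE T0 /act /pairing big1 // => j _; rewrite dtranslate_eq0 scaler0.
have kda := knots_dilate d0 ka.
have [c c0] := translate_spline t%:R kda; rewrite -sE s0 => /esym/eqP.
rewrite scaler_eq0 (negPf c0) /= => /eqP da0.
have [e e0] := dilate_spline d0 ka => E.
have {}E : ddilate (ratr d) (F a) = 0.
  apply/eqP; have : e *: ddilate (ratr d) (F a) == 0.
    rewrite -E -[F (d *: a)]dtranslate0 -(subrr (ratr t%:R)) addrC -dtranslateD da0.
    by rewrite dtranslate_eq0.
  by rewrite scaler_eq0 (negPf e0).
rewrite -[F a]ddilate1 -(@mulVf _ (ratr d : R)); last by rewrite fmorph_eq0 gt_eqF.
by rewrite -ddilateM E ddilate_eq0.
Qed.

Definition symbol_spec (p : seq nat -> {poly R[i]}) :=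
  forall s, knot_seq k s -> F (knot_row k s) = act T (p s).

Lemma symbol_exists : exists p, symbol_spec p.
Proof.
have /choice[p pE] : forall s, exists u, knot_seq k s -> F (knot_row k s) = act T u.
  move=> s; have [ks|ks] := boolP (knot_seq k s); last by exists 0.
  by have [u uE] := spline_translates ks; exists u.
by exists p.
Qed.

(** The dilate of [T] by [N] is proportional to [F] at the integer tuple (0, N, ..., kN). *)
Lemma dilation_symbol : exists H : nat -> {poly R[i]},
  forall N, (0 < N)%N -> ddilate N%:R T = act T (H N).
Proof.
have /choice[H HE] : forall N : nat, exists u, (0 < N)%N -> ddilate N%:R T = act T u.
  move=> N; have [->|N0] := posnP N; first by exists 0.
  have ki := knot_iota k 0.
  have [u] := spline_translates (knot_dilate k N0); rewrite knot_row_dilate // -iota_knot_row.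
  have N0' : 0 < N%:R :> rat by rewrite ltr0n.
  have [c c0 ->] := dilate_spline N0' knots_iota; rewrite ratr_nat => E.
  exists (c^-1 *: u) => _.
  by rewrite actZ -E scalerA mulVf // scale1r.
by exists H.
Qed.

Let ET : Edual R T := F_dual knots_iota.

Lemma symbol_structure : exists p H l rho, [/\ symbol_spec p,
  forall N, (0 < N)%N -> ddilate N%:R T = act T (H N) &
  let c := 'X^l * ('X - 1) ^+ rho : {poly R[i]} in
    [/\ (l + rho <= k)%N,
      forall N, (0 < N)%N -> exists2 a : R[i], a != 0 & c * H N = a *: (c \Po 'X^N) &
      forall s, knot_seq k s -> clustered k l (l + rho) s ->
        supp_in (mem [seq nth0 s i | i <- iota l rho.+1]) (c * p s) /\
        ((k * (nth0 s k - nth0 s 0).+1 <= nth0 s l)%N -> p s != 0)]].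
Proof.
have [p pE] := symbol_exists; have [H HE] := dilation_symbol; exists p, H.
have inj := act_inj ET (v := _) base_neq0.
have ki := knot_iota k 0.
have [||||||l [rho h]] := @translate_coefficients _ k p H; last by exists l, rho.
- move=> s x ks x0k xs; have [b [c E]] := insert_spline ks x0k xs.
  have [[k1 k2 _ _] _] := insert_knot_sub ks x0k xs.
  exists b, c; apply: inj; rewrite act_lin actZ -!pE //.
- move=> s t ks; have [b b0 E] := translate_spline t%:R (knot_rowP ks).
  exists b => //; apply: inj; rewrite actZ -act_translate -!pE //.
    by rewrite knot_row_translate // E ratr_nat.
  rewrite /knot_seq size_map (knot_seqP ks).1 eqxx sorted_map.
  by apply: sub_sorted (knot_seqP ks).2 => x y /=; rewrite ltn_add2l.
- apply: inj; rewrite -pE // -iota_knot_row -(expr0 'X) act_Xn.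
  by rewrite dtranslate0.
- move=> N N0; have N0' : 0 < N%:R :> rat by rewrite ltr0n.
  have [b b0 E] := dilate_spline N0' knots_iota; exists b => //; apply: inj.
  rewrite actZ -HE // -pE ?knot_dilate // knot_row_dilate // -iota_knot_row E.
  by rewrite ratr_nat.
- move=> N N0; apply/negP => /eqP H0; have := HE N N0.
  rewrite H0 act0 => E; apply: base_neq0.
  rewrite -[T]ddilate1 -(@mulVf _ (N%:R : R)) ?pnatr_eq0 -?lt0n //.
  by rewrite -ddilateM E ddilate_eq0.
- move=> M N M0 N0; apply: inj; rewrite -HE ?muln_gt0 ?M0 // natrM -ddilateM (HE N) //.
  by apply: act_dilate => //; exact: HE.
Qed.

Definition bspline_symbol l rho : {poly R[i]} := 'X^l * ('X - 1) ^+ rho.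

Lemma base_moments : exists p l rho n C, [/\ symbol_spec p, (l + rho <= k)%N, C != 0,
  forall P, T (polytest P^`(rho)) =
    C * pairing (fun j => (P^`(n)).[j%:R] : R[i]^o) (bspline_symbol l rho) &
  forall s, knot_seq k s -> clustered k l (l + rho) s ->
    supp_in (mem [seq nth0 s i | i <- iota l rho.+1]) (bspline_symbol l rho * p s) /\
    ((k * (nth0 s k - nth0 s 0).+1 <= nth0 s l)%N -> p s != 0)].
Proof.
have [p [H [l [rho [pE HE [lk cH cp]]]]]] := symbol_structure.
rewrite -/(bspline_symbol l rho) in cH cp.
have [b b0 H2] := cH 2%N isT.
have {}H2 : H 2%N = b *: ('X^l * ('X + 1) ^+ rho).
  have c0 : bspline_symbol l rho != 0.
    by rewrite mulf_neq0 ?expf_neq0 ?polyX_eq0 // -[1]polyC1 polyXsubC_eq0.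
  apply: (mulfI c0); rewrite H2 -scalerAr; congr (_ *: _).
  rewrite /bspline_symbol comp_polyM comp_Xn_poly [_ ^+ rho \Po _]rmorphXn /= comp_polyB comp_polyX.
  rewrite -[1]polyC1 comp_polyC polyC1 -exprM mulnC.
  by rewrite [(_ ^+ 2 - 1)]subr_sqr_1 exprMn exprM expr2; ring.
(* The 2 in [b / 2] is the Jacobian in [ddilate]. *)
have [|P|n [C C0 CE]] := @refinable_functional _ (moment_linear ET) (b / 2) l rho.
- exact: moment_neq0_ex base_neq0.
- have := congr1 (fun S => S (polytest P)) (HE 2%N isT).
  rewrite /= act_moment H2 linearZ_LR /= /ddilate test_affine_poly rmorph_nat => E.
  have two0 : 2 != 0 :> R[i] by rewrite pnatr_eq0.
  by rewrite mulrC -scalerA -E; apply: (mulfI two0); rewrite [RHS]mulrA mulfV // mul1r.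
exists p, l, rho, n, C; split=> //.
Qed.

End spline_maps.

(** * Identification with derivatives of B-splines *)

Section spline_identification.
Variable R : realType.
Implicit Types (T : testfun R -> R[i]^o) (P : {poly R[i]}).

Lemma act_moments T (C : R[i]) n rho (c u : {poly R[i]}) : Edual R T ->
  (forall P, T (polytest P^`(rho)) = C * pairing (fun j => (P^`(n)).[j%:R] : R[i]^o) c) ->
  forall P, act T u (polytest P^`(rho)) =
    C * pairing (fun j => (P^`(n)).[j%:R] : R[i]^o) (u * c).
Proof.
move=> ET TE P; rewrite act_moment pairingM -[RHS]pairing_scale.
apply: eq_pairing => i; rewrite /moment.
have -> : P^`(rho) \Po affine_poly 1 i%:R = (P \Po affine_poly 1 i%:R)^`(rho).
  by rewrite derivn_affine expr1n scale1r.
rewrite TE; congr (_ * _); apply: eq_pairing => j.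
by rewrite derivn_affine expr1n scale1r horner_affine mul1r natrD addrC.
Qed.

Lemma bspline_moments rho (a : nat -> R) : increasing_nodes rho a ->
  exists2 C : R[i], C != 0 & forall n P, iter n (@dderive R) (bspline rho a) (polytest P^`(rho)) =
    C * (-1) ^+ n * divdiff rho (fun i => (a i)%:C) P^`(n).
Proof.
move=> ia; have nd n P : iter n (@dderive R) (bspline rho a) (polytest P^`(rho)) =
    (-1) ^+ n * bspline rho a (polytest (P^`(n))^`(rho)).
  by rewrite iter_dderiveE iter_test_derive_poly /derivn -!iterD addnC.
case: rho ia nd => [|r] ia nd.
  by exists 1; [exact: oner_neq0|move=> n P; rewrite nd derivn0 mul1r].
exists (r`!%:R * (a r.+1 - a 0%N)%:C).
  have [_ _ a0r] := increasing_nodesS ia.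
  rewrite mulf_neq0 // ?pnatr_eq0 -?lt0n ?fact_gt0 //.
  by rewrite -[0]/(0%:C) (inj_eq (@complexI _)) subr_eq0 gt_eqF.
move=> n P; rewrite nd [bspline _ _ _]induced_bspline_divdiff //.
by rewrite mulrA [_ * (-1) ^+ n]mulrC.
Qed.

(* [v] carries [rho + 1] point masses and kills the degrees below [rho], which
   makes it a multiple of the divided difference at the dilated nodes. *)
Lemma pairing_divdiff k s l rho (v : {poly R[i]}) (b d : R[i]) :
  knot_seq k s -> (l + rho <= k)%N -> b != 0 -> v != 0 -> ('X - 1) ^+ rho %| v ->
  supp_in (mem [seq nth0 s i | i <- iota l rho.+1]) v ->
  exists2 e : R[i], e != 0 & forall P, pairing (fun i => P.[b * i%:R + d] : R[i]^o) v =
    e * divdiff rho (fun j => b * (nth0 s (l + j))%:R + d) P.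
Proof.
move=> ks lk b0 v0 dv sv.
have E_lin : linear (fun P => pairing (fun i => P.[b * i%:R + d] : R[i]^o) v).
  move=> c P Q; rewrite -pairing_lin; apply: eq_pairing => i.
  by rewrite hornerD hornerZ.
pose E : {linear {poly R[i]} -> R[i]^o} := HB.pack (fun P => pairing (fun i => P.[b * i%:R + d] : R[i]^o) v)
  (GRing.isLinear.Build R[i] {poly R[i]} R[i]^o _ _ E_lin).
have EE P : E P = pairing (fun i => (P \Po affine_poly b d).[i%:R] : R[i]^o) v.
  by apply: eq_pairing => i; rewrite horner_affine.
have all_E P : E P = E 'X^rho * divdiff rho (fun j => b * (nth0 s (l + j))%:R + d) P.
  apply: divdiff_unique.
  - move=> i j ir jr /addIr /(mulfI b0) /eqP; rewrite eqr_nat => /eqP h.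
    have := knot_ltE ks (i := (l + i)%N) (j := (l + j)%N).
    have := knot_ltE ks (i := (l + j)%N) (j := (l + i)%N).
    by rewrite h !ltnn; lia.
  - move=> Q Q0; rewrite -[E Q]/(pairing _ _) /pairing big1 // => i _.
    have [iI|iI] := boolP (val i \in [seq nth0 s i | i <- iota l rho.+1]); last first.
      by rewrite sv ?scale0r.
    have /mapP[j jI ->] := iI; have [j' j'E] : exists j', j = (l + j')%N.
      by exists (j - l)%N; rewrite subnKC //; move: jI; rewrite mem_iota => /andP[].
    by rewrite j'E Q0 ?scaler0 //; move: jI; rewrite mem_iota j'E; lia.
  - move=> Q Qr; rewrite EE (pairing_annihilated dv) //.
    by rewrite size_comp_poly2 // size_polyDl ?size_scale // ?size_polyX // (leq_ltn_trans (size_polyC_leq1 _)).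
exists (E 'X^rho); last by move=> P; rewrite -all_E.
have ut : uniq [seq nth0 s i | i <- iota l rho.+1] by rewrite (nodes_uniq ks) // addnS.
apply: contra v0 => /eqP e0; apply/eqP; apply: (pairing_separates ut).
  exact: sv.
move=> g; rewrite size_map size_iota => gr.
have -> : pairing (fun i => g.[i%:R] : R[i]^o) v = E (g \Po affine_poly b^-1 (- (b^-1 * d))).
  rewrite -[RHS]/(pairing _ _); apply: eq_pairing => i; rewrite horner_affine.
  by congr (g.[_]); field.
by rewrite all_E e0 mul0r.
Qed.

End spline_identification.

Lemma Zknots_clustered k l r (z : 'rV[int]_k.+1) s t : (l <= r <= k)%N -> Zknots l r z ->
  (forall i : 'I_k.+1, (nth0 s i)%:Z = z 0 i + t%:Z) -> clustered k l r s.
Proof.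
move=> /andP[lr rk] [zi zu] sE.
have step i : (i < k)%N -> (i.+1 <= l)%N || (r < i.+1)%N -> nth0 s i.+1 = (nth0 s i).+1.
  move=> ik ilr; have i1 : (i < k.+1)%N by exact: ltnW.
  have i2 : (i.+1 < k.+1)%N by [].
  have e1 : (nth0 s i)%:Z = z 0 (Ordinal i1) + t%:Z := sE (Ordinal i1).
  have e2 : (nth0 s i.+1)%:Z = z 0 (Ordinal i2) + t%:Z := sE (Ordinal i2).
  by have := zu (Ordinal i1) (Ordinal i2) erefl ilr; move: e1 e2; lia.
have left i : (i <= l)%N -> nth0 s i = (nth0 s 0 + i)%N.
  elim: i => [|i IHi] il; first by rewrite addn0.
  by rewrite step ?il ?IHi ?addnS // ?(ltnW il) // (leq_trans il) // (leq_trans lr).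
have right i : (r + i <= k)%N -> nth0 s (r + i)%N = (nth0 s r + i)%N.
  elim: i => [|i IHi]; first by rewrite !addn0.
  by rewrite addnS => ik; rewrite step ?IHi ?addnS ?ltnS ?leq_addr ?orbT // ltnW.
split; first exact: left.
by have := right (k - r)%N; rewrite subnKC // => ->.
Qed.

Section identification.
Variables (R : realType) (k : nat) (F : 'rV[rat]_k.+1 -> testfun R -> R[i]^o).
Hypothesis F_dual : forall a, knots k a -> Edual R (F a).
Hypothesis F_trans : translation_invariance F.
Hypothesis F_dil : dilation_invariance F.

Lemma knots_e_knots l r a : knots_e l r a -> knots k a.
Proof.
move=> [d [d0 [z [zi _] ->]]] i j ij; rewrite !mxE ltr_pM2l // ltr_int.
exact: zi.
Qed.

Lemma spline_identification p l rho n (C : R[i]) a : symbol_spec F p -> (l + rho <= k)%N ->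
  C != 0 ->
  (forall P, F (iota_row k) (polytest P^`(rho)) =
    C * pairing (fun j => (P^`(n)).[j%:R] : R[i]^o) (bspline_symbol R l rho)) ->
  (forall s, knot_seq k s -> clustered k l (l + rho) s ->
    supp_in (mem [seq nth0 s i | i <- iota l rho.+1]) (bspline_symbol R l rho * p s) /\
    ((k * (nth0 s k - nth0 s 0).+1 <= nth0 s l)%N -> p s != 0)) ->
  knots_e l (l + rho) a ->
  exists2 c : R[i], c != 0 & F a = c *: iter n (@dderive R)
    (bspline rho (fun j => ratr (a 0 (inord (l + j))))).
Proof.
move=> pE lk C0 CE cp ae; have ka := knots_e_knots ae.
have [d [d0 [z zZ aE]]] := ae.
have lrk : (l <= l + rho <= k)%N by rewrite leq_addr.
have lk' : (l < k.+1)%N by rewrite ltnS (leq_trans (leq_addr rho l)).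
(* A translation by at least [m] brings the [l]-th entry up to [k] times the length plus one; the
   second summand compensates for a negative entry of [z]. *)
pose m := (k * (absz (z 0%R ord_max - z 0%R ord0)).+1 + absz (z 0%R (Ordinal lk')))%N.
have [t [s [mt ks sE szE]]] := int_knots m zZ.1.
have clu := Zknots_clustered lrk zZ szE.
have far : (k * (nth0 s k - nth0 s 0).+1 <= nth0 s l)%N.
  have e0 : (nth0 s 0)%:Z = z 0 ord0 + t%:Z := szE ord0.
  have ek : (nth0 s k)%:Z = z 0 ord_max + t%:Z := szE ord_max.
  have el : (nth0 s l)%:Z = z 0 (Ordinal lk') + t%:Z := szE (Ordinal lk').
  have h : (nth0 s k - nth0 s 0 <= absz (z 0%R ord_max - z 0%R ord0))%N by lia.
  apply: (@leq_trans (k * (absz (z 0%R ord_max - z 0%R ord0)).+1)).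
    by rewrite leq_mul2l ltnS h orbT.
  by move: mt el; rewrite /m; move: (k * _)%N => u; lia.
have [sv /(_ far) ps0] := cp s ks clu.
set v := _ * p s in sv.
have symb0 : bspline_symbol R l rho != 0.
  by rewrite mulf_neq0 ?expf_neq0 ?polyX_eq0 // -[1]polyC1 polyXsubC_eq0.
have v0 : v != 0 by rewrite mulf_neq0.
have dv : ('X - 1) ^+ rho %| v by rewrite dvdp_mulr // dvdp_mull.
have zE : map_mx intr z = knot_row k s + const_mx (- t%:R) :> 'rV[rat]_k.+1.
  by rewrite sE -addrA -raddfD /= subrr raddf0 addr0.
have [c1 c10 Fz] := translate_spline F_trans (- t%:R) (knot_rowP ks).
have [c2 c20 Fa] := dilate_spline F_dil d0 (knots_translate (- t%:R) (knot_rowP ks)).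
rewrite -zE in Fz Fa; rewrite -aE Fz (pE _ ks) in Fa.
pose b : R[i] := (ratr d : R)%:C; pose tau : R[i] := b * (- t%:R).
have b0 : b != 0 by rewrite /b -[0]/(0%:C) (inj_eq (@complexI _)) fmorph_eq0 gt_eqF.
have [e e0 eE] := pairing_divdiff tau ks lk b0 v0 dv sv.
pose nodes j : R := ratr (a 0 (inord (l + j))).
have inodes : increasing_nodes rho nodes.
  move=> i ir; rewrite /nodes ltr_rat; apply: ka.
  have il : (l + i.+1 < k.+1)%N by rewrite ltnS (leq_trans _ lk) // leq_add2l.
  have il' : (l + i < k.+1)%N by apply: leq_ltn_trans il; rewrite addnS.
  by rewrite !inordK // addnS.
have nodesE j : (j <= rho)%N -> b * (nth0 s (l + j))%:R + tau = (nodes j)%:C.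
  move=> jr; have lj : (l + j < k.+1)%N by rewrite ltnS (leq_trans _ lk) // leq_add2l.
  have -> : nodes j = ratr d * ((nth0 s (l + j))%:R - t%:R).
    rewrite /nodes aE zE !mxE inordK // [LHS]rmorphM; congr (_ * _).
    by rewrite [LHS]rmorphB /= !ratr_nat.
  rewrite [RHS]rmorphM /tau -mulrDr; congr (_ * _).
  by rewrite [RHS]rmorphB /= !rmorph_nat.
have [D D0 DE] := bspline_moments inodes.
have ET : Edual R (F (iota_row k)) by apply: F_dual; exact: knots_iota.
(* The factors come from the dilation, its Jacobian, the translation, the passage from a derivative
   at affine arguments to a derivative of order [rho], and the moments. *)
pose K := c2 * (b * (c1 * (b ^- rho * (C * b ^+ n * e)))).
have bX0 i : b ^+ i != 0 by rewrite expf_neq0.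
have K0 : K != 0 by rewrite /K !mulf_neq0 // invr_neq0.
have sgn : (-1) ^+ n != 0 :> R[i] by rewrite expf_neq0 // oppr_eq0 oner_eq0.
exists (K / (D * (-1) ^+ n)); first by rewrite mulf_neq0 // invr_neq0 // mulf_neq0.
have EB : Edual R (iter n (@dderive R) (bspline rho nodes)).
  by apply: Edual_iter_derive; exact: Edual_bspline.
apply: Edual_ext; first exact: F_dual.
  by rewrite -[_ *: _]addr0; exact: (Edual_lin _ EB (@Edual0 R)).
(* Every polynomial is a derivative of order [rho], the form in which both sides are known. *)
move=> Q; have [P <-] := derivn_surjective rho Q.
rewrite -[RHS]/(K / (D * (-1) ^+ n) * iter n (@dderive R) (bspline rho nodes) _) DE.
rewrite [RHS]mulrA divfK ?mulf_neq0 // Fa.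
rewrite -[LHS]/(c2 * (b * (c1 * act (F (iota_row k)) (p s) (test_affine 1 (ratr (- t%:R)) (test_affine (ratr d) 0 _))))).
rewrite test_affine_comp test_affine_poly.
have tauE : (ratr d * ratr (- t%:R) + 0 : R)%:C = tau.
  rewrite addr0 [LHS]rmorphM; congr (_ * _).
  by rewrite [ratr _]rmorphN /= ratr_nat [LHS]rmorphN /= rmorph_nat.
rewrite mulr1 tauE -/b -/(affine_poly b tau).
have -> : P^`(rho) \Po affine_poly b tau = b ^- rho *: (P \Po affine_poly b tau)^`(rho).
  by rewrite derivn_affine scalerA mulVf // scale1r.
have ES : Edual R (act (F (iota_row k)) (p s)).
  by rewrite -(pE _ ks); exact: F_dual (knot_rowP ks).
have -> u Q' : act (F (iota_row k)) (p s) (polytest (u *: Q')) =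
    u * act (F (iota_row k)) (p s) (polytest Q').
  exact: (linearZ_LR (moment_linear ES) u Q').
rewrite (act_moments (p s) ET CE) [p s * _]mulrC -/v.
have -> : pairing (fun j => ((P \Po affine_poly b tau)^`(n)).[j%:R] : R[i]^o) v =
    b ^+ n * (e * divdiff rho (fun i => (nodes i)%:C) P^`(n)).
  rewrite -(eq_divdiff _ nodesE) -eE -[RHS]pairing_scale; apply: eq_pairing => j.
  by rewrite derivn_affine hornerZ horner_affine.
by rewrite /K !mulrA.
Qed.

End identification.

(** * Supports and the extremal integers *)

Section supports.
Variable R : realType.
Implicit Types (phi : testfun R) (T : testfun R -> R[i]^o).

Lemma notin_tsupp phi x : ~ tsupp phi x -> phi x = 0.
Proof.
move=> h; apply/eqP/negPn/negP => px; apply: h; exact: subset_closure.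
Qed.

Lemma tsupp_derive phi : tsupp (test_derive phi) `<=` tsupp phi.
Proof.
have cl : closed (tsupp phi) := @closed_closure _ _.
rewrite [X in _ `<=` X]((closure_id _).1 cl); apply: closure_subset => x /=.
apply: contraPP => h; apply/negP; rewrite negbK; apply/eqP.
have op : open (~` tsupp phi) by exact: closed_openC.
have nx : nbhs x (~` tsupp phi) by exact: open_nbhs_nbhs.
have z (f : R -> R) : (forall y, ~ tsupp phi y -> f y = 0) -> derive1 f x = 0.
  move=> f0; have zf : \forall y \near (x : R), f y = (cst 0 : R -> R) y.
    by apply: filterS nx => y /f0.
  by rewrite derive1E (near_eq_derive _ zf) derive_cst.
by apply: complex_ext; apply: z => y /notin_tsupp py; rewrite /re_part /im_part py.
Qed.

Lemma tsupp_iter_derive n phi : tsupp (iter n (@test_derive R) phi) `<=` tsupp phi.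
Proof.
elim: n => [|n IHn]; first exact: subset_refl.
exact: subset_trans (@tsupp_derive _) IHn.
Qed.

Lemma vanishes_iter_derive n T U : vanishes_on T U -> forall phi,
  compact (tsupp phi) -> tsupp phi `<=` U -> T (iter n (@test_derive R) phi) = 0.
Proof.
move=> TU phi cphi sphi; apply: TU; last exact: subset_trans (@tsupp_iter_derive _ _) sphi.
apply: subclosed_compact cphi (@tsupp_iter_derive _ _); exact: closed_closure.
Qed.

Lemma bspline_vanishes rho (a : nat -> R) n (U : set R) : increasing_nodes rho a ->
  (forall x, U x -> (x < a 0%N) || (a rho < x)) ->
  vanishes_on (iter n (@dderive R) (bspline rho a)) U.
Proof.
move=> ia Ua phi cphi sphi; rewrite iter_dderiveE.
set psi := iter n _ phi; have spsi : tsupp psi `<=` U.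
  exact: subset_trans (@tsupp_iter_derive n phi) sphi.
suff -> : bspline rho a psi = 0 by rewrite mulr0.
case: rho ia Ua => [|r] ia Ua.
  apply: notin_tsupp => /spsi/Ua; rewrite ltxx //.
have z x : bspline_fun r.+1 a x = 0 \/ psi x = 0.
  have [Ux|nUx] := pselect (U x).
    left; apply: bspline_fun_out => //.
    by case/orP: (Ua x Ux) => [/ltW->//|->]; rewrite orbT.
  by right; apply: notin_tsupp => /spsi.
have int0 (f : R -> R) : (forall x, f x = 0) -> \int[lebesgue_measure]_x f x = 0.
  move=> f0; have -> : f = cst 0 by apply/funext.
  by rewrite /Rintegral /= integral0.
apply: complex_ext.
  apply: (int0 (fun x => bspline_fun r.+1 a x * re_part psi x)) => x.
  by rewrite /re_part; case: (z x) => ->; rewrite ?mul0r ?mulr0.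
apply: (int0 (fun x => bspline_fun r.+1 a x * im_part psi x)) => x.
by rewrite /im_part; case: (z x) => ->; rewrite ?mul0r ?mulr0.
Qed.

Lemma Edual_pairing (T : nat -> testfun R -> R[i]^o) u :
  (forall i, Edual R (T i)) -> Edual R (pairing T u).
Proof.
move=> ET; rewrite /pairing; elim/big_ind: _ => [|S S' ES ES'|i _].
- exact: Edual0.
- by rewrite -[S]scale1r; exact: Edual_lin.
- by rewrite -[_ *: _]addr0; exact: (Edual_lin _ (ET i) (@Edual0 R)).
Qed.

(** Both sides are elements of E'(R) applied to [phi], so their equality on polynomials extends by
    density. *)
Lemma derivative_moments T (C : R[i]) n rho (c : {poly R[i]}) : Edual R T ->
  (forall P, T (polytest P^`(rho)) = C * pairing (fun j => (P^`(n)).[j%:R] : R[i]^o) c) ->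
  forall phi, T (iter rho (@test_derive R) phi) =
    C * pairing (fun j => iter n (@cderive R) phi j%:R : R[i]^o) c.
Proof.
move=> ET TE phi.
pose S := C *: pairing (fun j => (-1) ^+ n *: iter n (@dderive R) (Dirac j%:R)) c.
have sgn m : (-1) ^+ m * (-1) ^+ m = 1 :> R[i].
  by rewrite -exprD addnn -mul2n exprM sqrrN expr1n expr1n.
have SE psi : S psi = C * pairing (fun j => iter n (@cderive R) psi j%:R : R[i]^o) c.
  rewrite -[LHS]/(C * _) pairing_eval; congr (_ * _); apply: eq_pairing => j.
  rewrite -[LHS]/((-1) ^+ n * _) iter_dderiveE mulrA sgn mul1r /Dirac.
  by rewrite iter_test_derive.
have ES : Edual R S.
  rewrite -[S]addr0; apply: Edual_lin; last exact: Edual0.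
  apply: Edual_pairing => j; rewrite -[_ *: _]addr0; apply: Edual_lin; last exact: Edual0.
  by apply: Edual_iter_derive; exact: Edual_Dirac.
have ES' : Edual R ((-1) ^+ rho *: iter rho (@dderive R) T + 0).
  apply: Edual_lin; last exact: Edual0.
  exact: Edual_iter_derive.
have TS psi : ((-1) ^+ rho *: iter rho (@dderive R) T + 0) psi = T (iter rho (@test_derive R) psi).
  rewrite addr0 -[LHS]/((-1) ^+ rho * _) iter_dderiveE mulrA sgn mul1r //.
rewrite -TS -SE; congr (_ phi); apply: Edual_ext => // P.
rewrite TS SE iter_test_derive_poly TE; congr (_ * _); apply: eq_pairing => j.
by rewrite iter_cderive_poly /poly_fun rmorph_nat.
Qed.

(** Test with derivatives of a function supported within 1/2 of [j] whose [n]-th derivative at [j]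
    is nonzero: among the integers only [j] contributes. *)
Lemma not_vanishes T (C : R[i]) n rho (c : {poly R[i]}) (j : nat) U : Edual R T -> C != 0 ->
  (forall P, T (polytest P^`(rho)) = C * pairing (fun j => (P^`(n)).[j%:R] : R[i]^o) c) ->
  c`_j != 0 -> `[j%:R - 1 / 2, j%:R + 1 / 2]%classic `<=` U -> ~ vanishes_on T U.
Proof.
move=> ET C0 TE cj jU TU; have [phi [cphi sphi pj]] := local_test n (j%:R : R).
have := vanishes_iter_derive rho TU cphi (subset_trans sphi jU).
rewrite (derivative_moments ET TE) => /eqP; apply/negP; apply: mulf_neq0 => //.
have -> : pairing (fun j => iter n (@cderive R) phi j%:R : R[i]^o) c =
    c`_j * iter n (@cderive R) phi j%:R.
  have jc : (j < size c)%N by rewrite ltnNge; apply: contra cj => /(nth_default 0)/eqP.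
  rewrite /pairing (bigD1 (Ordinal jc)) //= big1 ?addr0 // => i ij.
  rewrite -iter_test_derive notin_tsupp ?scaler0 // => /tsupp_iter_derive/sphi.
  rewrite /= in_itv /= => /andP[h1 h2]; case/eqP: ij; apply: val_inj => /=.
  apply/eqP; rewrite -(eqr_nat R); case: (ltngtP (i : nat) j) => [h|h|->] //.
    have : (i.+1%:R : R) <= j%:R by rewrite ler_nat.
    by rewrite -natr1; lra.
  have : (j.+1%:R : R) <= i%:R by rewrite ler_nat.
  by rewrite -natr1; lra.
exact: (mulf_neq0 cj pj).
Qed.

End supports.

(** All steps of (0, ..., k) are 1, so the identification applies to this tuple before [k_left] and
    [k_right] are known. *)
Lemma iota_row_e k l r : knots_e l r (iota_row k).
Proof.
exists 1; split=> //; exists (\row_(i < k.+1) (i%:Z)).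
  split=> [i j ij|i j ji _]; rewrite !mxE ?ltr_nat //.
  by rewrite ji; lia.
by apply/rowP => i; rewrite !mxE mul1r.
Qed.

Lemma bspline_symbol_coef (R : realType) l rho :
  (bspline_symbol R l rho)`_l != 0 /\ (bspline_symbol R l rho)`_(l + rho) != 0.
Proof.
have sE : bspline_symbol R l rho = ('X - 1) ^+ rho * 'X^l by rewrite mulrC.
have X1 : 'X - 1 = 'X - 1%:P :> {poly R[i]} by rewrite polyC1.
rewrite sE !coefMXn !ltnNge leqnn leq_addr /= subnn addKn; split.
  rewrite -horner_coef0 horner_exp X1 hornerXsubC sub0r expf_neq0 //.
have m : ('X - 1) ^+ rho \is @monic R[i] by rewrite X1 monic_exp // monicXsubC.
have := monicP m; rewrite /lead_coef X1 size_exp_XsubC /= => ->.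
exact: oner_neq0.
Qed.

Section extremal_integers.
Variables (R : realType) (k : nat) (F : 'rV[rat]_k.+1 -> testfun R -> R[i]^o).
Hypothesis F_dual : forall a, knots k a -> Edual R (F a).
Variables (l rho n : nat) (C c : R[i]).
Hypothesis lk : (l + rho <= k)%N.
Hypothesis C0 : C != 0.
Hypothesis moments : forall P, F (iota_row k) (polytest P^`(rho)) =
  C * pairing (fun j => (P^`(n)).[j%:R] : R[i]^o) (bspline_symbol R l rho).
Hypothesis spline : F (iota_row k) = c *: iter n (@dderive R)
  (bspline rho (fun j => ratr (iota_row k 0 (inord (l + j))))).

Let T := F (iota_row k).
Let nodes j : R := ratr (iota_row k 0 (inord (l + j))).

Let nodesE j : (j <= rho)%N -> nodes j = (l + j)%:R.
Proof.
move=> jr; rewrite /nodes mxE inordK ?ratr_nat //.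
by rewrite ltnS (leq_trans _ lk) // leq_add2l.
Qed.

Let spline_vanishes (U : set R) :
  (forall x, U x -> (x < l%:R) || ((l + rho)%:R < x)) -> vanishes_on T U.
Proof.
move=> lU phi cphi sphi; rewrite /T spline -[LHS]/(c * _) (@bspline_vanishes _ _ _ _ U) ?mulr0 //.
  by move=> i ir; rewrite -/(nodes _) -/(nodes _) !nodesE ?ltr_nat ?ltn_add2l // ltnW.
by move=> x /lU; rewrite -/(nodes 0%N) -/(nodes rho) !nodesE // addn0.
Qed.

Let T_dual : Edual R T. Proof. by apply: F_dual; exact: knots_iota. Qed.

(** A half-line ending at an integer above [l] contains a neighbourhood of [l] of radius 1/2, and
    there [T] does not vanish because the symbol has a nonzero coefficient at [l]. *)
Lemma k_leftE : k_left F = l.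
Proof.
pose A : set int := [set i | vanishes_on T [set` `]-oo, i%:~R[]].
(* In [k_left] the choice is made among natural numbers, embedded in the integers, so the absolute
   value disappears by conversion. *)
rewrite -[LHS]/(xget 0 (fun i : nat => (A `&` ubound A) i%:Z)).
have Al : A l%:Z.
  by apply: spline_vanishes => x; rewrite /= in_itv /= => ->.
have ub : ubound A l%:Z.
  move=> i Ai; rewrite leNgt; apply/negP => li.
  apply: (not_vanishes T_dual C0 moments (bspline_symbol_coef R l rho).1 _ Ai) => x /=.
  rewrite !in_itv /= => /andP[_ xl]; apply: le_lt_trans xl _.
  have : ((l%:Z + 1)%:~R : R) <= i%:~R by rewrite ler_int lezD1.
  by rewrite rmorphD /=; lra.
apply: xget_unique => [|i [Ai ui]]; first by split.
by apply/eqP; rewrite -eqz_nat eq_le ub //= ui.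
Qed.

Lemma k_rightE : k_right F = (l + rho)%N.
Proof.
pose A : set int := [set i | vanishes_on T [set` `]i%:~R, +oo[]].
rewrite -[LHS]/(xget 0 (fun i : nat => (A `&` lbound A) i%:Z)).
have Al : A (l + rho)%N%:Z.
  by apply: spline_vanishes => x; rewrite /= in_itv /= andbT => ->; rewrite orbT.
have lb : lbound A (l + rho)%N%:Z.
  move=> i Ai; rewrite leNgt; apply/negP => il.
  apply: (not_vanishes T_dual C0 moments (bspline_symbol_coef R l rho).2 _ Ai) => x /=.
  rewrite !in_itv /= andbT => /andP[xl _]; apply: lt_le_trans xl.
  have : ((i + 1)%:~R : R) <= (l + rho)%:R.
    by rewrite -[X in _ <= X]/((l + rho)%N%:Z%:~R) ler_int lezD1.
  by rewrite rmorphD /=; lra.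
apply: xget_unique => [|i [Ai ui]]; first by split.
by apply/eqP; rewrite -eqz_nat eq_le lb // andbT ui.
Qed.

End extremal_integers.

Theorem theorem2p3 (R : realType) (k : nat) (hk : (1 <= k)%N)
    (F : {fun knots k >-> Edual R})
    (F_neq0 : exists2 a, knots k a & F a <> 0)
    (F_supp : support_condition F)
    (F_span : span_condition F)
    (F_trans : translation_invariance F)
    (F_dil : dilation_invariance F) :
  exists n : nat, forall a, knots_e (k_left F) (k_right F) a ->
    exists2 c : R[i], c != 0 &
      F a = c *: iter n (@dderive R)
        (bspline (k_right F - k_left F)%N
           (fun j => ratr (a 0 (inord (k_left F + j))))).
Proof.
have F_dual a : knots k a -> Edual R (F a) by move=> ka; exact: funS.
have [p [l [rho [n [C [pE lk C0 CE cp]]]]]] := base_moments F_neq0 F_dual F_span F_trans F_dil.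
have id := spline_identification F_dual F_trans F_dil pE lk C0 CE cp.
have [c _ TE] := id _ (iota_row_e _ _ _).
exists n; rewrite (k_leftE F_dual lk C0 CE TE) (k_rightE F_dual lk C0 CE TE) addKn.
exact: id.
Qed.
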